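(* A $(1,1)$-current $\omega$ on $\mathbb R^n$ can be written $\omega=dd^\#\psi$, where $\psi$ is a 1-homogeneous function, if and only if $d\omega=0$ and $\delta^\#\omega=0$.
   Context: A superform of bidegree $(p,q)$ on $\mathbb R^n$ is a form $\alpha=\sum_{|I|=p,|K|=q}\alpha_{IK}(x)\,dx_I\wedge d\xi_K$ on $\mathbb R^n_x\times\mathbb R^n_\xi$ whose coefficients depend only on $x$; $d$ is the exterior derivative. A current of bidegree $(p,q)$ has the same expression with the coefficients $\alpha_{IK}$ being (signed) measures on $\mathbb R^n$ (viewed as generalized functions), $d$ being taken in the distribution sense. For a function $\psi$, $d^\#\psi=\sum_j\frac{\partial\psi}{\partial x_j}d\xi_j$, so $dd^\#\psi=\sum_{j,k}\frac{\partial^2\psi}{\partial x_j\partial x_k}dx_j\wedge d\xi_k$ (distribution derivatives). $\delta^\#$ denotes contraction with the vector field $E^\#=\sum_jx_j\,\partial/\partial\xi_j$. A function $\psi$ is 1-homogeneous if $\psi(tx)=t\psi(x)$ for $t>0$. *)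

(* Defs.v *)
From HB Require Import structures.
From mathcomp Require Import all_boot all_order all_algebra.
From mathcomp Require Import all_classical all_reals all_analysis measurable_realfun.

Set Implicit Arguments.
Unset Strict Implicit.
Unset Printing Implicit Defensive.

Import Order.TTheory GRing.Theory Num.Theory.
Import numFieldNormedType.Exports.

Local Open Scope classical_set_scope.
Local Open Scope ring_scope.

HB.instance Definition _ (R : realType) (m n : nat) :=
  @isMeasurable.Build (sigma_display (@open 'M[R]_(m, n))) 'M[R]_(m, n)
    <<s @open 'M[R]_(m, n) >>
    (@sigma_algebra0 _ setT (@open 'M[R]_(m, n)))
    (@sigma_algebraC _ (@open 'M[R]_(m, n)))
    (@sigma_algebra_bigcup _ setT (@open 'M[R]_(m, n))).

Section lebesgue_rV.
Variable R : realType.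

Lemma open_measurable_mx m n (U : set 'M[R]_(m, n)) : open U -> measurable U.
Proof. exact: sub_gen_smallest. Qed.

Lemma measurable_coord m n (i : 'I_m) (j : 'I_n) :
  measurable_fun setT (fun x : 'M[R]_(m, n) => x i j).
Proof.
apply: (measurability _ (RGenOInfty.measurableE R)).
move=> _ [_ [a ->] <-]; rewrite setTI.
apply: open_measurable_mx; apply: open_comp; last first.
  by rewrite set_itvE; exact: open_gt.
by move=> x _; exact: coord_continuous.
Qed.

(* An open set is a countable union of balls (that is, cubes) with rational
   centre, so the Borel sigma-algebra is generated by the coordinates. *)
Lemma measurable_fun_rV d (T : measurableType d) n (f : T -> 'rV[R]_n) :
  (forall j, measurable_fun setT (fun x => f x ord0 j)) ->
  measurable_fun setT f.
Proof.
move=> mf; apply: (measurability (@open 'rV[R]_n)) => //.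
move=> _ [U oU <-]; rewrite setTI.
pose c (q : 'rV[rat]_n) : 'rV[R]_n := map_mx ratr q.
pose B (p : 'rV[rat]_n * nat) : set 'rV[R]_n :=
  [set y | ball (c p.1) p.2.+1%:R^-1 y /\ ball (c p.1) p.2.+1%:R^-1 `<=` U].
have -> : U = \bigcup_p B p.
  rewrite eqEsubset; split=> [x Ux|x [p _ [xB]]]; last exact.
  have /nbhs_ballP[e/= e0 eU] := open_nbhs_nbhs (conj oU Ux).
  have e20 : 0 < e / 2 by rewrite divr_gt0.
  have [k ke] : exists k : nat, k.+1%:R^-1 < e / 2.
    have [k] := ltr_add_invr e20.
    by rewrite add0r => ?; exists k.
  have k0 : 0 < k.+1%:R^-1 :> R by rewrite invr_gt0.
  have /choice[q qP] : forall j, exists r : rat,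
      `|ratr r - x ord0 j| < k.+1%:R^-1.
    move=> j.
    have oB : open (ball (x ord0 j) k.+1%:R^-1) by exact: ball_open.
    have B0 : ball (x ord0 j) k.+1%:R^-1 !=set0.
      by exists (x ord0 j); exact: ballxx.
    have [z [/= xz [r _ rz]]] := @dense_rat R _ B0 oB.
    by exists r; rewrite rz distrC.
  have xB : ball (c (\row_j q j)) k.+1%:R^-1 x.
    by split => // i j; rewrite /ball/= !mxE ord1; exact: qP.
  exists (\row_j q j, k) => //; split => // y yB; apply: eU.
  rewrite [e]splitr; apply: (@ball_triangle _ _ (c (\row_j q j))).
  - by apply: le_ball (ball_sym xB); exact: ltW.
  - by apply: le_ball yB; exact: ltW.
rewrite preimage_bigcup; apply: countable_bigcupT_measurable => [|[q k]].
  exact: countableP.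
have [BU|nBU] := pselect (ball (c q) k.+1%:R^-1 `<=` U); last first.
  rewrite (_ : _ @^-1` _ = set0)//.
  by rewrite -subset0 => t [].
rewrite (_ : _ @^-1` _ = \bigcap_(j in [set: 'I_n])
    ((fun x => f x ord0 j) @^-1` ball (c q ord0 j) k.+1%:R^-1)).
  apply: fin_bigcap_measurable => // j _.
  by rewrite -[X in measurable X]setTI; apply: mf => //; exact: measurable_ball.
rewrite eqEsubset; split=> [t [[_ tB] _] j _|t tB]; first exact: tB.
by split => //; split=> [|i j]; [rewrite invr_gt0|rewrite ord1; exact: tB].
Qed.

Definition cons_rV n (p : R * 'rV[R]_n) : 'rV[R]_n.+1 :=
  \row_j oapp (p.2 ord0) p.1 (unlift ord0 j).

Definition uncons_rV n (x : 'rV[R]_n.+1) : R * 'rV[R]_n :=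
  (x ord0 ord0, \row_j x ord0 (lift ord0 j)).

Lemma cons_rVK n : cancel (@cons_rV n) (@uncons_rV n).
Proof.
move=> [a v]; rewrite /uncons_rV mxE unlift_none /=; congr pair.
by apply/rowP => j; rewrite !mxE liftK.
Qed.

Lemma measurable_cons_rV n : measurable_fun setT (@cons_rV n).
Proof.
apply: measurable_fun_rV => j; under eq_fun do rewrite mxE.
case: unliftP => [i|] _ /=; last exact: measurable_fst.
exact: measurableT_comp (measurable_coord _ _) measurable_snd.
Qed.

Lemma measurable_uncons_rV n : measurable_fun setT (@uncons_rV n).
Proof.
apply: measurable_fun_pair; first exact: measurable_coord.
apply: measurable_fun_rV => j; under eq_fun do rewrite mxE.
exact: measurable_coord.
Qed.

Section lebesgue_step.
Variables (n : nat) (mu : {sigma_finite_measure set 'rV[R]_n -> \bar R}).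

Definition lebesgue_step : set 'rV[R]_n.+1 -> \bar R :=
  pushforward (lebesgue_measure \x mu)%E (@cons_rV n).

Let measurable_pre (A : set 'rV[R]_n.+1) :
  measurable A -> measurable (@cons_rV n @^-1` A).
Proof.
by move=> mA; rewrite -[X in measurable X]setTI; exact: measurable_cons_rV.
Qed.

Let step0 : lebesgue_step set0 = 0%E.
Proof. by rewrite /lebesgue_step /pushforward preimage_set0 measure0. Qed.

Let step_ge0 A : (0 <= lebesgue_step A)%E.
Proof. by rewrite /lebesgue_step /pushforward; exact: measure_ge0. Qed.

Let step_sigma_additive : semi_sigma_additive lebesgue_step.
Proof.
move=> F mF tF mUF; rewrite /lebesgue_step /pushforward preimage_bigcup.
apply: measure_semi_sigma_additive.
- by move=> k; exact: measurable_pre.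
- apply/trivIsetP => /= i j _ _ ij; rewrite -preimage_setI.
  by move/trivIsetP : tF => /(_ _ _ _ _ ij) ->//; rewrite preimage_set0.
- by rewrite -preimage_bigcup; exact: measurable_pre.
Qed.

HB.instance Definition _ := isMeasure.Build _ _ _ lebesgue_step
  step0 step_ge0 step_sigma_additive.

Let step_sigma_finite : sigma_finite setT lebesgue_step.
Proof.
have /sigma_finiteP[F [TF ndF Foo]] := sigma_finiteT (@lebesgue_measure R).
have /sigma_finiteP[G [TG ndG Goo]] := sigma_finiteT mu.
exists (fun k => @uncons_rV n @^-1` (F k `*` G k)).
  rewrite -preimage_bigcup; apply/esym; rewrite -subTset => x _ /=.
  have [k _ Fk] : (\bigcup_k F k) (uncons_rV x).1 by rewrite -TF.
  have [l _ Gl] : (\bigcup_k G k) (uncons_rV x).2 by rewrite -TG.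
  exists (maxn k l) => //; split.
    by move: Fk; exact/subsetPset/ndF/leq_maxl.
  by move: Gl; exact/subsetPset/ndG/leq_maxr.
move=> k; have [mF Fk] := Foo k; have [mG Gk] := Goo k; split.
  rewrite -[X in measurable X]setTI.
  by apply: measurable_uncons_rV => //; exact: measurableX.
rewrite /lebesgue_step /pushforward -comp_preimage.
rewrite (_ : _ \o _ = id); last by apply/funext => p; exact: cons_rVK.
by rewrite preimage_id product_measure1E// lte_mul_pinfty// ge0_fin_numE.
Qed.

HB.instance Definition _ := Measure_isSigmaFinite.Build _ _ _ lebesgue_step
  step_sigma_finite.

End lebesgue_step.

Fixpoint lebesgue_rV n : {sigma_finite_measure set 'rV[R]_n -> \bar R} :=
  if n is m.+1 then lebesgue_step (lebesgue_rV m)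
  else \d_(0 : 'rV[R]_0).

Lemma lebesgue_rV_box n (A : 'I_n -> set R) :
  (forall j, measurable (A j)) ->
  lebesgue_rV n [set x | forall j, A j (x ord0 j)] =
  (\prod_j lebesgue_measure (A j))%E.
Proof.
elim: n A => [|n IHn] A mA /=.
  rewrite big_ord0 diracE mem_set//= => j; by case: j.
transitivity ((lebesgue_measure \x lebesgue_rV n)%E
    (A ord0 `*` [set x : 'rV[R]_n | forall j, A (lift ord0 j) (x ord0 j)])).
  rewrite /lebesgue_step /pushforward; congr (_ _).
  rewrite eqEsubset; split=> [[a v] /= h|[a v] /= [h0 h] j].
    split=> [|j]; first by have := h ord0; rewrite mxE unlift_none.
    by have := h (lift ord0 j); rewrite mxE liftK.
  by rewrite mxE; case: unliftP => [i|] ->.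
have mB : measurable
    [set x : 'rV[R]_n | forall j, A (lift ord0 j) (x ord0 j)].
  rewrite (_ : [set _ | _] = \bigcap_(j in [set: 'I_n])
      ((fun x : 'rV[R]_n => x ord0 j) @^-1` A (lift ord0 j))).
    apply: fin_bigcap_measurable => // j _.
    by rewrite -[X in measurable X]setTI; exact: measurable_coord.
  by rewrite eqEsubset; split=> x h j => [_|]; exact: h.
rewrite product_measure1E//; last exact: mA.
rewrite [RHS]big_ord_recl; congr (_ * _)%E.
by apply: IHn => j; exact: mA.
Qed.

End lebesgue_rV.

Section supercurrents.
Variables (R : realType) (n : nat).
Local Notation E := 'rV[R]_n.

Definition partial (j : 'I_n) (f : E -> R) : E -> R :=
  fun x => 'D_(delta_mx ord0 j) f x.

Definition smooth (f : E -> R) : Prop :=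
  forall s : seq 'I_n, continuous (foldr partial f s) /\
    forall j x, derivable (foldr partial f s) x (delta_mx ord0 j).

Definition test_function (f : E -> R) : Prop :=
  smooth f /\ compact (closure [set x | f x != 0]).

(* A generalized function is given by its pairing with test functions; its
   values at other arguments are irrelevant, hence the equality [gfun_eq].
   Those occurring below are obtained from measures and locally integrable
   functions by differentiation and multiplication by coordinates, so linearity
   and continuity need not be part of the type. *)
Definition gfun : Type := (E -> R) -> R.

Definition gfun_eq (S T : gfun) : Prop :=
  forall f, test_function f -> S f = T f.

Definition gfun0 : gfun := fun=> 0.

Definition gfun_partial (j : 'I_n) (T : gfun) : gfun :=
  fun f => - T (partial j f).

Definition gfun_mul (g : E -> R) (T : gfun) : gfun :=
  fun f => T (fun x => g x * f x).

Definition locally_integrable_rV (psi : E -> R) : Prop :=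
  measurable_fun setT psi /\
  forall K : set E, compact K ->
    (\int[lebesgue_rV R n]_(x in K) `|psi x|%:E < +oo)%E.

Definition gfun_of_fun (psi : E -> R) : gfun :=
  fun f => \int[lebesgue_rV R n]_x (psi x * f x).

(* A signed measure need not have finite total variation on the whole of R^n:
   it is a difference of two Borel measures that are finite on compact sets. *)
Record signed_measure := SignedMeasure {
  spos : {measure set E -> \bar R};
  sneg : {measure set E -> \bar R};
  spos_finite : forall K, compact K -> (spos K < +oo)%E;
  sneg_finite : forall K, compact K -> (sneg K < +oo)%E }.

Definition gfun_of_measure (mu : signed_measure) : gfun :=
  fun f => \int[spos mu]_x f x - \int[sneg mu]_x f x.

(* [a I K] is the coefficient of dx_I /\ dxi_K, where the factors of dx_I and
   dxi_K are in increasing order of their indices. *)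
Definition superform : Type := {set 'I_n} -> {set 'I_n} -> gfun.

Definition superform_eq (a b : superform) : Prop :=
  forall I K, gfun_eq (a I K) (b I K).

Definition superform0 : superform := fun _ _ => gfun0.

Definition is_current (p q : nat) (a : superform) : Prop :=
  forall I K : {set 'I_n}, if (#|I| == p) && (#|K| == q)
    then exists mu : signed_measure, gfun_eq (a I K) (gfun_of_measure mu)
    else gfun_eq (a I K) gfun0.

(* Sign of the permutation sorting the factor of index [j] into place,
   from in front of those with indices in [I] *)
Definition sort_sign (j : 'I_n) (I : {set 'I_n}) : R :=
  (-1) ^+ #|[set i in I | (i < j)%N]%SET|.

(* d (u dx_I /\ dxi_K) = \sum_j (du / dx_j) dx_j /\ dx_I /\ dxi_K *)
Definition ext_d (a : superform) : superform := fun J K f =>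
  \sum_(j in J) sort_sign j J * gfun_partial j (a (J :\ j) K) f.

Definition d_sharp (T : gfun) : superform := fun I K f =>
  if I == finset.set0 then \sum_(j | K == [set j]%SET) gfun_partial j T f else 0.

(* Contraction is an antiderivation of degree -1, so that contracting with
   d / dxi_k maps dx_I /\ dxi_k /\ dxi_L to (-1)^|I| dx_I /\ dxi_L. *)
Definition delta_sharp (a : superform) : superform := fun I L f =>
  \sum_(k | k \notin L) (-1) ^+ #|I| * sort_sign k L *
    gfun_mul (fun x => x ord0 k) (a I (k |: L)) f.

Definition homogeneous1 (psi : E -> R) : Prop :=
  forall (t : R) (x : E), 0 < t -> psi (t *: x) = t * psi x.

End supercurrents.

Arguments superform0 {R n}.

(* Main.v *)
(* If omega = dd^# psi, the two equations follow from the symmetry of second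
   derivatives and from Euler's identity for the first derivatives of psi,
   tested against functions.

   Conversely let omega_jk be the coefficients. Since d omega = 0, the Poincare
   lemma provides u_k with d_j u_k = omega_jk. It is applied through cutoff
   operators that preserve test functions and signed measures, so the u_k are
   signed measures again. Put T = \sum_k x_k u_k, as Euler's identity demands;
   delta^# omega = 0 gives d_j T = u_j, so dd^# T = omega, and T satisfies
   Euler's identity, hence T is homogeneous of degree 1 as a distribution.
   It remains to see that T is a function. A signed measure whose first
   derivatives are signed measures does not charge Lebesgue null sets. So T has
   a density h on the shell 1 <= |x| <= e, and averaging over dilations yields
   the homogeneous density psi(y) = \int_R e^{-r} h(e^r y) dr of T. *)
From HB Require Import structures.
From mathcomp Require Import all_boot all_order all_algebra.
From mathcomp Require Import all_classical all_reals all_analysis measurable_realfun.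
From mathcomp Require Import ring lra.
Require Import Defs.

Set Implicit Arguments.
Unset Strict Implicit.
Unset Printing Implicit Defensive.

Import Order.TTheory GRing.Theory Num.Theory.
Import numFieldNormedType.Exports.

Local Open Scope classical_set_scope.
Local Open Scope ring_scope.

(** * Smooth functions and test functions *)

(** A generalized function is a bare functional, so every operation on it is the transpose of one on
    test functions, which must preserve compact support. Taking a primitive does not; subtracting
    [step] times the full line integral repairs this. With [P = cutoff_proj i] and
    [V = cutoff_prim i] one has [f = P f + d_i (V f)], hence [T f = T (P f) - (d_i T) (V f)]. This
    identity serves twice: it solves [d_j u = w_j] one coordinate after the other, and it writes [T]
    through push-forwards of measures times Lebesgue measure on a line, which charge no set whose
    sections in direction [i] are all null. A Radon-Nikodym density of [T] is determined only almost
    everywhere, whereas [homogeneous1] is a condition at every point; averaging over dilations gives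
    a function that is homogeneous by construction. The origin lies in no dilate of the shell, so
    its mass is computed separately. Both parts of a signed measure may have infinite total mass, so
    identities between signed measures are written as equalities of sums of positive measures, never
    as differences. *)

Section smooth_functions.
Variable R : realType.

(** Restricting to a line turns a directional derivative into a one-variable one, so that the chain
    rule and the mean value theorem of the real line apply. *)
Lemma is_derive_line (V : normedModType R) (f : V -> R) (x v : V) (t l : R) :
  is_derive (t *: v + x) v f l <-> is_derive t 1 (fun h => f (h *: v + x)) l.
Proof.
have E : (fun h : R => h^-1 *: (f (h *: v + (t *: v + x)) - f (t *: v + x))) =
  (fun h : R => h^-1 *: ((fun h => f (h *: v + x)) (h *: (1 : R) + t) -
                         (fun h => f (h *: v + x)) t)).
  by apply/funext => h; rewrite /= scalerDl addrA scaler1.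
split=> -[ex <-].
  by split; rewrite /derivable /derive -?E.
by split; rewrite /derivable /derive ?E.
Qed.

Lemma is_derive_line0 (V : normedModType R) (f : V -> R) (x v : V) (l : R) :
  is_derive x v f l <-> is_derive (0 : R) 1 (fun h => f (h *: v + x)) l.
Proof. by rewrite -is_derive_line scale0r add0r. Qed.

Lemma is_derive_comp_real (V : normedModType R) (f : V -> R) (g : R -> R)
    (x v : V) (a b : R) :
  is_derive (f x) 1 g b -> is_derive x v f a ->
  is_derive x v (g \o f) (b * a).
Proof.
move=> dg /is_derive_line0 df; apply/is_derive_line0.
by apply: (is_derive1_comp (g := fun h => f (h *: v + x))); rewrite // scale0r add0r.
Qed.

Variable n : nat.
Local Notation E := 'rV[R]_n.
Local Notation e := (fun i : 'I_n => delta_mx ord0 i : 'rV[R]_n).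

(** Coinduction principle: [smooth] speaks of all iterated partial derivatives at once, so the
    natural invariant is a class of functions stable under [partial]. *)
Lemma smooth_coind (S : (E -> R) -> Prop) :
  (forall f, S f -> continuous f /\
     forall j, (forall x, derivable f x (e j)) /\ S (partial j f)) ->
  forall f, S f -> smooth f.
Proof.
move=> Scl f Sf s.
have : S (foldr (@partial R n) f s).
  by elim: s => //= j s IH; have [_ /(_ j)[]] := Scl _ IH.
by move=> /Scl[cf df]; split => // j x; have [] := df j.
Qed.

Lemma smooth_partial j (f : E -> R) : smooth f -> smooth (partial j f).
Proof. by move=> sf s; have := sf (rcons s j); rewrite foldr_rcons. Qed.

Lemma smooth_continuous (f : E -> R) : smooth f -> continuous f.
Proof. by move=> /(_ [::])[]. Qed.

Lemma smooth_derivable j (f : E -> R) x : smooth f -> derivable f x (e j).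
Proof. by move=> /(_ [::])[_ /(_ j x)]. Qed.

Lemma smooth_is_derive j (f : E -> R) x :
  smooth f -> is_derive x (e j) f (partial j f x).
Proof. by move=> sf; apply: derivableP; exact: smooth_derivable. Qed.

Lemma partialE j (f df : E -> R) :
  (forall x, is_derive x (e j) f (df x)) -> partial j f = df.
Proof. by move=> h; apply/funext => x; have [_] := h x. Qed.

End smooth_functions.

(** * Flat functions, the source of all cutoffs *)

Section flat_functions.
Variable R : realType.

(** The case [k = 0] is the classical function [e^{-1/x}]; the powers of [1/x] are included so that
    derivatives stay in the linear span of the family. *)
Definition flat (k : nat) (x : R) : R :=
  if 0 < x then x^-1 ^+ k * expR (- x^-1) else 0.

Lemma flat_ge0 k x : 0 <= flat k x.
Proof.
rewrite /flat; case: ifPn => // x0.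
by rewrite mulr_ge0 ?expR_ge0// exprn_ge0// invr_ge0 ltW.
Qed.

Lemma flat_le0 k x : x <= 0 -> flat k x = 0.
Proof. by rewrite /flat leNgt => /negbTE ->. Qed.

Lemma flat_gt0 k x : 0 < x -> 0 < flat k x.
Proof. by move=> x0; rewrite /flat x0 mulr_gt0 ?expR_gt0// exprn_gt0// invr_gt0. Qed.

(** The term of order [k+2] of the exponential series at [1/x] beats the power [x^{-k}] and leaves
    [x^2], one order more than differentiability at 0 requires. *)
Lemma flat_le k x : flat k x <= (k.+2)`!%:R * x ^+ 2.
Proof.
rewrite /flat; case: ifPn => [x0|_]; last by rewrite mulr_ge0// sqr_ge0.
have y0 : 0 < x^-1 by rewrite invr_gt0.
set y := x^-1 in y0 *; have -> : x = y^-1 by rewrite invrK.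
clearbody y.
have fk : 0 < (k.+2)`!%:R :> R by rewrite ltr0n fact_gt0.
have h : y ^+ k.+2 / k.+2`!%:R <= expR y.
  by apply: le_trans (expR_ge1Dxn k.+1 (ltW y0)); rewrite lerDr.
rewrite expRN ler_pdivrMr ?expR_gt0// exprVn [leRHS]mulrAC.
rewrite ler_pdivlMr ?exprn_gt0//.
by rewrite -exprD addn2 mulrC -ler_pdivrMr.
Qed.

Lemma is_derive_flat k (x : R) :
  is_derive x 1 (flat k) (flat k.+2 x - k%:R * flat k.+1 x).
Proof.
have [x0|x0|->] := ltgtP x 0.
- rewrite !flat_le0 ?(ltW x0)// mulr0 subr0.
  have d0 := is_derive_cst (0 : R) x 1.
  apply: near_eq_is_derive d0.
  near=> y; rewrite flat_le0// ltW//; near: y.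
  exact: lt_nbhsl.
- have xn0 : x != 0 by rewrite gt_eqF.
  have dV : is_derive x 1 (fun x : R => x^-1) (- x^-1 ^+ 2).
    split; first exact: derivableV.
    by rewrite deriveV// derive_id; rewrite exprVn /GRing.scale/= mulr1.
  have dE : is_derive x 1 (expR \o (fun x : R => - x^-1)) (expR (- x^-1) * x^-1 ^+ 2).
    apply: is_derive1_comp; apply: is_derive_eq; by rewrite opprK.
  have dX : is_derive x 1 (fun x : R => x^-1 ^+ k) (k%:R * x^-1 ^+ k.-1 * - x^-1 ^+ 2).
    by have := is_deriveX k dV; rewrite exprfctE.
  have dF : is_derive x 1 ((fun x : R => x^-1 ^+ k) * (expR \o (fun x : R => - x^-1)))
      (flat k.+2 x - k%:R * flat k.+1 x).
    apply: (is_derive_eq (is_deriveM dX dE)).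
    rewrite /flat x0 /GRing.scale /=.
    case: k {dX} => [|k]; first by rewrite ?expr0 ?mul0r ?mulr0 ?addr0 /=; ring.
    by rewrite !exprS /=; ring.
  apply: near_eq_is_derive dF.
  near=> y; rewrite /flat ifT//; near: y.
  exact: lt_nbhsr.
- rewrite !flat_le0// mulr0 subr0.
  (* By [flat_le] the difference quotient at 0 is at most a constant times [|h|]. *)
  have h : h^-1 *: (flat k (h *: (1:R) + 0) - flat k 0) @[h --> 0^'] --> (0:R).
    rewrite (flat_le0 _ (lexx 0)).
    apply/cvgr0Pnorm_le => eps eps0; near=> h.
    have hn0 : h != 0 by near: h; exact: nbhs_dnbhs_neq.
    rewrite scaler1 addr0 subr0 normrM normfV ger0_norm ?flat_ge0//.
    rewrite ler_pdivrMl ?normr_gt0//; apply: (le_trans (flat_le _ _)).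
    rewrite -real_normK ?num_real// expr2 mulrCA ler_wpM2l//.
    rewrite -ler_pdivlMl ?ltr0n ?fact_gt0//.
    near: h; apply: dnbhs0_le; rewrite mulr_gt0// invr_gt0 ltr0n fact_gt0//.
  by split; [apply/cvg_ex; exists 0|exact/cvg_lim].
Unshelve. all: by end_near.
Qed.

End flat_functions.

Section smooth_closure.
Variables (R : realType) (n : nat).
Local Notation E := 'rV[R]_n.
Local Notation e := (fun i : 'I_n => delta_mx ord0 i : 'rV[R]_n).

(* Closed under partial derivatives, which yields all closure properties of
   [smooth] at once. *)
Inductive smooth_expr : (E -> R) -> Prop :=
| smooth_expr_base f : smooth f -> smooth_expr f
| smooth_expr_cst a : smooth_expr (fun=> a)
| smooth_expr_coord i : smooth_expr (fun x => x ord0 i)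
| smooth_expr_add f g :
    smooth_expr f -> smooth_expr g -> smooth_expr (fun x => f x + g x)
| smooth_expr_mul f g :
    smooth_expr f -> smooth_expr g -> smooth_expr (fun x => f x * g x)
| smooth_expr_exp f : smooth_expr f -> smooth_expr (fun x => expR (f x))
| smooth_expr_flat k f : smooth_expr f -> smooth_expr (fun x => flat k (f x))
| smooth_expr_inv f : smooth_expr f -> (forall x, f x != 0) ->
    smooth_expr (fun x => (f x)^-1).

Lemma is_derive_coord (i j : 'I_n) (x : E) :
  is_derive x (e j) (fun x : E => x ord0 i) (i == j)%:R.
Proof.
apply/is_derive_line0.
rewrite (_ : (fun h : R => _) = (fun h : R => (i == j)%:R * h + x ord0 i)).
  by apply: is_derive_eq; rewrite addr0 /GRing.scale/= mulr1.
by apply/funext => h; rewrite !mxE eqxx /= mulrC.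
Qed.

Lemma continuous_flat k : continuous (@flat R k).
Proof.
move=> x; apply/differentiable_continuous/derivable1_diffP.
by have [] := is_derive_flat k x.
Qed.

Lemma smooth_expr_step f : smooth_expr f ->
  continuous f /\
  forall j, exists2 df, smooth_expr df & forall x, is_derive x (e j) f (df x).
Proof.
elim=> {f} [f sf|a|i|f g sf [cf df] sg [cg dg]|f g sf [cf df] sg [cg dg]
           |f sf [cf df]|k f sf [cf df]|f sf [cf df] fn0].
- split => [|j]; first exact: smooth_continuous.
  exists (partial j f); first by apply: smooth_expr_base; exact: smooth_partial.
  by move=> x; exact: smooth_is_derive.
- split => [|j]; first exact: cst_continuous.
  by exists (fun=> 0) => [|x]; [exact: smooth_expr_cst|exact: is_derive_cst].
- split => [|j]; first by move=> x; exact: coord_continuous.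
  exists (fun=> (i == j)%:R); first exact: smooth_expr_cst.
  by move=> x; exact: is_derive_coord.
- split => [|j]; first by move=> x; exact: cvgD (cf x) (cg x).
  have [df' sdf fdf] := df j; have [dg' sdg gdg] := dg j.
  exists (fun x => df' x + dg' x); first exact: smooth_expr_add.
  by move=> x; have := is_deriveD (fdf x) (gdg x).
- split => [|j]; first by move=> x; exact: cvgM (cf x) (cg x).
  have [df' sdf fdf] := df j; have [dg' sdg gdg] := dg j.
  exists (fun x => f x * dg' x + g x * df' x).
    by apply: smooth_expr_add; exact: smooth_expr_mul.
  by move=> x; have := is_deriveM (fdf x) (gdg x).
- split => [|j].
    by move=> x; apply: continuous_comp; [exact: cf|exact: continuous_expR].
  have [df' sdf fdf] := df j.
  exists (fun x => expR (f x) * df' x).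
    by apply: smooth_expr_mul => //; exact: smooth_expr_exp.
  by move=> x; apply: is_derive_comp_real.
- split => [|j].
    by move=> x; apply: continuous_comp; [exact: cf|exact: continuous_flat].
  have [df' sdf fdf] := df j.
  exists (fun x => (flat k.+2 (f x) + (- k%:R) * flat k.+1 (f x)) * df' x).
    apply: smooth_expr_mul => //; apply: smooth_expr_add.
      exact: smooth_expr_flat.
    by apply: smooth_expr_mul; [exact: smooth_expr_cst|exact: smooth_expr_flat].
  move=> x; rewrite mulNr; apply: is_derive_comp_real => //.
  exact: is_derive_flat.
- split => [|j]; first by move=> x; apply: cvgV (cf x).
  have [df' sdf fdf] := df j.
  exists (fun x => (-1) * ((f x)^-1 * (f x)^-1 * df' x)).
    apply: smooth_expr_mul; first exact: smooth_expr_cst.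
    by do 2 apply: smooth_expr_mul => //; exact: smooth_expr_inv.
  move=> x; have [fx <-] := fdf x; split; first exact: derivableV.
  by rewrite deriveV// /GRing.scale/= mulN1r -mulNr -invfM expr2.
Qed.

Lemma smooth_exprP f : smooth_expr f -> smooth f.
Proof.
apply: smooth_coind => {}f /smooth_expr_step[cf df]; split => // j.
have [df' sdf fdf] := df j.
by rewrite (partialE fdf); split => // x; have [] := fdf x.
Qed.

Lemma smooth_cst a : smooth (fun _ : E => a).
Proof. exact/smooth_exprP/smooth_expr_cst. Qed.

Lemma smooth_coord i : smooth (fun x : E => x ord0 i).
Proof. exact/smooth_exprP/smooth_expr_coord. Qed.

Lemma smoothD (f g : E -> R) :
  smooth f -> smooth g -> smooth (fun x => f x + g x).
Proof.
by move=> sf sg; apply/smooth_exprP/smooth_expr_add; exact: smooth_expr_base.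
Qed.

Lemma smoothM (f g : E -> R) :
  smooth f -> smooth g -> smooth (fun x => f x * g x).
Proof.
by move=> sf sg; apply/smooth_exprP/smooth_expr_mul; exact: smooth_expr_base.
Qed.

Lemma smoothB (f g : E -> R) :
  smooth f -> smooth g -> smooth (fun x => f x - g x).
Proof.
move=> sf sg; have := smoothD sf (smoothM (smooth_cst (-1)) sg).
by congr smooth; apply/funext => x; rewrite mulN1r.
Qed.

Lemma partialD j (f g : E -> R) : smooth f -> smooth g ->
  partial j (fun x => f x + g x) = fun x => partial j f x + partial j g x.
Proof.
move=> sf sg; apply: partialE => x.
exact: is_deriveD (smooth_is_derive _ _ sf) (smooth_is_derive _ _ sg).
Qed.

Lemma partialB j (f g : E -> R) : smooth f -> smooth g ->
  partial j (fun x => f x - g x) = fun x => partial j f x - partial j g x.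
Proof.
move=> sf sg; apply: partialE => x.
exact: is_deriveB (smooth_is_derive _ _ sf) (smooth_is_derive _ _ sg).
Qed.

Lemma partialM j (f g : E -> R) : smooth f -> smooth g ->
  partial j (fun x => f x * g x) =
  fun x => f x * partial j g x + g x * partial j f x.
Proof.
move=> sf sg; apply: partialE => x.
exact: is_deriveM (smooth_is_derive _ _ sf) (smooth_is_derive _ _ sg).
Qed.

Lemma partial_cst j (a : R) : partial j (fun _ : E => a) = fun=> 0.
Proof. by apply: partialE => x; exact: is_derive_cst. Qed.

Lemma partial_coordM j i (f : E -> R) : smooth f ->
  partial j (fun x => x ord0 i * f x) =
  fun x => (i == j)%:R * f x + x ord0 i * partial j f x.
Proof.
move=> sf; apply: partialE => x; rewrite addrC (mulrC _ (f x)).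
exact: is_deriveM (is_derive_coord _ _ _) (smooth_is_derive _ _ sf).
Qed.

End smooth_closure.

Section test_functions.
Variables (R : realType) (n : nat).
Local Notation E := 'rV[R]_n.
Local Notation e := (fun i : 'I_n => delta_mx ord0 i : 'rV[R]_n).

Lemma coord_le_norm (x : E) i : `|x ord0 i| <= `|x|.
Proof.
rewrite [leRHS]/Num.norm/= mx_normrE; apply/bigmax_geP; right.
by exists (ord0, i).
Qed.

Lemma norm_le_coord (x : E) (M : R) :
  0 <= M -> (forall i, `|x ord0 i| <= M) -> `|x| <= M.
Proof.
move=> M0 h; rewrite [leLHS]/Num.norm/= mx_normrE; apply/bigmax_leP; split=> //.
by move=> [a b] _ /=; rewrite (ord1 a).
Qed.

Lemma compact_norm_le (K : set E) :
  compact K -> exists2 M : R, 0 <= M & forall x : E, K x -> `|x| <= M.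
Proof.
move=> /compact_bounded [M [_ hM]]; exists (`|M| + 1).
  by rewrite addr_ge0.
by move=> x Kx; apply: (hM (`|M| + 1)) => //; rewrite (le_lt_trans (ler_norm M))// ltrDl.
Qed.

Lemma closed_norm_le (M : R) : closed [set x : E | `|x| <= M].
Proof.
apply: (@closed_comp _ _ (fun x : E => `|x|) [set y | y <= M]).
  by move=> x _; exact: norm_continuous.
exact: closed_le.
Qed.

Lemma compact_cube (M : R) : compact [set x : E | `|x| <= M].
Proof.
apply: bounded_closed_compact; last exact: closed_norm_le.
by exists M; split; [exact: num_real|move=> N MN x /= xM; exact: le_trans xM (ltW MN)].
Qed.

Lemma test_functionP (f : E -> R) :
  test_function f <-> smooth f /\ exists M, forall x, f x != 0 -> `|x| <= M.
Proof.
split=> -[sf cf]; split=> //.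
  have [M M0 hM] := compact_norm_le cf.
  by exists M => x fx; apply: hM; exact: subset_closure.
have [M hM] := cf; apply: (subclosed_compact _ (@compact_cube M)).
  exact: closed_closure.
have := @closed_norm_le M; rewrite closure_id => ->; exact: closure_subset.
Qed.

Lemma test_smooth (f : E -> R) : test_function f -> smooth f.
Proof. by case. Qed.

Lemma test_bounded_support (f : E -> R) : test_function f ->
  exists2 M : R, 0 <= M & forall x : E, M < `|x| -> f x = 0.
Proof.
move=> /test_functionP[_ [M hM]]; exists (Num.max 0 M); first by rewrite le_max lexx.
move=> x; rewrite gt_max => /andP[_ Mx]; apply/eqP; apply: contraTT Mx => /hM.
by rewrite leNgt.
Qed.

Lemma test_intro (f : E -> R) (M : R) : smooth f ->
  (forall x, M < `|x| -> f x = 0) -> test_function f.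
Proof.
move=> sf h; apply/test_functionP; split=> //; exists M => x.
by apply: contraNT; rewrite -ltNge => /h ->.
Qed.

Lemma test_function0 : test_function (fun _ : E => 0 : R).
Proof. by apply: (@test_intro _ 0) => //; exact: smooth_cst. Qed.

Lemma test_functionD (f g : E -> R) : test_function f -> test_function g ->
  test_function (fun x => f x + g x).
Proof.
move=> tf tg; have [M _ hM] := test_bounded_support tf.
have [N _ hN] := test_bounded_support tg.
apply: (@test_intro _ (Num.max M N)); first exact: smoothD (test_smooth tf) (test_smooth tg).
by move=> x; rewrite gt_max => /andP[/hM -> /hN ->]; rewrite addr0.
Qed.

Lemma test_functionMr (f g : E -> R) : smooth f -> test_function g ->
  test_function (fun x => f x * g x).
Proof.
move=> sf tg; have [N _ hN] := test_bounded_support tg.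
apply: (@test_intro _ N); first exact: smoothM (test_smooth tg).
by move=> x /hN ->; rewrite mulr0.
Qed.

Lemma test_coordM i (f : E -> R) : test_function f ->
  test_function (fun x => x ord0 i * f x).
Proof. by apply: test_functionMr; exact: smooth_coord. Qed.

Lemma test_sum (I : Type) (s : seq I) (f : I -> E -> R) :
  (forall i, test_function (f i)) -> test_function (fun x => \sum_(i <- s) f i x).
Proof.
move=> tf; elim: s => [|i s IH].
  under eq_fun do rewrite big_nil.
  exact: test_function0.
under eq_fun do rewrite big_cons.
exact: test_functionD.
Qed.

Lemma partial_eq0 j (f : E -> R) x :
  (\forall h \near (0 : R), f (h *: e j + x) = 0) -> partial j f x = 0.
Proof.
move=> h.
have d0 : is_derive (0 : R) 1 (fun h => f (h *: e j + x)) 0.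
  apply: near_eq_is_derive (is_derive_cst (0 : R) (0:R) (1:R)).
  by apply: filterS h => y ->.
by have [_] := (is_derive_line0 _ _ _ _).2 d0.
Qed.

Lemma near_line (v x : E) (A : set E) : open A -> A x ->
  \forall h \near (0 : R), A (h *: v + x).
Proof.
move=> oA Ax.
have c : (fun h : R => h *: v + x) @ (0 : R) --> 0 *: v + x.
  by apply: cvgD; [apply: cvgZr_tmp; exact: cvg_id|exact: cvg_cst].
rewrite scale0r add0r in c.
exact: c _ (open_nbhs_nbhs (conj oA Ax)).
Qed.

Lemma open_norm_gt (M : R) : open [set x : E | M < `|x|].
Proof.
apply: (@open_comp _ _ (fun x : E => `|x|) [set y | M < y]).
  by move=> x _; exact: norm_continuous.
exact: open_gt.
Qed.

Lemma test_partial j (f : E -> R) : test_function f -> test_function (partial j f).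
Proof.
move=> tf; have [M _ hM] := test_bounded_support tf.
apply: (@test_intro _ M); first exact/smooth_partial/test_smooth.
move=> x Mx; apply: partial_eq0.
by apply: filterS (near_line (e j) (@open_norm_gt M) Mx) => h /= /hM.
Qed.

End test_functions.

(** * Derivatives in arbitrary directions *)

Section chain_rule.
Variables (R : realType) (n : nat).
Local Notation E := 'rV[R]_n.

Lemma line_MVT (f df : E -> R) (v y : E) (a : R) :
  (forall x, is_derive x v f (df x)) ->
  exists2 c : R, `|c| <= `|a| & f (a *: v + y) - f y = a * df (c *: v + y).
Proof.
move=> fdf; pose g h := f (h *: v + y).
have dg (h : R) : is_derive h 1 g (df (h *: v + y)).
  exact: (is_derive_line _ _ _ _ _).1 (fdf _).
have cg (A : set R) : {within A, continuous g}.
  apply: continuous_subspaceT => h; apply/differentiable_continuous/derivable1_diffP.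
  by have [] := dg h.
have g0 : g 0 = f y by rewrite /g scale0r add0r.
have [a0|a0] := leP 0 a.
  have [c /[!in_itv]/= /andP[c0 ca]] := MVT_segment a0 (fun x _ => dg x) (cg _).
  rewrite g0 subr0 mulrC => E1; exists c => //.
  by rewrite !ger0_norm.
have [c /[!in_itv]/= /andP[ac c0]] := MVT_segment (ltW a0) (fun x _ => dg x) (cg _).
rewrite g0 sub0r mulrN mulrC => E1; exists c; first by rewrite !ler0_norm ?lerN2// ltW.
by rewrite -[LHS]opprB -[f (_ + _)]/(g a) E1 opprK.
Qed.

(** [smooth] only provides derivatives along the coordinate axes. The increment is split into a move
    along [v] followed by one along [w]; the mean value theorem writes the second as a value of [df]
    near [x], and [df] is continuous. Adding one coordinate at a time yields the general
    direction. *)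
Lemma is_derive_add_dir (f df : E -> R) (x v w : E) (A c : R) :
  is_derive x v f A -> (forall y, is_derive y w f (df y)) -> continuous df ->
  is_derive x (v + c *: w) f (A + c * df x).
Proof.
move=> fA fdf cdf.
have key : h^-1 *: (f (h *: (v + c *: w) + x) - f x) @[h --> 0^'] --> A + c * df x.
  have [dA vA] := fA.
  have cA : h^-1 *: (f (h *: v + x) - f x) @[h --> 0^'] --> A.
    by rewrite -vA; exact: dA.
  have cB : h^-1 *: (f (h *: (v + c *: w) + x) - f (h *: v + x)) @[h --> 0^']
      --> c * df x.
    have [c0|cn0] := eqVneq c 0.
      rewrite c0 mul0r; apply: cvg_near_cst; near=> h.
      by rewrite scale0r addr0 subrr scaler0.
    apply/cvgrPdist_le => eps eps0.
    have /cvgrPdist_le/(_ (eps / `|c|)) := cdf x.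
    rewrite divr_gt0 ?normr_gt0// => /(_ isT) /nbhs_ballP[d /= d0 dB].
    (* The point given by the mean value theorem lies within [|h| * B] of [x]. *)
    pose B : R := `|c| * `|w| + `|v|.
    have B0 : 0 <= B by rewrite addr_ge0// mulr_ge0.
    near=> h.
    have hn0 : h != 0 by near: h; exact: nbhs_dnbhs_neq.
    have -> : h *: (v + c *: w) + x = (h * c) *: w + (h *: v + x).
      by rewrite scalerDr scalerA addrA [_ *: v + _]addrC.
    have [k kh ->] := line_MVT (h *: v + x) (h * c) fdf.
    rewrite /GRing.scale/= -mulrA mulKf// -mulrBr normrM mulrC -ler_pdivlMr ?normr_gt0//.
    apply: dB; rewrite -ball_normE /=.
    rewrite addrA [_ + x]addrC opprD addrA subrr sub0r normrN.
    apply: (@le_lt_trans _ _ (`|h| * B)).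
      rewrite (le_trans (ler_normD _ _))// !normrZ /B mulrDr lerD2r mulrA ler_wpM2r//.
      by rewrite -normrM.
    apply: (@le_lt_trans _ _ (`|h| * (B + 1))); first by rewrite ler_wpM2l// lerDl.
    rewrite -ltr_pdivlMr ?ltr_wpDl//.
    by near: h; apply: dnbhs0_lt; rewrite divr_gt0// ltr_wpDl.
  rewrite (_ : (fun h => _) = (fun h => h^-1 *: (f (h *: v + x) - f x) +
    h^-1 *: (f (h *: (v + c *: w) + x) - f (h *: v + x)))); first exact: cvgD cA cB.
  by apply/funext => h; rewrite -scalerDr; congr (_ *: _); rewrite [RHS]addrC addrA subrK.
by split; [apply/cvg_ex; eexists; exact: key|exact/cvg_lim].
Unshelve. all: by end_near.
Qed.

Lemma is_derive_smooth (f : E -> R) (x v : E) : smooth f ->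
  is_derive x v f (\sum_j v ord0 j * partial j f x).
Proof.
move=> sf.
rewrite [X in is_derive _ X](row_sum_delta v).
elim: (index_enum _) => [|j s IH]; first by rewrite !big_nil; exact: is_derive0.
rewrite !big_cons addrC [X in is_derive _ _ _ X]addrC.
apply: is_derive_add_dir => //; first by move=> y; exact: smooth_is_derive.
exact/smooth_continuous/smooth_partial.
Qed.

End chain_rule.

Section real_integrable.
Context d (T : measurableType d) (R : realType).
Variables (mu : {measure set T -> \bar R}) (D : set T) (mD : measurable D).
Implicit Types f g : T -> R.

Lemma integrable_realB f g : mu.-integrable D (EFin \o f) ->
  mu.-integrable D (EFin \o g) ->
  mu.-integrable D (EFin \o (fun x => f x - g x)).
Proof.
move=> fi gi; rewrite (_ : _ \o _ = (EFin \o f) \- (EFin \o g))%E.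
  exact: integrableB.
by apply/funext.
Qed.

Lemma integrable_realZ (k : R) f : mu.-integrable D (EFin \o f) ->
  mu.-integrable D (EFin \o (fun x => k * f x)).
Proof.
move=> fi; rewrite (_ : _ \o _ = (fun x => k%:E * (EFin \o f) x))%E.
  exact: integrableZl.
by apply/funext.
Qed.

Lemma integrable_real_le f g : measurable_fun D f ->
  (forall x, D x -> `|f x| <= g x) -> mu.-integrable D (EFin \o g) ->
  mu.-integrable D (EFin \o f).
Proof.
move=> mf fg ig.
refine (@le_integrable _ _ _ mu D mD (EFin \o f) _ _ _ ig).
  exact/measurable_EFinP.
by move=> x Dx /=; rewrite lee_fin (le_trans (fg x Dx))// ler_norm.
Qed.

End real_integrable.

(** * Integration along coordinate lines *)

Section line_integrals.
Variables (R : realType) (n : nat).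
Local Notation E := 'rV[R]_n.
Local Notation e := (fun i : 'I_n => delta_mx ord0 i : 'rV[R]_n).
Local Notation leb := (@lebesgue_measure R).

Lemma integrable_indicZ (K a : R) (B : set R) : measurable B ->
  leb.-integrable B (EFin \o (fun r => K * \1_(`[- a, a]) r)).
Proof.
move=> mB; apply: (integrableS measurableT) => //.
apply: integrable_realZ => //.
exact: (integrable_indic_itv (- a) a true false).
Qed.

Lemma integrable_le_indic (B : set R) (g : R -> R) (K a : R) : measurable B ->
  measurable_fun setT g -> (forall r, `|g r| <= K * \1_(`[- a, a]) r) ->
  leb.-integrable B (EFin \o g).
Proof.
move=> mB mg gK.
refine (@integrable_real_le _ _ _ leb B mB g _ _ _ (integrable_indicZ K a mB)) => //.
exact: measurable_funS mg.
Qed.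

Lemma norm_delta_le1 (i : 'I_n) : `|e i| <= 1.
Proof.
apply: norm_le_coord => // j; rewrite mxE eqxx /=.
by case: (j == i); rewrite ?normr1// normr0.
Qed.

Lemma continuous_cube_bounded (f : E -> R) (M : R) : continuous f ->
  exists2 K : R, 0 <= K & forall x : E, `|x| <= M -> `|f x| <= K.
Proof.
move=> cf.
have : compact (f @` [set x : E | `|x| <= M]).
  by apply: continuous_compact; [exact: continuous_subspaceT|exact: compact_cube].
move=> /compact_bounded [K [_ hK]]; exists (`|K| + 1); first by rewrite addr_ge0.
move=> x xM; apply: (hK (`|K| + 1)); last by exists x.
by rewrite (le_lt_trans (ler_norm K))// ltrDl.
Qed.

Definition strip_supported (i : 'I_n) (f : E -> R) :=
  exists M : R, forall x : E, M < `|x ord0 i| -> f x = 0.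

Lemma line_coord (i j : 'I_n) (r : R) (x : E) :
  (r *: e i + x) ord0 j = (j == i)%:R * r + x ord0 j.
Proof. by rewrite !mxE eqxx /= mulrC. Qed.

(** One majorant for all lines through a cube, used for both continuity and differentiation under
    the integral. If [|r| <= M + C], the point lies in the cube of radius [M + C + C], where [f] is
    bounded; otherwise its i-th coordinate leaves the strip. *)
Lemma strip_bound i (f : E -> R) (C : R) : continuous f -> strip_supported i f ->
  exists K a : R, forall x : E, `|x| <= C -> forall r,
    `|f (r *: e i + x)| <= K * \1_(`[- a, a]) r.
Proof.
move=> cf [M hM].
have [K K0 hK] := continuous_cube_bounded (M + C + C) cf.
exists K, (M + C) => x xC r; rewrite indicE.
have [ra|ra] := leP `|r| (M + C).
  rewrite mem_set ?mulr1; last by rewrite /= in_itv/= -ler_norml.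
  apply: hK; rewrite (le_trans (ler_normD _ _))// lerD// normrZ.
  by rewrite -[leRHS]mulr1; apply: ler_pM => //; exact: norm_delta_le1.
rewrite hM ?normr0; first by rewrite mulr_ge0.
rewrite line_coord eqxx mul1r.
have := coord_le_norm x i; have := ler_normB (r + x ord0 i) (x ord0 i).
rewrite addrK; lra.
Qed.

Lemma continuous_line (i : 'I_n) (x : E) : continuous (fun r : R => r *: e i + x).
Proof. by move=> r; apply: cvgD; [exact: scalel_continuous|exact: cvg_cst]. Qed.

Lemma measurable_line_comp i (f : E -> R) (x : E) : continuous f ->
  measurable_fun setT (fun r : R => f (r *: e i + x)).
Proof.
move=> cf; apply: continuous_measurable_fun => r.
by apply: continuous_comp; [exact: continuous_line|exact: cf].
Qed.

Definition Lint (B : set R) i (f : E -> R) (x : E) : R :=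
  \int[leb]_(r in B) f (r *: e i + x).

Variables (B : set R) (mB : measurable B).

Lemma integrable_line i (f : E -> R) (x : E) : continuous f ->
  strip_supported i f -> leb.-integrable B (EFin \o (fun r => f (r *: e i + x))).
Proof.
move=> cf sf; have [K [a h]] := strip_bound `|x| cf sf.
by apply: (integrable_le_indic (K := K) (a := a)) => //; [exact: measurable_line_comp|exact: h].
Qed.

(** Compactness of [[-a, a]] makes the continuity of [f] uniform along the segment that carries the
    integrals; off the segment both integrands vanish. *)
Lemma continuous_Lint i (f : E -> R) : continuous f -> strip_supported i f ->
  continuous (Lint B i f).
Proof.
move=> cf sf x.
have [K [a h]] := strip_bound (`|x| + 1) cf sf.
pose c := \int[leb]_(r in B) \1_(`[- a, a]) r.
have c0 : 0 <= c by apply: Rintegral_ge0.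
suff : forall eps : R, 0 < eps ->
    \forall y \near x, `|Lint B i f x - Lint B i f y| <= eps.
  by move=> H; apply/(@cvgrPdist_le _ _ _ (nbhs (x : E))).
move=> eps eps0.
(* The summand 1 keeps the denominator positive, as [c] may be 0. *)
pose eta := eps / (c + 1).
have eta0 : 0 < eta by rewrite divr_gt0// ltr_wpDl.
have near1 : \forall y \near x, forall r, `[- a, a]%classic r ->
    `|f (r *: e i + x) - f (r *: e i + y)| < eta.
  have /compact_near_coveringP := @segment_compact R (- a) a.
  move=> /(_ _ (nbhs x) (fun y r => `|f (r *: e i + x) - f (r *: e i + y)| < eta) _).
  apply => r _ /=.
  have c0' : p.1 *: e i @[p --> (nbhs r, nbhs x)] --> r *: e i.
    by apply: cvgZr_tmp; exact: cvg_fst.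
  have c1' : p.1 *: e i + x @[p --> (nbhs r, nbhs x)] --> r *: e i + x.
    by apply: cvgD; [exact: c0'|exact: cvg_cst].
  have c2' : p.1 *: e i + p.2 @[p --> (nbhs r, nbhs x)] --> r *: e i + x.
    by apply: cvgD; [exact: c0'|exact: cvg_snd].
  have c1 := cvg_comp _ _ c1' (cf _).
  have c2 := cvg_comp _ _ c2' (cf _).
  have c3 : f (p.1 *: e i + x) - f (p.1 *: e i + p.2) @[p --> (nbhs r, nbhs x)] --> (0 : R).
    by rewrite -(subrr (f (r *: e i + x))); exact: cvgB c1 c2.
  exact: (cvgr0_norm_lt _ c3 _ eta0).
have near2 : \forall y \near x, `|y| <= `|x| + 1.
  have : \forall z \near `|x|, z < `|x| + 1 by apply: lt_nbhsl; rewrite ltrDl.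
  move=> /(@norm_continuous _ E x) hx.
  by near=> y; apply: ltW; near: y; exact: hx.
near=> y.
have hy : `|y| <= `|x| + 1 by near: y.
have hx : `|x| <= `|x| + 1 by rewrite lerDl.
have hxy : forall r, `|f (r *: e i + x) - f (r *: e i + y)| <= eta * \1_(`[- a, a]) r.
  move=> r; rewrite indicE; case: (boolP (_ \in _)) => [|/negP] ra.
    rewrite mulr1 ltW//; move: r ra; near: y; apply: filterS near1 => y h1 r.
    by move=> /set_mem; exact: h1.
  have := h _ hx r; have := h _ hy r; rewrite indicE (negbTE (introN idP ra)) !mulr0.
  by rewrite !normr_le0 => /eqP -> /eqP ->; rewrite subrr.
have ix := integrable_line x cf sf; have iy := integrable_line y cf sf.
rewrite /Lint -RintegralB//.
have iB : leb.-integrable B (EFin \o (fun r => f (r *: e i + x) - f (r *: e i + y))).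
  exact: integrable_realB.
apply: le_trans (le_normr_Rintegral _ iB) _ => //.
apply: (@le_trans _ _ (\int[leb]_(r in B) (eta * \1_(`[- a, a]) r))).
  apply: le_Rintegral => //; last exact: integrable_indicZ.
  exact: integrable_norm.
rewrite RintegralZl//; last first.
  by have := integrable_indicZ 1 a mB; under eq_fun do rewrite /= mul1r.
rewrite -/c /eta mulrAC ler_pdivrMr ?ltr_wpDl//.
by apply: ler_wpM2l; [exact: ltW|rewrite lerDl].
Unshelve. all: by end_near.
Qed.

Lemma strip_partial i j (f : E -> R) :
  strip_supported i f -> strip_supported i (partial j f).
Proof.
move=> [M hM]; exists M => x Mx; apply: partial_eq0.
have oM : open [set x : E | M < `|x ord0 i|].
  apply: (@open_comp _ _ (fun x : E => `|x ord0 i|) [set y | M < y]).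
    move=> z _; apply: (@continuous_comp _ _ _ (fun x : E => x ord0 i)).
      exact: coord_continuous.
    exact: norm_continuous.
  exact: open_gt.
by apply: filterS (near_line (e j) oM Mx) => h /= /hM.
Qed.

(** Differentiation under the integral sign in the increment [h]. For [h] in []-1, 1[] the base
    point stays in the cube of radius [1 + |x|], where [strip_bound] provides the majorant. *)
Lemma is_derive_Lint i j (f : E -> R) (x : E) : smooth f -> strip_supported i f ->
  is_derive x (e j) (Lint B i f) (Lint B i (partial j f) x).
Proof.
move=> sf ssf; apply/is_derive_line0.
pose F (h r : R) := f (r *: e i + (h *: e j + x)).
have Fd (h r : R) : is_derive h 1 (F ^~ r) (partial j f (r *: e i + (h *: e j + x))).
  rewrite addrCA; have := smooth_is_derive j (h *: e j + (r *: e i + x)) sf.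
  move=> /is_derive_line; congr is_derive.
  by apply/funext => k; rewrite /F addrCA.
have F1 (h r : R) : partial1of2 F h r = partial j f (r *: e i + (h *: e j + x)).
  by rewrite partial1of2E; have [_] := Fd h r.
have cp := smooth_continuous (smooth_partial j sf).
have [K [a hK]] := strip_bound (1 + `|x|) cp (strip_partial j ssf).
have in01 : `](-1), 1[%classic (0 : R) by rewrite /= in_itv/= ltrN10 ltr01.
have key := @cvg_differentiation_under_integral R _ _ leb F B mB 0 (-1) 1 in01 _ _
  (fun r => `|K| * \1_(`[- a, a]) r) _ (integrable_indicZ `|K| a mB) _.
have {}key : h^-1 *: (Lint B i f (h *: e j + x) - Lint B i f x) @[h --> 0^']
    --> Lint B i (partial j f) x.
  under [X in _ --> X]eq_Rintegral do rewrite -[x]add0r -(scale0r (e j)) -F1.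
  rewrite /Lint.
  have -> : (fun h => h^-1 *: (Lint B i f (h *: e j + x) - Lint B i f x)) =
    (fun h => h^-1 *: (\int[leb]_(y in B) F (h + 0) y - \int[leb]_(y in B) F 0 y)).
    by apply/funext => h; rewrite /Lint /F addr0 scale0r add0r.
  apply: key.
  - by move=> h _; apply: integrable_line => //; exact: smooth_continuous.
  - by move=> h r _ _; have [] := Fd h r.
  - by move=> r; rewrite mulr_ge0// indicE.
  - move=> h r /=; rewrite in_itv/= => /andP[h1 h2] _; rewrite F1.
    apply: (le_trans (hK _ _ r)).
      rewrite (le_trans (ler_normD _ _))// lerD2r normrZ -[leRHS]mulr1 ler_pM//.
        by rewrite ler_norml !ltW.
      exact: norm_delta_le1.
    by rewrite ler_wpM2r ?ler_norm// indicE.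
split.
  apply/cvg_ex; exists (Lint B i (partial j f) x) => /=.
  by under eq_fun do rewrite scaler1 addr0 scale0r add0r.
by apply/cvg_lim => //=; under eq_fun do rewrite scaler1 addr0 scale0r add0r.
Qed.

Lemma partial_Lint i j (f : E -> R) : smooth f -> strip_supported i f ->
  partial j (Lint B i f) = Lint B i (partial j f).
Proof. by move=> sf ssf; apply: partialE => x; exact: is_derive_Lint. Qed.

Lemma smooth_Lint i (f : E -> R) : smooth f -> strip_supported i f ->
  smooth (Lint B i f).
Proof.
move=> sf ssf.
apply: (@smooth_coind _ _ (fun g => exists f,
    [/\ smooth f, strip_supported i f & g = Lint B i f])); last by exists f.
move=> _ {sf ssf} [{}f [sf ssf ->]]; split=> [|j].
  by apply: continuous_Lint => //; exact: smooth_continuous.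
rewrite partial_Lint//; split=> [x|]; first by have [] := is_derive_Lint j x sf ssf.
by exists (partial j f); split; [exact: smooth_partial|exact: strip_partial|].
Qed.

End line_integrals.

Section line_FTC.
Variables (R : realType) (n : nat).
Local Notation E := 'rV[R]_n.
Local Notation e := (fun i : 'I_n => delta_mx ord0 i : 'rV[R]_n).
Local Notation leb := (@lebesgue_measure R).

Lemma line_FTC i (f : E -> R) (x : E) (a b : R) : smooth f -> a < b ->
  \int[leb]_(r in `[a, b]) partial i f (r *: e i + x) =
  f (b *: e i + x) - f (a *: e i + x).
Proof.
move=> sf ab; pose F (r : R) := f (r *: e i + x).
have dF (r : R) : is_derive r 1 F (partial i f (r *: e i + x)).
  exact: (is_derive_line _ _ _ _ _).1 (smooth_is_derive _ _ sf).
have cF (r : R) : {for r, continuous F}.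
  by apply/differentiable_continuous/derivable1_diffP; have [] := dF r.
rewrite /Rintegral (@continuous_FTC2 _ _ F)//.
- apply: continuous_subspaceT => r.
  apply: (@continuous_comp _ _ _ (fun r : R => r *: e i + x) (partial i f)).
    exact: continuous_line.
  exact/smooth_continuous/smooth_partial.
- split.
  + by move=> r _; have [] := dF r.
  + by apply: cvg_at_right_filter; exact: cF.
  + by apply: cvg_at_left_filter; exact: cF.
- by move=> r _; rewrite derive1E; have [_] := dF r.
Qed.

Lemma Rintegral_support (A B : set R) (g : R -> R) :
  (forall r, r \in A -> r \notin B -> g r = 0) ->
  (forall r, r \in B -> r \notin A -> g r = 0) ->
  \int[leb]_(r in A) g r = \int[leb]_(r in B) g r.
Proof.
move=> AB BA; rewrite Rintegral_mkcond [RHS]Rintegral_mkcond.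
apply: eq_Rintegral => r _; rewrite /patch.
case: ifPn => rA; case: ifPn => rB //; first exact: AB.
by rewrite BA.
Qed.

Lemma strip_line i (f : E -> R) (x : E) : strip_supported i f ->
  exists2 c : R, 0 < c & forall r, c <= `|r| -> f (r *: e i + x) = 0.
Proof.
move=> [M hM]; exists (`|M| + `|x ord0 i| + 1); first by rewrite ltr_wpDl// addr_ge0.
move=> r rc; apply: hM; rewrite line_coord eqxx mul1r.
have := ler_normB (r + x ord0 i) (x ord0 i); have := ler_norm M.
rewrite addrK; lra.
Qed.

Lemma Lint_partialT i (f : E -> R) : smooth f -> strip_supported i f ->
  Lint setT i (partial i f) = fun=> 0.
Proof.
move=> sf ssf; apply/funext => x; rewrite /Lint.
have [c c0 hc] := strip_line x ssf.
have [c' c'0 hc'] := strip_line x (strip_partial i ssf).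
pose C := Num.max c c'.
have C0 : 0 < C by rewrite lt_max c0.
have cC : c <= C by rewrite le_max lexx.
rewrite (@Rintegral_support _ `[- C, C]).
- rewrite line_FTC//; last by rewrite gtrN.
  by rewrite !hc ?subrr// ?normrN ger0_norm// ltW.
- move=> r _; rewrite notin_setE/= in_itv/= -ler_norml => /negP; rewrite -ltNge.
  by rewrite gt_max => /andP[_ /ltW/hc'].
- by move=> r _; rewrite in_setT.
Qed.

Lemma Lint_partialNy i (f : E -> R) : smooth f -> strip_supported i f ->
  Lint `]-oo, 0] i (partial i f) = f.
Proof.
move=> sf ssf; apply/funext => x; rewrite /Lint.
have [c c0 hc] := strip_line x ssf.
have [c' c'0 hc'] := strip_line x (strip_partial i ssf).
pose C := Num.max c c'.
have C0 : 0 < C by rewrite lt_max c0.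
have cC : c <= C by rewrite le_max lexx.
rewrite (@Rintegral_support _ `[- C, 0]).
- rewrite line_FTC//; last by rewrite oppr_lt0.
  by rewrite scale0r add0r hc ?subr0// normrN ger0_norm// ltW.
- move=> r; rewrite inE notin_setE/= !in_itv/= => r0; rewrite r0 andbT => /negP.
  rewrite -ltNge => rC; apply: hc'; rewrite ler0_norm// lerNr.
  by apply: le_trans (ltW rC) _; rewrite lerN2 le_max lexx orbT.
- move=> r; rewrite inE notin_setE/= !in_itv/= => /andP[_ r0]; by rewrite r0.
Qed.

End line_FTC.

(** * Cutoff primitives of test functions *)

Section cutoff_operators.
Variables (R : realType) (n : nat).
Local Notation E := 'rV[R]_n.
Local Notation e := (fun i : 'I_n => delta_mx ord0 i : 'rV[R]_n).

(** A smooth transition from 0 to 1 across [-1 <= x_i <= 1]. The arguments [1 + x_i] and [1 - x_i]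
    are never both nonpositive, which keeps the denominator positive. *)
Definition step (i : 'I_n) (x : E) : R :=
  flat 0 (1 + x ord0 i) * (flat 0 (1 + x ord0 i) + flat 0 (1 - x ord0 i))^-1.

Lemma step_den_gt0 (t : R) : 0 < flat 0 (1 + t) + flat 0 (1 - t).
Proof.
have [t0|t0] := leP 0 t.
  by rewrite ltr_pwDl ?flat_ge0// flat_gt0// ltr_wpDr.
by rewrite ltr_wpDl ?flat_ge0// flat_gt0// ltr_wpDr// oppr_ge0 ltW.
Qed.

Lemma smooth_step i : smooth (step i).
Proof.
have s1 : smooth_expr (fun x : E => flat 0 (1 + x ord0 i)).
  apply: smooth_expr_flat; apply: smooth_expr_add; first exact: smooth_expr_cst.
  exact: smooth_expr_coord.
have s2 : smooth_expr (fun x : E => flat 0 (1 + -1 * x ord0 i)).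
  apply: smooth_expr_flat; apply: smooth_expr_add; first exact: smooth_expr_cst.
  by apply: smooth_expr_mul; [exact: smooth_expr_cst|exact: smooth_expr_coord].
apply: smooth_exprP; apply: smooth_expr_mul => //.
under eq_fun do rewrite -mulN1r.
apply: smooth_expr_inv; first exact: smooth_expr_add.
by move=> x; rewrite gt_eqF// mulN1r step_den_gt0.
Qed.

Lemma step_le0 i (x : E) : x ord0 i <= -1 -> step i x = 0.
Proof. by move=> x1; rewrite /step flat_le0 ?mul0r//; lra. Qed.

Lemma step_ge1 i (x : E) : 1 <= x ord0 i -> step i x = 1.
Proof.
move=> x1; have := step_den_gt0 (x ord0 i); rewrite /step.
rewrite (@flat_le0 _ 0 (1 - _)); last by lra.
by rewrite addr0 => h; rewrite divff// gt_eqF.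
Qed.

Lemma step_bounds i (x : E) : 0 <= step i x <= 1.
Proof.
have h := step_den_gt0 (x ord0 i); rewrite /step.
rewrite mulr_ge0 ?flat_ge0 ?invr_ge0 ?(ltW h)//=.
by rewrite ler_pdivrMr// mul1r lerDl flat_ge0.
Qed.

Lemma partial_shift j (f : E -> R) (w x : E) :
  partial j f (x + w) = partial j (fun y => f (y + w)) x.
Proof.
by rewrite /partial /derive; under eq_fun do rewrite /= addrA.
Qed.

Lemma partial_invariant i j (f : E -> R) :
  (forall h x, f (x + h *: e j) = f x) ->
  forall h x, partial i f (x + h *: e j) = partial i f x.
Proof. by move=> fj h x; rewrite partial_shift; under eq_fun do rewrite fj. Qed.

Lemma partial_invariant0 j (f : E -> R) :
  (forall h x, f (x + h *: e j) = f x) -> partial j f = fun=> 0.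
Proof.
move=> fj; apply: partialE => x; apply/is_derive_line0.
by under eq_fun do rewrite addrC fj; exact: is_derive_cst.
Qed.

Lemma step_invariant i j (h : R) (x : E) : j != i ->
  step i (x + h *: e j) = step i x.
Proof.
by move=> ji; rewrite /step !mxE eqxx eq_sym (negbTE ji) mulr0 addr0.
Qed.

Lemma partial_step0 i (x : E) : 1 < `|x ord0 i| -> partial i (step i) x = 0.
Proof.
move=> x1.
have [x0|x0] := leP 0 (x ord0 i).
  rewrite ger0_norm// in x1.
  have d1 : is_derive (0 : R) 1 (fun h => step i (h *: e i + x)) 0.
    apply: near_eq_is_derive (is_derive_cst (1 : R) (0:R) (1:R)).
    have o1 : open [set x : E | 1 < x ord0 i].
      apply: (@open_comp _ _ (fun x : E => x ord0 i) [set y | 1 < y]).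
        by move=> z _; exact: coord_continuous.
      exact: open_gt.
    by apply: filterS (near_line (e i) o1 x1) => h /ltW/step_ge1.
  by have [_] := (is_derive_line0 _ _ _ _).2 d1.
rewrite ltr0_norm// in x1.
apply: partial_eq0.
have o1 : open [set x : E | x ord0 i < -1].
  apply: (@open_comp _ _ (fun x : E => x ord0 i) [set y | y < -1]).
    by move=> z _; exact: coord_continuous.
  exact: open_lt.
have x1' : x ord0 i < -1 by rewrite ltrNr.
by apply: filterS (near_line (e i) o1 x1') => h /ltW/step_le0.
Qed.

Lemma test_strip i (f : E -> R) : test_function f -> strip_supported i f.
Proof.
move=> /test_bounded_support[M _ hM]; exists M => x xM; apply: hM.
by rewrite (lt_le_trans xM)// coord_le_norm.
Qed.

(* With [chi = step i] and [F] the integral of [f] along the line through [x] in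
   direction [i], [cutoff_proj] is [chi' F] and [cutoff_prim] is the primitive of
   [f - chi' F], which again has compact support. *)
Definition cutoff_proj i (f : E -> R) (x : E) : R :=
  partial i (step i) x * Lint setT i f x.

Definition cutoff_prim i (f : E -> R) (x : E) : R :=
  Lint `]-oo, 0] i f x - step i x * Lint setT i f x.

Lemma Lint_eq0 (B : set R) i (f : E -> R) (x : E) :
  (forall r, f (r *: e i + x) = 0) -> Lint B i f x = 0.
Proof.
move=> h; rewrite /Lint; under eq_Rintegral do rewrite h.
by rewrite /Rintegral integral0.
Qed.

Lemma smooth_cutoff_proj i f : test_function f -> smooth (cutoff_proj i f).
Proof.
move=> tf; apply: smoothM; first exact/smooth_partial/smooth_step.
by apply: smooth_Lint => //; [exact: test_smooth|exact: test_strip].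
Qed.

Lemma smooth_cutoff_prim i f : test_function f -> smooth (cutoff_prim i f).
Proof.
move=> tf; have sf := test_smooth tf; have ssf := test_strip i tf.
by apply: smoothB; [|apply: smoothM; [exact: smooth_step|]]; exact: smooth_Lint.
Qed.

Lemma test_line_eq0 (M : R) i (f : E -> R) (x : E) :
  (forall x, M < `|x| -> f x = 0) ->
  (exists2 j, j != i & M < `|x ord0 j|) -> forall r, f (r *: e i + x) = 0.
Proof.
move=> hM [j ji xj] r; apply: hM.
have := coord_le_norm (r *: e i + x) j; apply: lt_le_trans.
by rewrite line_coord (negbTE ji) mul0r add0r.
Qed.

Lemma norm_gt_coord (x : E) (M : R) :
  0 <= M -> M < `|x| -> exists j, M < `|x ord0 j|.
Proof.
move=> M0 Mx; apply: contrapT => /forallNP h.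
have : `|x| <= M.
  by apply: norm_le_coord => // i; rewrite leNgt; apply/negP.
by rewrite leNgt Mx.
Qed.

Lemma test_cutoff_proj i f : test_function f -> test_function (cutoff_proj i f).
Proof.
move=> tf; have [M M0 hM] := test_bounded_support tf.
apply: (@test_intro _ _ _ (Num.max 1 M)); first exact: smooth_cutoff_proj.
move=> x xM; have [|j xj] := norm_gt_coord _ xM; first by rewrite le_max ler01.
move: xj; rewrite gt_max => /andP[x1 xjM].
have [ji|ji] := eqVneq j i; first by rewrite ji in x1; rewrite /cutoff_proj partial_step0// mul0r.
by rewrite /cutoff_proj Lint_eq0 ?mulr0//; apply: test_line_eq0 hM _; exists j.
Qed.

(** Far to the right in direction [i] the half-line integral is already the full one and [step] is
    1, so the two terms cancel; far to the left both vanish. Far out in another coordinate, [f]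
    vanishes on the whole line. *)
Lemma test_cutoff_prim i f : test_function f -> test_function (cutoff_prim i f).
Proof.
move=> tf; have [M M0 hM] := test_bounded_support tf.
apply: (@test_intro _ _ _ (Num.max 1 M)); first exact: smooth_cutoff_prim.
move=> x xM; have [|j xj] := norm_gt_coord _ xM; first by rewrite le_max ler01.
move: xj; rewrite gt_max => /andP[x1 xjM].
have [ji|ji] := eqVneq j i; last first.
  by rewrite /cutoff_prim !Lint_eq0 ?mulr0 ?subrr//; apply: test_line_eq0 hM _; exists j.
rewrite {j}ji in x1 xjM *.
have f0 r : M < `|r + x ord0 i| -> f (r *: e i + x) = 0.
  move=> h; apply: hM; apply: lt_le_trans (coord_le_norm _ i).
  by rewrite line_coord eqxx mul1r.
rewrite /cutoff_prim; have [x0|x0] := leP 0 (x ord0 i).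
  rewrite ger0_norm// in x1 xjM.
  rewrite step_ge1 ?mul1r ?(ltW x1)//; apply/eqP; rewrite subr_eq0; apply/eqP.
  apply: Rintegral_support => r; rewrite ?in_setT// => _.
  rewrite notin_setE/= in_itv/= => /negP; rewrite -ltNge => r0.
  by apply: f0; rewrite ger0_norm ?addr_ge0 ?ltW//; lra.
rewrite ltr0_norm// in x1 xjM.
rewrite step_le0 ?mul0r ?subr0; last by rewrite lerNr ltW.
rewrite /Lint (@Rintegral_support _ _ set0) ?Rintegral_set0// => r.
  rewrite inE/= in_itv/= => r0 _.
  by apply: f0; rewrite ltr0_norm; lra.
by rewrite in_set0.
Qed.

Lemma cutoff_proj_partial i f : test_function f ->
  cutoff_proj i (partial i f) = fun=> 0.
Proof.
move=> tf; apply/funext => x; rewrite /cutoff_proj Lint_partialT ?mulr0//.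
  exact: test_smooth.
exact: test_strip.
Qed.

Lemma cutoff_prim_partial i f : test_function f ->
  cutoff_prim i (partial i f) = f.
Proof.
move=> tf; have sf := test_smooth tf; have ssf := test_strip i tf.
apply/funext => x; rewrite /cutoff_prim Lint_partialT// Lint_partialNy//.
by rewrite mulr0 subr0.
Qed.

(** The homotopy formula [f = P f + d_i (V f)]; together with [P d_i = 0] and [V d_i = id] above it
    contains all that is needed of the operators in direction [i]. *)
Lemma partial_cutoff_prim i f : test_function f ->
  partial i (cutoff_prim i f) = fun x => f x - cutoff_proj i f x.
Proof.
move=> tf; have sf := test_smooth tf; have ssf := test_strip i tf.
rewrite /cutoff_prim partialB; [|exact: smooth_Lint|]; last first.
  by apply: smoothM; [exact: smooth_step|exact: smooth_Lint].
rewrite partialM; [|exact: smooth_step|exact: smooth_Lint].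
rewrite !partial_Lint// Lint_partialNy// Lint_partialT//.
by apply/funext => x; rewrite mulr0 add0r mulrC.
Qed.

(** The cutoff depends on the i-th coordinate alone, so the derivative in another direction only
    meets the line integral. *)
Lemma partial_cutoff_proj_neq i j f : j != i -> test_function f ->
  partial j (cutoff_proj i f) = cutoff_proj i (partial j f).
Proof.
move=> ji tf; have sf := test_smooth tf; have ssf := test_strip i tf.
rewrite /cutoff_proj partialM; [|exact/smooth_partial/smooth_step|exact: smooth_Lint].
rewrite partial_Lint// (@partial_invariant0 j (partial i (step i))).
  by apply/funext => x; rewrite mulr0 addr0.
by apply: partial_invariant => h x; exact: step_invariant.
Qed.

Lemma partial_cutoff_prim_neq i j f : j != i -> test_function f ->
  partial j (cutoff_prim i f) = cutoff_prim i (partial j f).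
Proof.
move=> ji tf; have sf := test_smooth tf; have ssf := test_strip i tf.
rewrite /cutoff_prim partialB; [|exact: smooth_Lint|]; last first.
  by apply: smoothM; [exact: smooth_step|exact: smooth_Lint].
rewrite partialM; [|exact: smooth_step|exact: smooth_Lint].
rewrite !partial_Lint// (@partial_invariant0 j (step i)).
  by apply/funext => x; rewrite mulr0 addr0.
by move=> h x; exact: step_invariant.
Qed.

(* A test function is the integral of its derivative, and differentiation
   commutes with the integral. *)
Lemma partial_comm i j (f : E -> R) : test_function f ->
  partial i (partial j f) = partial j (partial i f).
Proof.
move=> tf; have sf := test_smooth tf; have ssf := test_strip i tf.
have tif := test_partial i tf; have tjif := test_partial j tif.
rewrite -{1}(Lint_partialNy sf ssf) partial_Lint//; last first.
- exact: test_strip.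
- exact: test_smooth.
rewrite partial_Lint//; last first.
- exact: test_strip.
- exact: test_smooth.
by rewrite Lint_partialNy//; [exact: test_smooth|exact: test_strip].
Qed.

End cutoff_operators.

(** * Measures that are finite on compact sets *)

Section boxes.
Variables (R : realType) (n : nat).
Local Notation E := 'rV[R]_n.

Definition box (a b : E) : set E :=
  [set x | forall j, a ord0 j < x ord0 j < b ord0 j].

Lemma measurable_box a b : measurable (box a b).
Proof.
rewrite (_ : box a b = \bigcap_(j in [set: 'I_n])
    ((fun x : E => x ord0 j) @^-1` `]a ord0 j, b ord0 j[)).
  apply: fin_bigcap_measurable => // j _.
  by rewrite -[X in measurable X]setTI; exact: measurable_coord.
rewrite eqEsubset; split=> x h j; first by move=> _; rewrite /= in_itv/=; exact: h.
by have := h j I; rewrite /= in_itv.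
Qed.

Lemma box_bounded a b x : box a b x -> `|x| <= `|a| + `|b|.
Proof.
move=> xab; apply: norm_le_coord => [|j]; first by rewrite addr_ge0.
have /andP[ax xb] := xab j.
have := coord_le_norm a j; have := coord_le_norm b j; rewrite !ler_norml => /andP[_ ?] /andP[? _].
by apply/andP; split; have := normr_ge0 a; have := normr_ge0 b; lra.
Qed.

Definition cube (k : R) : set E := box (const_mx (- k)) (const_mx k).

Lemma cubeE k : cube k = [set x | forall j, `|x ord0 j| < k].
Proof.
rewrite eqEsubset; split=> x h j; have := h j; rewrite ?mxE.
  by rewrite ltr_norml.
by rewrite /= ltr_norml.
Qed.

Let boxes : set (set E) := [set A | exists a b, A = box a b].

Lemma box_setI_closed : setI_closed boxes.
Proof.
move=> _ _ [a [b ->]] [a' [b' ->]].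
exists (\row_j Num.max (a ord0 j) (a' ord0 j)), (\row_j Num.min (b ord0 j) (b' ord0 j)).
rewrite eqEsubset; split=> [x [h h'] j|x h].
  by rewrite !mxE gt_max lt_min; case/andP: (h j) => -> ->; case/andP: (h' j) => -> ->.
by split=> j; have := h j; rewrite !mxE gt_max lt_min
  => /andP[/andP[h1 h2] /andP[h3 h4]]; rewrite ?h1 ?h2 ?h3 ?h4.
Qed.

Lemma bigcup_cube : \bigcup_(k : nat) cube k%:R = setT.
Proof.
rewrite -subTset => x _; exists (Num.truncn `|x|).+1 => //; rewrite cubeE => j.
exact: le_lt_trans (coord_le_norm x j) (truncnS_gt _).
Qed.

(** The identity is measurable from the sigma-algebra of the boxes to the Borel one as soon as its
    coordinates are, and a half-space [x_j > a] is a countable union of boxes. *)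
Lemma measurable_box_gen (A : set E) : measurable A -> <<s boxes >> A.
Proof.
move=> mA.
have mid : @measurable_fun _ _ (g_sigma_algebraType boxes) E setT id.
  apply: measurable_fun_rV => j.
  apply: (measurability _ (RGenOInfty.measurableE R)).
  move=> _ [_ [a ->] <-]; rewrite setTI.
  rewrite (_ : _ @^-1` _ = \bigcup_(k : nat)
      box (\row_i if i == j then a else - k%:R) (const_mx k%:R)).
    by apply: bigcupT_measurable => k; apply: sub_sigma_algebra; eexists; eexists.
  rewrite eqEsubset; split=> [x /=|x [k _ /(_ j)]]; last first.
    by rewrite !mxE eqxx /= in_itv/= andbT => /andP[].
  rewrite in_itv/= andbT => ax.
  have [k _] : (\bigcup_(k : nat) cube k%:R) x by rewrite bigcup_cube.
  rewrite cubeE => h; exists k => // i; rewrite !mxE.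
  have := h i; rewrite ltr_norml => /andP[h1 ->].
  by case: eqP => [->|_]; rewrite ?ax ?h1.
have := mid measurableT A mA; rewrite setTI preimage_id.
exact.
Qed.

Lemma measure_box_unique (m1 m2 : {measure set E -> \bar R}) :
  (forall a b, m1 (box a b) = m2 (box a b)) ->
  (forall k : nat, m1 (cube k%:R) < +oo)%E ->
  forall A, measurable A -> m1 A = m2 A.
Proof.
move=> m12 m1oo A /measurable_box_gen.
apply: (@g_sigma_algebra_measure_unique _ R E boxes _ (fun k => cube k%:R)) => //.
- by move=> _ [a [b ->]]; exact: measurable_box.
- by move=> k; eexists; eexists.
- exact: bigcup_cube.
- exact: box_setI_closed.
- by move=> _ [a [b ->]]; exact: m12.
Qed.

Definition finite_on_compacts (m : set E -> \bar R) :=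
  forall K, compact K -> (m K < +oo)%E.

Lemma finite_on_cubes (m : {measure set E -> \bar R}) (k : R) :
  finite_on_compacts m -> (m (cube k) < +oo)%E.
Proof.
move=> /(_ _ (@compact_cube R n `|k|)); apply: le_lt_trans.
apply: le_measure; rewrite ?inE.
- exact: measurable_box.
- rewrite -[X in measurable X]setCK; apply: measurableC; apply: open_measurable_mx.
  by rewrite openC; exact: closed_norm_le.
move=> x; rewrite cubeE => h; apply: norm_le_coord => // j.
by rewrite ltW// (lt_le_trans (h j))// ler_norm.
Qed.

Lemma continuous_measurable_rV (f : E -> R) : continuous f -> measurable_fun setT f.
Proof.
move=> cf; apply: (measurability _ (RGenOInfty.measurableE R)).
move=> _ [_ [a ->] <-]; rewrite setTI; apply: open_measurable_mx.
apply: open_comp; first by move=> x _; exact: cf.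
by rewrite set_itvE; exact: open_gt.
Qed.

Lemma measurable_norm_le (M : R) : measurable [set x : E | `|x| <= M].
Proof.
rewrite -[X in measurable X]setCK; apply: measurableC; apply: open_measurable_mx.
by rewrite openC; exact: closed_norm_le.
Qed.

Lemma integrable_bounded_support (m : {measure set E -> \bar R}) (f : E -> R) (K M : R) :
  finite_on_compacts m -> measurable_fun setT f ->
  (forall x, `|f x| <= K) -> (forall x, M < `|x| -> f x = 0) ->
  m.-integrable setT (EFin \o f).
Proof.
move=> mfin mf fK fM.
have K0 : 0 <= K := le_trans (normr_ge0 _) (fK 0).
apply/integrableP; split; first exact/measurable_EFinP.
have mA := measurable_norm_le M; set A := [set x : E | _] in mA.
have mAoo : (m A < +oo)%E by apply: mfin; exact: compact_cube.
have le : (\int[m]_x `|(EFin \o f) x| <= \int[m]_(x in A) (cst K%:E) x)%E.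
  rewrite [leRHS]integral_mkcond; apply: ge0_le_integral => //.
  - by apply/measurable_EFinP; exact: measurableT_comp.
  - apply/measurable_restrict => //; rewrite setTI; exact: measurable_cst.
  move=> x _ /=; rewrite patchE; case: ifPn => [_|]; first by rewrite lee_fin.
  by rewrite notin_setE/= => /negP; rewrite -ltNge => /fM ->; rewrite normr0.
by apply: le_lt_trans le _; rewrite integral_cst// lte_mul_pinfty ?lee_fin.
Qed.

Lemma test_measurable (f : E -> R) : test_function f -> measurable_fun setT f.
Proof. by move=> /test_smooth/smooth_continuous/continuous_measurable_rV. Qed.

Lemma test_bounded (f : E -> R) : test_function f ->
  exists2 K : R, 0 <= K & forall x, `|f x| <= K.
Proof.
move=> tf; have [M _ hM] := test_bounded_support tf.
have [K K0 hK] := continuous_cube_bounded M (smooth_continuous (test_smooth tf)).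
exists K => // x; have [/hK//|/hM->] := leP `|x| M.
by rewrite normr0.
Qed.

Lemma test_integrable (m : {measure set E -> \bar R}) (f : E -> R) :
  finite_on_compacts m -> test_function f -> m.-integrable setT (EFin \o f).
Proof.
move=> mfin tf; have [M _ hM] := test_bounded_support tf.
have [K _ hK] := test_bounded tf.
exact: integrable_bounded_support (test_measurable tf) hK hM.
Qed.

Definition box_bump (a b : E) (x : E) : R :=
  \prod_j (flat 0 (x ord0 j + - a ord0 j) * flat 0 (b ord0 j + -1 * x ord0 j)).

(** Test functions increasing to the indicator of the open box as [k] grows: [box_bump] is smooth,
    positive inside the box and zero outside. *)
Definition box_approx (a b : E) (k : nat) (x : E) : R :=
  1 - expR (- k%:R * box_bump a b x).

Lemma box_bump_ge0 a b x : 0 <= box_bump a b x.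
Proof. by apply: prodr_ge0 => j _; rewrite mulr_ge0// flat_ge0. Qed.

Lemma box_bump_gt0 a b x : box a b x -> 0 < box_bump a b x.
Proof.
move=> h; apply: prodr_gt0 => j _; have /andP[ax xb] := h j.
by rewrite mulr_gt0// flat_gt0// ?subr_gt0// mulN1r subr_gt0.
Qed.

Lemma box_bump_eq0 a b x : ~ box a b x -> box_bump a b x = 0.
Proof.
move=> /existsNP[j /negP]; rewrite negb_and -!leNgt => h.
rewrite /box_bump (bigD1 j)//=; case/orP: h => h.
  by rewrite flat_le0 ?mul0r// subr_le0.
by rewrite (@flat_le0 _ _ (b ord0 j + _)) ?mulr0 ?mul0r// mulN1r subr_le0.
Qed.

Lemma smooth_box_approx a b k : smooth (box_approx a b k).
Proof.
apply: smoothB; first exact: smooth_cst.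
apply: smooth_exprP; apply: smooth_expr_exp; apply: smooth_expr_mul.
  exact: smooth_expr_cst.
rewrite /box_bump; elim: (index_enum _) => [|j s IH].
  by under eq_fun do rewrite big_nil; exact: smooth_expr_cst.
under eq_fun do rewrite big_cons; apply: smooth_expr_mul => //.
have sc := @smooth_expr_coord R n j.
apply: smooth_expr_mul; apply: smooth_expr_flat; apply: smooth_expr_add => //.
- exact: smooth_expr_cst.
- exact: smooth_expr_cst.
- by apply: smooth_expr_mul => //; exact: smooth_expr_cst.
Qed.

Lemma box_approx_eq0 a b k x : ~ box a b x -> box_approx a b k x = 0.
Proof. by move=> /box_bump_eq0; rewrite /box_approx => ->; rewrite mulr0 expR0 subrr. Qed.

Lemma test_box_approx a b k : test_function (box_approx a b k).
Proof.
apply: (@test_intro _ _ _ (`|a| + `|b|)); first exact: smooth_box_approx.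
move=> x xab; apply: box_approx_eq0 => /box_bounded.
by rewrite leNgt xab.
Qed.

Lemma box_approx_ge0 a b k x : 0 <= box_approx a b k x.
Proof.
by rewrite /box_approx subr_ge0 -expR0 ler_expR mulNr oppr_le0 mulr_ge0// box_bump_ge0.
Qed.

Lemma box_approx_nd a b x : {homo (fun k => box_approx a b k x) : k l / (k <= l)%N >-> k <= l}.
Proof.
move=> k l kl; rewrite /box_approx lerD2l lerN2 ler_expR !mulNr lerN2.
by rewrite ler_wpM2r ?box_bump_ge0// ler_nat.
Qed.

Lemma box_approx_cvg a b x : box_approx a b k x @[k --> \oo] --> (\1_(box a b) x : R).
Proof.
rewrite indicE; case: (boolP (x \in _)) => [/set_mem xab|]; last first.
  rewrite notin_setE => xab; under eq_fun do rewrite box_approx_eq0//.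
  exact: cvg_cst.
rewrite -[X in _ --> X]subr0 /box_approx; apply: cvgB; first exact: cvg_cst.
under eq_fun do rewrite mulNr -mulrN expRM_natl.
apply: cvg_expr; rewrite ger0_norm ?expR_ge0// expR_lt1 oppr_lt0.
exact: box_bump_gt0.
Qed.

Lemma cvg_integral_box_approx (m : {measure set E -> \bar R}) a b :
  (\int[m]_x (box_approx a b k x)%:E)%E @[k --> \oo] --> m (box a b).
Proof.
have mb := measurable_box a b.
rewrite -[X in _ --> m X]setIT -integral_indic//.
have -> : (\int[m]_x (\1_(box a b) x)%:E =
  \int[m]_x (limn (fun k => (box_approx a b k x)%:E)))%E.
  apply: eq_integral => x _; apply/esym/cvg_lim => //.
  by apply: cvg_EFin; [exact: nearW|exact: box_approx_cvg].
apply: cvg_monotone_convergence => //.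
- by move=> k; apply/measurable_EFinP; apply: test_measurable; exact: test_box_approx.
- by move=> k x _; rewrite lee_fin box_approx_ge0.
- by move=> x _ k l kl; rewrite lee_fin box_approx_nd.
Qed.

(** Monotone convergence along [box_approx] recovers the masses of the boxes, which determine a
    measure that is finite on cubes. *)
Lemma measure_test_unique (m1 m2 : {measure set E -> \bar R}) :
  finite_on_compacts m1 -> finite_on_compacts m2 ->
  (forall f, test_function f -> \int[m1]_x f x = \int[m2]_x f x) ->
  forall A, measurable A -> m1 A = m2 A.
Proof.
move=> fm1 fm2 m12; apply: measure_box_unique => [a b|k]; last exact: finite_on_cubes.
have := @cvg_integral_box_approx m1 a b; have := @cvg_integral_box_approx m2 a b.
have -> : (fun k => \int[m1]_x (box_approx a b k x)%:E)%E =
    (fun k => \int[m2]_x (box_approx a b k x)%:E)%E.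
  apply/funext => k; have tf := test_box_approx a b k.
  have := congr1 EFin (m12 _ tf); rewrite /Rintegral !fineK//.
    exact: integrable_fin_num (test_integrable fm2 tf).
  exact: integrable_fin_num (test_integrable fm1 tf).
by move=> h1 h2; rewrite -(cvg_lim _ h1)// -(cvg_lim _ h2).
Qed.

End boxes.

(** * Push-forwards of weighted measures *)

Section weighted_pushforward.
Context d d' (X : measurableType d) (Y : measurableType d') (R : realType).
Variables (m : {measure set X -> \bar R}) (phi : X -> Y) (w : X -> R).
Hypotheses (mphi : measurable_fun setT phi) (mw : measurable_fun setT w).
Hypothesis w0 : forall x, 0 <= w x.

Let wpush (A : set Y) : \bar R := (\int[m]_(x in phi @^-1` A) (w x)%:E)%E.

Let mpre A : measurable A -> measurable (phi @^-1` A).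
Proof. by move=> mA; rewrite -[X in measurable X]setTI; exact: mphi. Qed.

Let wpush0 : wpush set0 = 0%E.
Proof. by rewrite /wpush preimage_set0 integral_set0. Qed.

Let wpush_ge0 A : (0 <= wpush A)%E.
Proof. by apply: integral_ge0 => x _; rewrite lee_fin. Qed.

Let wpush_sigma_additive : semi_sigma_additive wpush.
Proof.
move=> F mF tF mUF; rewrite /wpush preimage_bigcup.
rewrite ge0_integral_bigcup//.
- apply: is_cvg_ereal_nneg_natsum => k _; exact: wpush_ge0.
- by move=> k; exact: mpre.
- by apply/measurable_EFinP; exact: measurable_funTS.
- by move=> x _; rewrite lee_fin.
- apply/trivIsetP => /= i j _ _ ij; rewrite -preimage_setI.
  by move/trivIsetP : tF => /(_ _ _ _ _ ij) ->//; rewrite preimage_set0.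
Qed.

Let wpush_measure : {measure set Y -> \bar R} :=
  HB.pack wpush (isMeasure.Build _ _ _ wpush wpush0 wpush_ge0 wpush_sigma_additive).

Import HBNNSimple.

(** Both sides are monotone limits along simple functions approximating [f]; on a level set the
    formula is the definition of [wpush]. *)
Let integral_wpush (f : Y -> \bar R) : measurable_fun setT f ->
  (forall y, 0 <= f y)%E ->
  (\int[wpush_measure]_y f y = \int[m]_x ((w x)%:E * f (phi x)))%E.
Proof.
move=> mf f0; pose f_ := nnsfun_approx measurableT mf.
have mf_ k : measurable_fun setT (f_ k \o phi) by exact: measurableT_comp.
have c1 : (\int[wpush_measure]_y (f_ k y)%:E)%E @[k --> \oo] -->
    (\int[wpush_measure]_y f y)%E.
  have -> : (\int[wpush_measure]_y f y =
      \int[wpush_measure]_y (limn (fun k => (f_ k y)%:E)))%E.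
    by apply: eq_integral => y _; apply/esym/cvg_lim => //; exact: cvg_nnsfun_approx.
  apply: cvg_monotone_convergence => //.
  - by move=> k; exact/measurable_EFinP.
  - by move=> k y _; rewrite lee_fin.
  - by move=> y _ k l kl; rewrite lee_fin; exact/lefP/nd_nnsfun_approx.
have c2 : (\int[m]_x ((w x)%:E * (f_ k (phi x))%:E))%E @[k --> \oo] -->
    (\int[m]_x ((w x)%:E * f (phi x)))%E.
  have -> : (\int[m]_x ((w x)%:E * f (phi x)) =
      \int[m]_x (limn (fun k => (w x)%:E * (f_ k (phi x))%:E)))%E.
    apply: eq_integral => x _; apply/esym/cvg_lim => //.
    by apply: cvgeZl => //; exact: cvg_nnsfun_approx.
  apply: cvg_monotone_convergence => //.
  - by move=> k; apply/measurable_EFinP; exact: measurable_funM mw (mf_ k).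
  - by move=> k y _; rewrite lee_fin mulr_ge0.
  - move=> y _ k l kl; rewrite lee_fin ler_wpM2l//.
    exact/lefP/nd_nnsfun_approx.
suff E12 : (fun k => \int[wpush_measure]_y (f_ k y)%:E)%E =
    (fun k => \int[m]_x ((w x)%:E * (f_ k (phi x))%:E))%E.
  by rewrite -(cvg_lim _ c1)// -(cvg_lim _ c2)// E12.
apply/funext => k.
have mpk r : measurable (f_ k @^-1` [set r]) by [].
transitivity (\sum_(r \in range (f_ k)) r%:E * wpush (f_ k @^-1` [set r]))%E.
  rewrite integral_nnsfun// sintegralE.
  by have -> : (f_ k : Y -> R) \_ setT = f_ k by apply/funext => y; rewrite patchE in_setT.
transitivity (\sum_(r \in range (f_ k))
    \int[m]_x (r%:E * ((w x)%:E * (\1_(phi @^-1` (f_ k @^-1` [set r])) x)%:E)))%E.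
  apply: eq_fsbigr => r _.
  have mr := mpre (mpk r).
  rewrite /wpush.
  have [r0|r0] := leP 0 r; last first.
    rewrite preimage_nnfun0// preimage_set0 integral_set0 mule0.
    by apply/esym/integral0_eq => x _; rewrite indic0 mule0 mule0.
  rewrite integral_mkcond ge0_integralZl//.
  - congr (_ * _)%E; apply: eq_integral => x _; rewrite patchE indicE.
    by case: ifP => _; rewrite ?mule1 ?mule0.
  - by apply/measurable_EFinP; apply: measurable_funM => //; exact: measurable_indic.
  - by move=> x _; rewrite -EFinM lee_fin mulr_ge0// indicE.
rewrite -ge0_integral_fsum//.
- apply: eq_integral => x _.
  rewrite [in RHS]fimfunE -fsumEFin// ge0_mule_fsumr; last first.
    by move=> r; exact: nnfun_muleindic_ge0.
  by apply: eq_fsbigr => r _; rewrite EFinM muleCA.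
- move=> r; apply/measurable_EFinP; apply: measurable_funM => //.
  by apply: measurable_funM => //; exact/measurable_indic/mpre.
- move=> r x _; rewrite muleCA; apply: mule_ge0; first by rewrite lee_fin.
  by have := nnfun_muleindic_ge0 (f_ k) r (phi x); rewrite !indicE.
Qed.

Lemma weighted_pushforward : exists nu : {measure set Y -> \bar R},
  (forall A, nu A = \int[m]_(x in phi @^-1` A) (w x)%:E)%E /\
  forall f : Y -> \bar R, measurable_fun setT f -> (forall y, 0 <= f y)%E ->
    (\int[nu]_y f y = \int[m]_x ((w x)%:E * f (phi x)))%E.
Proof. by exists wpush_measure; split => // f mf f0; exact: integral_wpush. Qed.

End weighted_pushforward.

Section signed_pushforward.
Context d (Z : measurableType d) (R : realType) (n : nat).
Local Notation E := 'rV[R]_n.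

Lemma compact_measurable_rV (K : set E) : compact K -> measurable K.
Proof.
move=> /(compact_closed (@norm_hausdorff _ E)) cK.
rewrite -[X in measurable X]setCK; apply: measurableC; apply: open_measurable_mx.
by rewrite openC.
Qed.

Variables (m : {measure set Z -> \bar R}) (phi : Z -> E).
Hypothesis mphi : measurable_fun setT phi.

Let mcube (M : R) : measurable (phi @^-1` [set x | `|x| <= M]).
Proof. by rewrite -[X in measurable X]setTI; apply: mphi => //; exact: measurable_norm_le. Qed.

(** Exactly what makes the push-forward of [|w| m] under [phi] finite on cubes, hence on compact
    sets; [phi] itself need not be proper. *)
Definition locally_integrable_along (w : Z -> R) :=
  forall M : R, (\int[m]_(z in phi @^-1` [set x : E | (`|x| <= M)%R]) `|w z|%:E < +oo)%E.

Lemma integrable_along (w : Z -> R) f : measurable_fun setT w ->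
  locally_integrable_along w -> test_function f ->
  m.-integrable setT (EFin \o (fun z => w z * f (phi z))).
Proof.
move=> mw lw tf.
have [M _ hM] := test_bounded_support tf; have [K K0 hK] := test_bounded tf.
have mc := mcube M; set A := _ @^-1` _ in mc.
have mf : measurable_fun setT (fun z => f (phi z)).
  by apply: measurableT_comp => //; exact: test_measurable.
have iA : m.-integrable A (EFin \o w).
  apply/integrableP; split; last exact: lw.
  by apply/measurable_EFinP; exact: measurable_funTS.
have iK : m.-integrable setT (EFin \o (fun z => K * `|w z * \1_A z|)).
  apply: integrable_realZ => //.
  apply: integrable_norm.
  have : m.-integrable setT ((EFin \o w) \_ A) by rewrite -integrable_mkcond.
  congr (_.-integrable _ _); apply/funext => z.
  by rewrite /= patchE indicE; case: ifPn => _ /=; rewrite ?mulr1 ?mulr0.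
apply: (integrable_real_le _ _ _ iK) => //; first exact: measurable_funM.
move=> z _; rewrite indicE; case: (boolP (z \in A)) => [_|].
  by rewrite mulr1 normrM mulrC ler_wpM2r.
by rewrite notin_setE => /negP; rewrite -ltNge => /hM ->; rewrite !mulr0 normr0 mulr0.
Qed.

Lemma weighted_integral (w : Z -> R) (nu : {measure set E -> \bar R}) (f : E -> R) :
  (forall z, 0 <= w z) -> measurable_fun setT f ->
  (forall f : E -> \bar R, measurable_fun setT f -> (forall y, 0 <= f y)%E ->
    (\int[nu]_y f y = \int[m]_x ((w x)%:E * f (phi x)))%E) ->
  \int[nu]_x f x = \int[m]_z (w z * f (phi z)).
Proof.
move=> w0 mf nuE; rewrite /Rintegral; congr fine.
rewrite integralE [RHS]integralE.
have mEf : measurable_fun setT (EFin \o f) by exact/measurable_EFinP.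
rewrite !nuE//; [|exact: measurable_funeneg|exact: measurable_funepos].
congr (_ - _)%E; apply: eq_integral => z _.
- by rewrite !funeposE -!EFin_max -EFinM maxr_pMr// mulr0.
- by rewrite !funenegE -!EFinN -!EFin_max -EFinM maxr_pMr// mulr0 mulrN.
Qed.

(** The positive and negative parts of [w] are pushed forward separately. Both images are dominated
    by that of [|w| m], which gives the finiteness on compact sets and the second clause. *)
Lemma signed_pushforward (w : Z -> R) : measurable_fun setT w ->
  locally_integrable_along w ->
  exists nu : signed_measure R n,
    (forall f, test_function f ->
      gfun_of_measure nu f = \int[m]_z (w z * f (phi z))) /\
    (forall A, measurable A -> (\int[m]_(z in phi @^-1` A) `|w z|%:E = 0)%E ->
      spos nu A = 0%E /\ sneg nu A = 0%E).
Proof.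
move=> mw lw.
have part (v : Z -> R) : measurable_fun setT v -> (forall z, 0 <= v z) ->
    (forall z, v z <= `|w z|) ->
  exists nu : {measure set E -> \bar R}, [/\ finite_on_compacts nu,
    (forall f, test_function f -> m.-integrable setT (EFin \o (fun z => v z * f (phi z))) /\
       \int[nu]_x f x = \int[m]_z (v z * f (phi z))) &
    (forall A, measurable A -> (\int[m]_(z in phi @^-1` A) `|w z|%:E = 0)%E ->
      nu A = 0%E)].
  move=> mv v0 vw; have [nu [nuE nuI]] := weighted_pushforward m mphi mv v0.
  have nu_le A : measurable A ->
      (nu A <= \int[m]_(z in phi @^-1` A) `|w z|%:E)%E.
    move=> mA; have mpA : measurable (phi @^-1` A).
      by rewrite -[X in measurable X]setTI; exact: mphi.
    rewrite nuE; apply: ge0_le_integral => //.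
    - by move=> z _; rewrite lee_fin.
    - by apply/measurable_EFinP; exact: measurable_funTS.
    - by apply/measurable_EFinP; apply: measurable_funTS; exact: measurableT_comp.
    - by move=> z _; rewrite lee_fin.
  exists nu; split.
  - move=> K cK; have [M _ hM] := compact_norm_le cK.
    apply: (@le_lt_trans _ _ (nu [set x : E | `|x| <= M])).
      apply: le_measure; rewrite ?inE//; first exact: compact_measurable_rV.
      exact: measurable_norm_le.
    by apply: le_lt_trans (nu_le _ _) (lw M); exact: measurable_norm_le.
  - move=> f tf; split; last by apply: weighted_integral => //; exact: test_measurable.
    apply: integrable_along => // M; apply: le_lt_trans (lw M).
    apply: ge0_le_integral => //.
    + by apply/measurable_EFinP; apply: measurable_funTS; exact: measurableT_comp.
    + by apply/measurable_EFinP; apply: measurable_funTS; exact: measurableT_comp.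
    + by move=> z _; rewrite lee_fin ger0_norm.
  - move=> A mA A0; apply/eqP; rewrite eq_le measure_ge0 andbT -A0.
    exact: nu_le.
pose wp z := Num.max (w z) 0; pose wn z := Num.max (- w z) 0.
have mwp : measurable_fun setT wp by exact: measurable_maxr.
have mwn : measurable_fun setT wn.
  by apply: measurable_maxr => //; exact: measurableT_comp.
have [||p [pf pI p0]] := part wp mwp.
- by move=> z; rewrite /wp le_max lexx orbT.
- by move=> z; rewrite /wp ge_max normr_ge0 ler_norm.
have [||q [qf qI q0]] := part wn mwn.
- by move=> z; rewrite /wn le_max lexx orbT.
- by move=> z; rewrite /wn ge_max normr_ge0 -normrN ler_norm.
exists (SignedMeasure pf qf); split => [f tf|A mA A0]; last by rewrite p0// q0.
rewrite /gfun_of_measure/=; have [ip ->] := pI f tf; have [iq ->] := qI f tf.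
rewrite -RintegralB//; apply: eq_Rintegral => z _; rewrite -mulrBl; congr (_ * _).
rewrite /wp /wn; have [w0|w0] := leP 0 (w z).
  by rewrite (max_idPr _) ?subr0// oppr_le0.
by rewrite (max_idPl _) ?sub0r ?opprK// oppr_ge0 ltW.
Qed.

End signed_pushforward.

(** * Push-forwards along coordinate lines *)

Section line_pushforward.
Variables (R : realType) (n : nat).
Local Notation E := 'rV[R]_n.
Local Notation e := (fun i : 'I_n => delta_mx ord0 i : 'rV[R]_n).
Local Notation RR := (measurableTypeR R).
Local Notation leb := (@lebesgue_measure R).

(** Product measures and Fubini's theorem ask for the bundled sigma-finite structure. The equation
    is between measures, so that integrals can be rewritten in either direction. *)
Lemma finite_on_compacts_sigma_finite (m : {measure set E -> \bar R}) :
  finite_on_compacts m ->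
  exists m' : {sigma_finite_measure set E -> \bar R},
    m' = m :> {measure set E -> \bar R}.
Proof.
move=> mfin.
have sf : sigma_finite setT m.
  exists (fun k : nat => cube k%:R); first by rewrite bigcup_cube.
  by move=> k; split; [exact: measurable_box|exact: finite_on_cubes].
case: m mfin sf => mu [c1 c2] mfin sf.
pose m : {measure set E -> \bar R} := Measure.Pack (@Measure.Class _ _ _ mu c1 c2).
pose m' : {sigma_finite_measure set E -> \bar R} :=
  HB.pack_for (SigmaFiniteMeasure.type E R) (Measure.sort m) c1 c2 (Measure_isSigmaFinite.Build _ _ _ m sf).
by exists m'.
Qed.

Definition section_null (i : 'I_n) (A : set E) :=
  forall x : E, leb [set r : R | A (r *: e i + x)] = 0%E.

Definition line_map i (z : E * RR) : E := z.2 *: e i + z.1.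

Lemma measurable_line_map i : measurable_fun setT (line_map i).
Proof.
apply: measurable_fun_rV => j; under eq_fun do rewrite line_coord.
apply: measurable_funD; first by apply: measurable_funM => //; exact: measurable_snd.
exact: measurableT_comp (measurable_coord _ _) measurable_fst.
Qed.

(** Transpose of a weighted integration along lines. The map from [(x, r)] to [r e_i + x] is not
    proper; the hypothesis says that it becomes so on the support of [w], with [w] bounded over
    bounded sets. *)
Lemma line_pushforward (m : {measure set E -> \bar R}) i (w : E * RR -> R) :
  finite_on_compacts m -> measurable_fun setT w ->
  (forall M : R, exists c K : R, forall x r, `|r *: e i + x| <= M -> w (x, r) != 0 ->
     [/\ `|x| <= c, `|r| <= c & `|w (x, r)| <= K]) ->
  exists nu : signed_measure R n,
    (forall f, test_function f ->
      gfun_of_measure nu f =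
      \int[m]_x \int[leb]_r (w (x, r) * f (r *: e i + x))) /\
    (forall A, measurable A -> section_null i A ->
      spos nu A = 0%E /\ sneg nu A = 0%E).
Proof.
move=> mfin mw wc; have [m' mE] := finite_on_compacts_sigma_finite mfin.
pose p : {measure set (E * RR) -> \bar R} := (m' \x leb)%E.
have mabs : measurable_fun setT (fun z => `|w z|%:E).
  by apply/measurable_EFinP; exact: measurableT_comp.
have mpair x : measurable_fun setT (fun r : RR => (x, r) : E * RR).
  exact: pair1_measurable.
have lw : locally_integrable_along p (line_map i) w.
  move=> M; have [c [K h]] := wc M.
  pose Q : set (E * RR) := [set x : E | `|x| <= c] `*` `[- c, c].
  have mc := @measurable_norm_le R n c.
  have mI : measurable (`[- c, c] : set R) by exact: measurable_itv.
  have mQ : measurable Q by exact: measurableX.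
  have mS : measurable (line_map i @^-1` [set x | `|x| <= M]).
    rewrite -[X in measurable X]setTI; apply: measurable_line_map => //.
    exact: measurable_norm_le.
  have pQ : (p Q < +oo)%E.
    have -> : p Q = (m [set x : E | (`|x| <= c)%R] * leb `[(- c)%R, c])%E.
      by rewrite -mE; exact: product_measure1E.
    have mfc := mfin _ (@compact_cube R n c).
    rewrite lte_mul_pinfty//; first by rewrite ge0_fin_numE.
    by rewrite /= lebesgue_measure_itv/=; case: ifP => _; rewrite -?EFinB ltry.
  apply: (@le_lt_trans _ _ (\int[p]_(z in Q) (cst `|K|%:E) z)%E); last first.
    by rewrite integral_cst// lte_mul_pinfty// lee_fin.
  rewrite integral_mkcond [leRHS]integral_mkcond; apply: ge0_le_integral => //.
  - by move=> z _; rewrite patchE; case: ifP => // _; rewrite lee_fin.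
  - by apply/measurable_restrict => //; exact: measurable_funTS.
  - by apply/measurable_restrict.
  move=> [x r] _; rewrite !patchE; case: ifPn => [/set_mem/= xr|_]; last first.
    by case: ifP => // _; rewrite lee_fin.
  have [w0|w0] := eqVneq (w (x, r)) 0.
    by rewrite w0 normr0; case: ifP => // _; rewrite lee_fin.
  have [xc rc wK] := h x r xr w0.
  rewrite mem_set; last by split=> //=; rewrite in_itv/= -ler_norml.
  by rewrite lee_fin (le_trans wK)// ler_norm.
have [nu [nuI nu0]] := signed_pushforward (measurable_line_map i) mw lw.
exists nu; split => [f tf|A mA A0]; last first.
  apply: nu0 => //.
  have mpA : measurable (line_map i @^-1` A).
    by rewrite -[X in measurable X]setTI; exact: measurable_line_map.
  (* By Tonelli's theorem the mass over [A] is an integral over [x] of integrals over the sections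
     of [A], which are null. *)
  rewrite integral_mkcond fubini_tonelli1//; last 2 first.
  - by apply/measurable_restrict => //; exact: measurable_funTS.
  - by move=> z; rewrite patchE; case: ifP => // _; rewrite lee_fin.
  apply: integral0_eq => x _; rewrite /fubini_F.
  pose S := [set r : R | A (r *: e i + x)].
  have mS : measurable S.
    rewrite -[X in measurable X]setTI.
    exact: (measurableT_comp (measurable_line_map i) (mpair x)).
  transitivity (\int[leb]_(r in S) `|w (x, r)|%:E)%E.
    rewrite [RHS]integral_mkcond; apply: eq_integral => r _.
    by rewrite !patchE; congr (if _ then _ else _); apply/idP/idP => /set_mem h; exact/mem_set.
  apply: null_set_integral => //; last exact: A0.
  by apply: measurable_funTS; exact: (measurableT_comp mabs (mpair x)).
have iwf := integrable_along (measurable_line_map i) mw lw tf.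
rewrite nuI// /Rintegral -(integral12_prod_meas1 iwf) /fubini_F -mE.
congr fine; apply: eq_integral => x _.
rewrite fineK//; apply: integrable_fin_num => //.
have [M _ hM] := test_bounded_support tf; have [B B0 hB] := test_bounded tf.
have [c [K h]] := wc M.
apply: (@integrable_le_indic R setT (fun r => w (x, r) * f (r *: e i + x)) (`|K| * B) c) => //.
  apply: measurable_funM; first exact: (measurableT_comp mw (mpair x)).
  apply: measurableT_comp; first exact: test_measurable.
  exact: (measurableT_comp (measurable_line_map i) (mpair x)).
move=> r; have [w0|w0] := eqVneq (w (x, r)) 0.
  by rewrite w0 mul0r normr0 mulr_ge0 ?mulr_ge0// indicE.
have [xM|xM] := leP `|r *: e i + x| M; last first.
  by rewrite (hM _ xM) mulr0 normr0 mulr_ge0 ?mulr_ge0// indicE.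
have [_ rc wK] := h x r xM w0.
rewrite indicE mem_set ?mulr1; last by rewrite /= in_itv/= -ler_norml.
by rewrite normrM ler_pM// (le_trans wK)// ler_norm.
Qed.

End line_pushforward.

(** * Functionals given by signed measures *)

Section radon_functionals.
Variables (R : realType) (n : nat).
Local Notation E := 'rV[R]_n.
Local Notation e := (fun i : 'I_n => delta_mx ord0 i : 'rV[R]_n).
Local Notation leb := (@lebesgue_measure R).
Implicit Types (T : gfun R n) (N : set E -> Prop).

Lemma gfun_of_measureD (mu : signed_measure R n) f g :
  test_function f -> test_function g ->
  gfun_of_measure mu (fun x => f x + g x) = gfun_of_measure mu f + gfun_of_measure mu g.
Proof.
move=> tf tg; rewrite /gfun_of_measure !RintegralD//.
- by rewrite opprD addrACA.
- exact: test_integrable (@sneg_finite _ _ mu) tf.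
- exact: test_integrable (@sneg_finite _ _ mu) tg.
- exact: test_integrable (@spos_finite _ _ mu) tf.
- exact: test_integrable (@spos_finite _ _ mu) tg.
Qed.

Lemma gfun_of_measureZ (mu : signed_measure R n) (k : R) f : test_function f ->
  gfun_of_measure mu (fun x => k * f x) = k * gfun_of_measure mu f.
Proof.
move=> tf; rewrite /gfun_of_measure !RintegralZl//.
- by rewrite mulrBr.
- exact: test_integrable (@sneg_finite _ _ mu) tf.
- exact: test_integrable (@spos_finite _ _ mu) tf.
Qed.

(* [T] is a signed measure both parts of which vanish on the sets satisfying
   [N]. *)
Definition radon_null N T := exists mu : signed_measure R n,
  gfun_eq T (gfun_of_measure mu) /\
  forall A, measurable A -> N A -> spos mu A = 0%E /\ sneg mu A = 0%E.

Definition radon T := exists mu : signed_measure R n, gfun_eq T (gfun_of_measure mu).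

Lemma radon_null_radon N T : radon_null N T -> radon T.
Proof. by move=> [mu [Tmu _]]; exists mu. Qed.

Lemma radon_radon_null T : radon T -> radon_null (fun=> False) T.
Proof. by move=> [mu Tmu]; exists mu; split. Qed.

Lemma radon_null_eq N T T' : gfun_eq T T' -> radon_null N T' -> radon_null N T.
Proof. by move=> TT' [mu [T'mu h]]; exists mu; split=> // f tf; rewrite TT'// T'mu. Qed.

Lemma radon_null0 N : radon_null N (@gfun0 R n).
Proof.
have z : @finite_on_compacts R n (@mzero _ E R) by move=> K _; rewrite /mzero ltry.
exists (@SignedMeasure _ _ (@mzero _ E R) (@mzero _ E R) z z); split=> // f tf.
by rewrite /gfun_of_measure subrr.
Qed.

Lemma radon_nullN N T : radon_null N T -> radon_null N (fun f => - T f).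
Proof.
move=> [[p q pf qf] [Tmu h]]; exists (SignedMeasure qf pf); split.
  by move=> f tf; rewrite Tmu// /gfun_of_measure/= opprB.
by move=> A mA /(h _ mA)[/= ? ?].
Qed.

Lemma finite_on_compactsD (p q : {measure set E -> \bar R}) :
  finite_on_compacts p -> finite_on_compacts q ->
  finite_on_compacts (measure_add p q).
Proof. by move=> pf qf K cK; rewrite measure_addE lte_add_pinfty//; [exact: pf|exact: qf]. Qed.

Lemma Rintegral_measure_add (p q : {measure set E -> \bar R}) f :
  finite_on_compacts p -> finite_on_compacts q -> test_function f ->
  \int[measure_add p q]_x f x = \int[p]_x f x + \int[q]_x f x.
Proof.
move=> pf qf tf; have ip := test_integrable pf tf; have iq := test_integrable qf tf.
by rewrite /Rintegral integral_measure_add// fineD//; exact: integrable_fin_num.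
Qed.

Lemma radon_nullD N T T' : radon_null N T -> radon_null N T' ->
  radon_null N (fun f => T f + T' f).
Proof.
move=> [[p q pf qf] [Tmu h]] [[p' q' pf' qf'] [Tmu' h']].
exists (SignedMeasure (finite_on_compactsD pf pf') (finite_on_compactsD qf qf')).
split=> [f tf|A mA NA].
  rewrite Tmu// Tmu'// /gfun_of_measure/= !Rintegral_measure_add//.
  by rewrite opprD addrACA.
have /= [p0 q0] := h A mA NA; have /= [p0' q0'] := h' A mA NA.
split; [rewrite -[LHS]/(measure_add p p' A)|rewrite -[LHS]/(measure_add q q' A)];
  by rewrite measure_addE ?p0 ?q0 ?p0' ?q0' adde0.
Qed.

Lemma radon_nullB N T T' : radon_null N T -> radon_null N T' ->
  radon_null N (fun f => T f - T' f).
Proof. by move=> hT hT'; exact: radon_nullD hT (radon_nullN hT'). Qed.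

Lemma radon_null_sum N (I : Type) (s : seq I) (T : I -> gfun R n) :
  (forall i, radon_null N (T i)) -> radon_null N (fun f => \sum_(i <- s) T i f).
Proof.
move=> hT; elim: s => [|i s IH].
  by apply: radon_null_eq (radon_null0 N) => f _; rewrite big_nil.
by apply: radon_null_eq (radon_nullD (hT i) IH) => f _; rewrite big_cons.
Qed.

Lemma radonE T : radon T <-> radon_null (fun=> False) T.
Proof. by split=> [/radon_radon_null|/radon_null_radon]. Qed.

Lemma radonD T T' : radon T -> radon T' -> radon (fun f => T f + T' f).
Proof. by rewrite !radonE; exact: radon_nullD. Qed.

Lemma radonN T : radon T -> radon (fun f => - T f).
Proof. by rewrite !radonE; exact: radon_nullN. Qed.

Lemma radon_eq T T' : gfun_eq T T' -> radon T' -> radon T.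
Proof. by rewrite !radonE; exact: radon_null_eq. Qed.

Lemma radon_sum (I : Type) (s : seq I) (T : I -> gfun R n) :
  (forall i, radon (T i)) -> radon (fun f => \sum_(i <- s) T i f).
Proof. by move=> hT; rewrite radonE; apply: radon_null_sum => i; exact/radonE. Qed.

Lemma radon_add T f g : radon T -> test_function f -> test_function g ->
  T (fun x => f x + g x) = T f + T g.
Proof.
move=> [mu Tmu] tf tg; rewrite !Tmu//; [exact: gfun_of_measureD|exact: test_functionD].
Qed.

Lemma radon_scale T (k : R) f : radon T -> test_function f ->
  T (fun x => k * f x) = k * T f.
Proof.
move=> [mu Tmu] tf; rewrite !Tmu//; first exact: gfun_of_measureZ.
by apply: test_functionMr => //; exact: smooth_cst.
Qed.

Lemma radon_sub T f g : radon T -> test_function f -> test_function g ->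
  T (fun x => f x - g x) = T f - T g.
Proof.
move=> rT tf tg; have tNg := test_functionMr (smooth_cst (-1)) tg.
rewrite -mulN1r -radon_scale// -radon_add//; congr T.
by apply/funext => x; rewrite mulN1r.
Qed.

Lemma radon_zero T : radon T -> T (fun=> 0) = 0.
Proof.
move=> rT; have := radon_scale 0 rT (@test_function0 R n).
by rewrite !mul0r.
Qed.

Lemma radon_test_sum T (I : Type) (s : seq I) (f : I -> E -> R) : radon T ->
  (forall i, test_function (f i)) ->
  T (fun x => \sum_(i <- s) f i x) = \sum_(i <- s) T (f i).
Proof.
move=> rT tf; elim: s => [|i s IH].
  by rewrite big_nil; under eq_fun do rewrite big_nil; exact: radon_zero.
rewrite big_cons -IH -radon_add//; last exact: test_sum.
by congr T; apply/funext => x; rewrite big_cons.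
Qed.

Lemma signed_pushforward_id (m : {measure set E -> \bar R}) (w : E -> R) :
  measurable_fun setT w ->
  (forall M : R, (\int[m]_(x in [set x : E | (`|x| <= M)%R]) `|w x|%:E < +oo)%E) ->
  exists nu : signed_measure R n, forall f, test_function f ->
    gfun_of_measure nu f = \int[m]_x (w x * f x).
Proof.
move=> mw lw.
have [nu [nuI _]] := @signed_pushforward _ _ _ _ m id (@measurable_id _ _ setT) w mw lw.
by exists nu.
Qed.

Lemma radon_mul T k : radon T -> radon (gfun_mul (fun x => x ord0 k) T).
Proof.
move=> [mu Tmu].
have part (m : {measure set E -> \bar R}) : finite_on_compacts m ->
    radon (fun f => \int[m]_x (x ord0 k * f x)).
  move=> mf; have mc := @measurable_coord R 1 n ord0 k.
  have [|nu nuI] := signed_pushforward_id (m := m) mc; last first.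
    by exists nu => f tf; rewrite nuI.
  move=> M; have mA := @measurable_norm_le R n M; set A := [set x | _] in mA *.
  apply: (@le_lt_trans _ _ (\int[m]_(x in A) (cst `|M|%:E) x)%E); last first.
    by rewrite integral_cst// lte_mul_pinfty ?lee_fin//; apply: mf; exact: compact_cube.
  apply: ge0_le_integral => //.
  - by apply/measurable_EFinP; apply: measurable_funTS; exact: measurableT_comp.
  - by move=> x xM; rewrite lee_fin (le_trans (coord_le_norm x k))// (le_trans xM)// ler_norm.
have pf := @spos_finite _ _ mu; have qf := @sneg_finite _ _ mu.
apply: radon_eq (radonD (part _ pf) (radonN (part _ qf))) => f tf.
by rewrite /gfun_mul Tmu//; exact: test_coordM.
Qed.

(** The principle that lets the cutoff operators act on signed measures: an operator on test
    functions that integrates along lines against a suitable weight transposes to one on signed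
    measures, and its images do not charge sets with null sections. *)
Lemma radon_line N T i (w : E * measurableTypeR R -> R) (L : (E -> R) -> E -> R) :
  radon_null N T -> measurable_fun setT w ->
  (forall M : R, exists c K : R, forall x r, `|r *: e i + x| <= M -> w (x, r) != 0 ->
     [/\ `|x| <= c, `|r| <= c & `|w (x, r)| <= K]) ->
  (forall f, test_function f -> test_function (L f) /\
     forall x, L f x = \int[leb]_r (w (x, r) * f (r *: e i + x))) ->
  radon_null (section_null i) (fun f => T (L f)).
Proof.
move=> /radon_null_radon[mu Tmu] mw wc hL.
have pf := @spos_finite _ _ mu; have qf := @sneg_finite _ _ mu.
have [p [pI p0]] := line_pushforward pf mw wc.
have [q [qI q0]] := line_pushforward qf mw wc.
have rp : radon_null (section_null i) (gfun_of_measure p) by exists p.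
have rq : radon_null (section_null i) (gfun_of_measure q) by exists q.
apply: radon_null_eq (radon_nullB rp rq) => f tf; have [tL LE] := hL f tf.
rewrite Tmu// pI// qI// /gfun_of_measure.
by congr (_ - _); apply: eq_Rintegral => x _; rewrite LE.
Qed.

(** Moving along direction [i] changes only the i-th coordinate, so a bound on [x_i] is all that is
    missing to control [x] and [r]. *)
Lemma line_norm_le i (x : E) (r M c : R) : `|r *: e i + x| <= M ->
  `|x ord0 i| <= c -> `|x| <= Num.max M c /\ `|r| <= M + c.
Proof.
move=> xM xc; split.
  apply: norm_le_coord => [|j]; first by rewrite le_max (le_trans _ xM).
  have [->|ji] := eqVneq j i; first by rewrite le_max xc orbT.
  have := coord_le_norm (r *: e i + x) j.
  by rewrite line_coord (negbTE ji) mul0r add0r le_max => /le_trans -> .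
have := coord_le_norm (r *: e i + x) i; rewrite line_coord eqxx mul1r => h.
have := ler_normB (r + x ord0 i) (x ord0 i); rewrite addrK; lra.
Qed.

Lemma radon_cutoff_proj T i : radon T ->
  radon_null (section_null i) (fun f => T (cutoff_proj i f)).
Proof.
move=> rT; have sp : smooth (partial i (@step R n i)) by exact/smooth_partial/smooth_step.
apply: (radon_line (w := fun z => partial i (step i) z.1) (radon_radon_null rT)).
- exact: (measurableT_comp (continuous_measurable_rV (smooth_continuous sp)) measurable_fst).
- move=> M.
  have [K K0 hK] := continuous_cube_bounded (Num.max M 1) (smooth_continuous sp).
  exists (Num.max (Num.max M 1) (M + 1)), K => x r xM /= w0.
  have x1 : `|x ord0 i| <= 1.
    by rewrite leNgt; apply: contra w0 => /partial_step0 ->.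
  have [xm rm] := line_norm_le xM x1.
  by split; [rewrite le_max xm|rewrite le_max rm orbT|exact: hK].
- move=> f tf; split; first exact: test_cutoff_proj.
  move=> x; rewrite /cutoff_proj /Lint/= RintegralZl//.
  apply: integrable_line => //; last exact: test_strip.
  exact/smooth_continuous/test_smooth.
Qed.

(** The weight is [1_{r <= 0} - step i x]. If [r + x_i] stays bounded while [x_i] is large, then
    [r < 0] and both terms are 1; if [x_i] is very negative, then [r > 0] and both are 0. So [x_i]
    is bounded wherever the weight counts. *)
Lemma radon_cutoff_prim T i : radon T ->
  radon_null (section_null i) (fun f => T (cutoff_prim i f)).
Proof.
move=> rT.
have cs : continuous (@step R n i) by exact/smooth_continuous/smooth_step.
apply: (radon_line (w := fun z => \1_(`]-oo, 0]) z.2 - step i z.1) (radon_radon_null rT)).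
- apply: measurable_funB.
    by apply: (measurableT_comp _ measurable_snd) => //; exact: measurable_indic.
  exact: (measurableT_comp (continuous_measurable_rV cs) measurable_fst).
- move=> M.
  exists (Num.max (Num.max M (`|M| + 1)) (M + (`|M| + 1))), 1 => x r xM /= w0.
  have rx : `|r + x ord0 i| <= M.
    by have := coord_le_norm (r *: e i + x) i; rewrite line_coord eqxx mul1r => /le_trans -> .
  have MM := ler_norm M.
  have x1 : `|x ord0 i| <= `|M| + 1.
    rewrite leNgt; apply: contra w0 => xM1.
    have [x0|x0] := leP 0 (x ord0 i).
      rewrite (ger0_norm x0) in xM1.
      rewrite step_ge1; last by have := normr_ge0 M; lra.
      move: rx; rewrite ler_norml => /andP[_ rx].
      by rewrite indicE mem_set ?subrr//= in_itv/=; lra.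
    rewrite (ltr0_norm x0) in xM1.
    rewrite step_le0 ?subr0; last by have := normr_ge0 M; lra.
    move: rx; rewrite ler_norml => /andP[rx _].
    by rewrite indicE memNset//= in_itv/=; apply/negP; rewrite -ltNge; lra.
  have [xm rm] := line_norm_le xM x1.
  split; [by rewrite le_max xm|by rewrite le_max rm orbT|].
  have /andP[s0 s1] := step_bounds i x; rewrite indicE ler_norml.
  by case: (_ \in _); rewrite ?mulr1n ?mulr0n; apply/andP; split; lra.
- move=> f tf; split; first exact: test_cutoff_prim.
  have cf := smooth_continuous (test_smooth tf); have sf := test_strip i tf.
  move=> x; rewrite /cutoff_prim /Lint/=.
  rewrite -RintegralZl//; last exact: integrable_line.
  rewrite [X in X - _ = _]Rintegral_mkcond -RintegralB//.
  + apply: eq_Rintegral => r _; rewrite patchE indicE mulrBl.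
    by case: ifPn => _; rewrite ?mul1r ?mul0r.
  + have iB : leb.-integrable `]-oo, 0] (EFin \o (fun r => f (r *: e i + x))).
      exact: integrable_line.
    have mI : measurable (`]-oo, 0] : set (measurableTypeR R)) by exact: measurable_itv.
    move: iB => /(integrable_mkcond _ mI).
    by congr (_.-integrable _ _); apply/funext => r; rewrite /= !patchE; case: ifP.
  + by apply: integrable_realZ => //; exact: integrable_line.
Qed.

End radon_functionals.

(** * Lebesgue measure and absolute continuity *)

Section lebesgue_rV_properties.
Variables (R : realType) (n : nat).
Local Notation E := 'rV[R]_n.
Local Notation e := (fun i : 'I_n => delta_mx ord0 i : 'rV[R]_n).
Local Notation RR := (measurableTypeR R).
Local Notation leb := (@lebesgue_measure R).
Local Notation lam := (lebesgue_rV R n).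

Definition side (a b : R) : R := if a < b then b - a else 0.

Lemma lebesgue_box (a b : E) :
  lam (box a b) = (\prod_j side (a ord0 j) (b ord0 j))%:E.
Proof.
rewrite (_ : box a b = [set x | forall j, `]a ord0 j, b ord0 j[%classic (x ord0 j)]).
  rewrite (@lebesgue_rV_box R n (fun j => `]a ord0 j, b ord0 j[%classic)); last first.
    by move=> j; exact: measurable_itv.
  rewrite -prodEFin; apply: eq_bigr => j _.
  by rewrite lebesgue_measure_itv/= lte_fin /side; case: ifP => // _; rewrite EFinB.
by rewrite eqEsubset; split=> x h j; have := h j; rewrite /= in_itv.
Qed.

Lemma lebesgue_cube_lty (k : R) : (lam (cube k) < +oo)%E.
Proof. by rewrite lebesgue_box ltry. Qed.

Lemma lebesgue_finite_on_compacts : @finite_on_compacts R n lam.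
Proof.
move=> K cK; have [M _ hM] := compact_norm_le cK.
apply: le_lt_trans (lebesgue_cube_lty (M + 1)); apply: le_measure; rewrite ?inE.
- exact: compact_measurable_rV.
- exact: measurable_box.
- move=> x Kx; rewrite cubeE => j.
  by apply: le_lt_trans (coord_le_norm x j) _; rewrite (le_lt_trans (hM x Kx))// ltrDl.
Qed.

Lemma lebesgue_setT_neq0 : lam setT != 0%E.
Proof.
have h : (0 < lam (cube 1%R))%E.
  rewrite lebesgue_box lte_fin; apply: prodr_gt0 => j _; rewrite !mxE /side.
  by rewrite ifT; lra.
rewrite gt_eqF//; apply: lt_le_trans h _; apply: le_measure; rewrite ?inE//.
exact: measurable_box.
Qed.

Lemma continuous_measurable_map (g : E -> E) : continuous g -> measurable_fun setT g.
Proof.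
move=> cg; apply: measurable_fun_rV => j; apply: continuous_measurable_rV => x.
by apply: (@continuous_comp _ _ _ g (fun y : E => y ord0 j)); [exact: cg|exact: coord_continuous].
Qed.

Lemma continuous_translation (v : E) : continuous (fun x : E => v + x).
Proof. by move=> x; apply: (@continuousD _ _ _ (cst v) id x); [exact: cst_continuous|exact: cvg_id]. Qed.

Lemma continuous_scaling (t : R) : continuous (fun x : E => t *: x).
Proof. by move=> x; exact: scaler_continuous. Qed.

Lemma lebesgue_translation (v : E) (A : set E) : measurable A ->
  lam ((fun x => v + x) @^-1` A) = lam A.
Proof.
move=> mA.
have mt := continuous_measurable_map (@continuous_translation v).
apply/esym.
pose m2 : {measure set E -> \bar R} := pushforward lam (fun x => v + x).
apply: (measure_box_unique (m1 := lam) (m2 := m2 mt)) => // [a b|k]; last first.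
  exact: lebesgue_cube_lty.
rewrite /m2 /= /pushforward.
rewrite (_ : _ @^-1` box a b = box (a - v) (b - v)).
  rewrite !lebesgue_box; congr EFin; apply: eq_bigr => j _.
  by rewrite !mxE /side ltrD2r; case: ifP => // _; rewrite opprB addrA subrK.
rewrite eqEsubset; split=> x h j; have := h j; rewrite !mxE; lra.
Qed.

Lemma lebesgue_scaling (t : R) (A : set E) : 0 < t -> measurable A ->
  lam ((fun x => t *: x) @^-1` A) = ((t^-1 ^+ n)%:E * lam A)%E.
Proof.
move=> t0 mA.
have mt := continuous_measurable_map (@continuous_scaling t).
have tn0 : 0 <= t^-1 ^+ n by rewrite exprn_ge0// invr_ge0 ltW.
pose m1 : {measure set E -> \bar R} := pushforward lam (fun x => t *: x).
pose m2 : {measure set E -> \bar R} := mscale (NngNum tn0) lam.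
have preE a b : (fun x => t *: x) @^-1` box a b = box (t^-1 *: a) (t^-1 *: b).
  rewrite eqEsubset; split=> x h j; have := h j; rewrite !mxE.
    by rewrite ltr_pdivrMl// ltr_pdivlMl.
  by rewrite ltr_pdivrMl// ltr_pdivlMl.
suff : m1 mt A = m2 A by [].
apply: (measure_box_unique (m1 := m1 mt) (m2 := m2)) => // [a b|k]; last first.
  by rewrite /m1 /= /pushforward preE lebesgue_box ltry.
rewrite /m1 /m2 /= /pushforward /mscale/= preE !lebesgue_box -EFinM; congr EFin.
rewrite -[X in _ ^+ X]card_ord -prodr_const -big_split/=; apply: eq_bigr => j _.
rewrite !mxE /side ltr_pM2l ?invr_gt0//; case: ifP => _; last by rewrite mulr0.
by rewrite mulrBr.
Qed.

Lemma measurable_section (A : set E) i (x : E) : measurable A ->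
  measurable ([set r : R | A (r *: e i + x)] : set RR).
Proof.
move=> mA; rewrite -[X in measurable X]setTI.
exact: (measurableT_comp (measurable_line_map i) (pair1_measurable x)).
Qed.

(* The bad lines of a Lebesgue null set form a null set, which is invariant in
   direction [i] and inherits the other invariances of [A]. *)
Definition bad_lines i (A : set E) : set E :=
  [set x | leb [set r : R | A (r *: e i + x)] != 0%E].

Let lineI i (A : set E) (z : E * RR) : \bar R := (\1_A (line_map i z))%:E.

Let lineIE i A x : measurable A ->
  fubini_F leb (lineI i A) x = leb [set r : R | A (r *: e i + x)].
Proof.
move=> mA; rewrite /fubini_F -[X in leb X]setIT -integral_indic//.
exact: measurable_section.
Qed.

Let mlineI i A : measurable A -> measurable_fun setT (lineI i A).
Proof.
move=> mA; apply/measurable_EFinP.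
by apply: (measurableT_comp _ (measurable_line_map i)); exact: measurable_indic.
Qed.

Lemma measurable_bad_lines i A : measurable A -> measurable (bad_lines i A).
Proof.
move=> mA; have mF : measurable_fun setT (fubini_F leb (lineI i A)).
  apply: measurable_fun_fubini_tonelli_F; first exact: mlineI.
  by move=> z; rewrite lee_fin.
rewrite (_ : bad_lines i A = fubini_F leb (lineI i A) @^-1` (~` [set 0%E])).
  by rewrite -[X in measurable X]setTI; apply: mF => //; exact: measurableC.
by rewrite eqEsubset; split=> x; rewrite /bad_lines /= lineIE// => /eqP.
Qed.

(** By Tonelli's theorem the integral over [x] of the length of the section through [x] equals the
    integral over [r] of the measure of a translate of [A], which is 0; so almost every section is
    null. *)
Lemma bad_lines_null i A : measurable A -> lam A = 0%E -> lam (bad_lines i A) = 0%E.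
Proof.
move=> mA A0; have mF : measurable_fun setT (fubini_F leb (lineI i A)).
  apply: measurable_fun_fubini_tonelli_F; first exact: mlineI.
  by move=> z; rewrite lee_fin.
have F0 z : (0 <= lineI i A z)%E by rewrite lee_fin.
have int0 : (\int[lam]_x `|fubini_F leb (lineI i A) x| = 0)%E.
  transitivity (\int[lam]_x fubini_F leb (lineI i A) x)%E.
    by apply: eq_integral => x _; rewrite gee0_abs// integral_ge0.
  rewrite fubini_tonelli//; last exact: mlineI.
  apply: integral0_eq => r _; rewrite /lineI.
  transitivity (\int[lam]_x (\1_((fun x => r *: e i + x) @^-1` A) x)%:E)%E => //.
  have mt := continuous_measurable_map (@continuous_translation (r *: e i)).
  rewrite integral_indic//; last first.
    by rewrite -[X in measurable X]setTI; exact: mt.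
  by rewrite setIT; exact: etrans (lebesgue_translation (r *: e i) mA) A0.
move/(ae_eq_integral_abs lam measurableT mF) : int0 => [N [mN N0 sub]].
apply/eqP; rewrite eq_le measure_ge0 andbT -N0; apply: le_measure; rewrite ?inE//.
  exact: measurable_bad_lines.
move=> x bx; apply: sub => /= /(_ I); rewrite lineIE// => h.
by move: bx; rewrite /bad_lines /= h eqxx.
Qed.

Definition line_invariant i (C : set E) := forall (r : R) x, C x -> C (r *: e i + x).

Lemma line_invariantE i C r x : line_invariant i C -> C (r *: e i + x) = C x.
Proof.
move=> iC; apply/propext; split; last exact: iC.
by move/(iC (- r)); rewrite scaleNr addKr.
Qed.

Lemma lebesgue_measure_shift (a : R) (S : set RR) : measurable S ->
  leb [set r : R | S (r + a)] = leb S.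
Proof.
move=> mS; apply/esym.
have ms : measurable_fun setT (fun r : RR => (r + a : RR)).
  exact: (@measurable_funD _ RR R setT id (cst a)).
pose m2 : {measure set RR -> \bar R} := pushforward leb (fun r : RR => (r + a : RR)).
apply: (lebesgue_measure_unique (mu := m2 ms)) => // _ [[x y] _ <-].
rewrite /m2 /= /pushforward.
rewrite (_ : _ @^-1` _ = `]x - a, y - a]%classic).
  rewrite !lebesgue_measure_itv/= !lte_fin ltrD2r; case: ifP => // _.
  by rewrite -!EFinB opprB addrA subrK.
by rewrite eqEsubset; split=> r /=; rewrite !in_itv/=; lra.
Qed.

Lemma bad_lines_invariant i j A : measurable A -> j = i \/ line_invariant j A ->
  line_invariant j (bad_lines i A).
Proof.
move=> mA [->|jA] r x; rewrite /bad_lines /=.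
  rewrite -(lebesgue_measure_shift r (measurable_section i x mA)).
  rewrite (_ : [set s | A (s *: e i + (r *: e i + x))] =
    [set s | [set s | A (s *: e i + x)] (s + r)])//.
  by apply/funext => s; rewrite /= addrA -scalerDl.
rewrite (_ : [set _ | A (_ + (_ + _))] = [set s | A (s *: e i + x)])//.
by apply/funext => s; rewrite /= addrCA (line_invariantE _ _ jA).
Qed.

Lemma all_invariant (C : set E) x y : (forall i, line_invariant i C) -> C x -> C y.
Proof.
move=> iC Cx; rewrite -(subrK x y) [y - x]row_sum_delta.
elim: (index_enum _) => [|j s IH]; first by rewrite big_nil add0r.
by rewrite big_cons -addrA; exact: iC.
Qed.

(** Induction on the list [s] of directions in which the null set [C] containing [A] is not yet
    known to be invariant. Outside the bad lines of [C] in direction [i], the sections of [A] are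
    null and the hypothesis applies; the rest of [A] lies in [bad_lines i C], again a null set, now
    invariant in direction [i] too. *)
Lemma section_null_lebesgue_null (p q : {measure set E -> \bar R}) :
  (forall i A, measurable A -> section_null i A -> p A = q A) ->
  forall A, measurable A -> lam A = 0%E -> p A = q A.
Proof.
move=> pq.
have ind (s : seq 'I_n) : forall A C, measurable A -> measurable C -> A `<=` C ->
    lam C = 0%E -> (forall i, i \notin s -> line_invariant i C) -> p A = q A.
  elim: s => [|i s IH] A C mA mC AC C0 iC.
    (* A nonempty set invariant in all directions is the whole space, which is not null. *)
    have -> : A = set0.
      apply/eqP; apply: contraT => /set0P[x /AC Cx]; exfalso.
      have : C = setT by rewrite -subTset => y _; apply: all_invariant Cx => i; exact: iC.
      by move=> CT; have := lebesgue_setT_neq0; rewrite -CT C0 eqxx.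
    by rewrite !measure0.
  have mB := measurable_bad_lines i mC; have B0 := bad_lines_null i mC C0.
  rewrite (measureDI p mA mB) (measureDI q mA mB); congr (_ + _)%E.
    apply: (pq i); first exact: measurableD.
    move=> x; have [Bx|nBx] := pselect (bad_lines i C x).
      rewrite (_ : [set _ | _] = set0) ?measure0// -subset0 => r [_]; apply.
      by apply: bad_lines_invariant => //; left.
    apply/eqP; rewrite eq_le measure_ge0 andbT.
    have -> : 0%E = leb [set r : R | C (r *: e i + x)].
      by apply/esym/eqP; apply: contrapT => h; apply: nBx; apply/negP.
    apply: le_measure; rewrite ?inE.
    - by apply: measurable_section; exact: measurableD.
    - exact: measurable_section.
    - by move=> r [/AC].
  apply: (IH _ (bad_lines i C)) => //; first exact: measurableI.
  move=> j js; apply: bad_lines_invariant => //.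
  have [->|ji] := eqVneq j i; first by left.
  by right; apply: iC; rewrite inE negb_or ji.
move=> A mA A0; apply: (ind (enum 'I_n) A A) => // i.
by rewrite mem_enum.
Qed.

End lebesgue_rV_properties.

Section radon_absolute_continuity.
Variables (R : realType) (n : nat).
Local Notation E := 'rV[R]_n.
Local Notation lam := (lebesgue_rV R n).
Implicit Types (T : gfun R n) (mu nu : signed_measure R n).

(** Moving the negative parts across reduces the claim to the uniqueness of positive measures and
    avoids differences of infinite masses. *)
Lemma signed_measure_unique mu nu :
  (forall f, test_function f -> gfun_of_measure mu f = gfun_of_measure nu f) ->
  forall A, measurable A -> (spos mu A + sneg nu A = spos nu A + sneg mu A)%E.
Proof.
move=> munu A mA.
have mp := @spos_finite _ _ mu; have mq := @sneg_finite _ _ mu.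
have np := @spos_finite _ _ nu; have nq := @sneg_finite _ _ nu.
have := @measure_test_unique R n (measure_add (spos mu) (sneg nu))
  (measure_add (spos nu) (sneg mu)) (finite_on_compactsD mp nq)
  (finite_on_compactsD np mq) _ A mA.
rewrite -[X in _ -> X = _]measure_addE -[X in _ -> _ = X]measure_addE; apply => f tf.
rewrite !Rintegral_measure_add//.
by have := munu f tf; rewrite /gfun_of_measure; lra.
Qed.

(* Integrating along the i-th coordinate shows that [T] gives no mass to the
   sets whose lines in that direction are null; by Fubini's theorem a Lebesgue
   null set is exhausted by such sets, one direction after the other. *)
Lemma radon_partial_ac T mu : gfun_eq T (gfun_of_measure mu) ->
  (forall i, radon (gfun_partial i T)) ->
  forall A, measurable A -> lam A = 0%E -> spos mu A = sneg mu A.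
Proof.
move=> Tmu rpT; apply: section_null_lebesgue_null => i A mA sA.
have rT : radon T by exists mu.
(* [nu] represents [f |-> T (P f) - (d_i T) (V f)], which is [T] by the homotopy formula. Its two
   parts vanish on [A], and [mu] is compared with it. *)
have [nu [nuE nu0]] := radon_nullB (radon_cutoff_proj i rT) (radon_cutoff_prim i (rpT i)).
have := @signed_measure_unique mu nu _ A mA.
have [-> ->] := nu0 A mA sA; rewrite adde0 add0e; apply => f tf.
rewrite -nuE// -Tmu// /gfun_partial partial_cutoff_prim//.
rewrite radon_sub//; last exact: test_cutoff_proj.
by rewrite opprK addrC subrK.
Qed.

End radon_absolute_continuity.

(** * Homogeneity *)

Section radon_scaling.
Variables (R : realType) (n : nat).
Local Notation E := 'rV[R]_n.
Local Notation e := (fun i : 'I_n => delta_mx ord0 i : 'rV[R]_n).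
Implicit Types (T : gfun R n).

Definition scale_fun (t : R) (f : E -> R) (x : E) : R := f (t *: x).

Lemma is_derive_scale_fun t j f x : smooth f ->
  is_derive x (e j) (scale_fun t f) (t * scale_fun t (partial j f) x).
Proof.
move=> sf; apply/is_derive_line0.
have d1 : is_derive (0 : R) 1 (fun h : R => f (h *: e j + t *: x)) (partial j f (t *: x)).
  exact: (is_derive_line0 _ _ _ _).1 (smooth_is_derive _ _ sf).
have d2 : is_derive (0 : R) 1 (fun h : R => t * h) t.
  by apply: is_derive_eq; rewrite /GRing.scale/= mulr1.
rewrite (_ : (fun h => _) = (fun h : R => f (h *: e j + t *: x)) \o (fun h : R => t * h)).
  rewrite mulrC /scale_fun; apply: is_derive1_comp d2.
  by rewrite mulr0.
by apply/funext => h; rewrite /scale_fun/= scalerDr scalerA.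
Qed.

Lemma partial_scale_fun t j f : smooth f ->
  partial j (scale_fun t f) = fun x => t * scale_fun t (partial j f) x.
Proof. by move=> sf; apply: partialE => x; exact: is_derive_scale_fun. Qed.

(** Each derivative brings out a factor [t], so the class stable under [partial] consists of the
    multiples of the [scale_fun t f]. *)
Lemma smooth_scale_fun t f : smooth f -> smooth (scale_fun t f).
Proof.
move=> sf; apply: (@smooth_coind _ _ (fun g => exists c f,
    smooth f /\ g = fun x => c * scale_fun t f x)); last first.
  by exists 1, f; split=> //; apply/funext => x; rewrite mul1r.
move=> _ {sf} [c [{}f [sf ->]]]; split=> [|j].
  move=> x; apply: (@continuousM _ _ (cst c) (scale_fun t f)); first exact: cst_continuous.
  apply: (@continuous_comp _ _ _ (fun x : E => t *: x) f).
    exact: (@continuous_scaling R n t).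
  exact: smooth_continuous.
have dj x : is_derive x (e j) (fun x => c * scale_fun t f x)
    (c * t * scale_fun t (partial j f) x).
  rewrite -mulrA.
  have dc := is_derive_cst c x (e j).
  have := is_deriveM dc (is_derive_scale_fun t j x sf).
  by rewrite /GRing.scale/= mulr0 addr0.
rewrite (partialE dj); split=> [x|]; first by have [] := dj x.
by exists (c * t), (partial j f); split=> //; exact: smooth_partial.
Qed.

Lemma scale_support (t c M : R) f : 0 < c -> c <= t ->
  (forall x, M < `|x| -> f x = 0) ->
  forall x : E, M / c < `|x| -> scale_fun t f x = 0.
Proof.
move=> c0 ct fM x xM; apply: fM; rewrite normrZ gtr0_norm ?(lt_le_trans c0)//.
by move: xM; rewrite ltr_pdivrMr// mulrC => /lt_le_trans; apply; rewrite ler_wpM2r.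
Qed.

Lemma test_scale_fun t f : 0 < t -> test_function f -> test_function (scale_fun t f).
Proof.
move=> t0 tf; have [M _ hM] := test_bounded_support tf.
apply: (@test_intro _ _ _ (M / t)); first exact/smooth_scale_fun/test_smooth.
exact: scale_support hM.
Qed.

Definition euler (f : E -> R) (x : E) : R := \sum_j x ord0 j * partial j f x.

Lemma test_euler f : test_function f -> test_function (euler f).
Proof. by move=> tf; apply: test_sum => j; apply: test_coordM; exact: test_partial. Qed.

Lemma euler_scale t f : smooth f -> euler (scale_fun t f) = scale_fun t (euler f).
Proof.
move=> sf; apply/funext => x; rewrite /euler /scale_fun; apply: eq_bigr => j _.
by rewrite partial_scale_fun// mxE mulrCA mulrA.
Qed.

Lemma is_derive_scale_t f (x : E) (t : R) : smooth f -> t != 0 ->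
  is_derive t 1 (fun s => scale_fun s f x) (t^-1 * scale_fun t (euler f) x).
Proof.
move=> sf tn0.
have := is_derive_smooth (t *: x) x sf; rewrite -[X in is_derive X](addr0 (t *: x)).
move/is_derive_line; congr is_derive.
  by apply/funext => s; rewrite addr0.
rewrite /scale_fun /euler mulr_sumr; apply: eq_bigr => j _.
by rewrite mxE !mulrA mulVf// mul1r.
Qed.

(** Differentiation under the integral for [s] in []t/2, 2t[]: there [s^-1] is at most [(t/2)^-1]
    and all supports lie in the cube of radius [M / (t/2)], which gives the majorant [G]. *)
Lemma is_derive_measure_scale (m : {measure set E -> \bar R}) f (t : R) :
  finite_on_compacts m -> test_function f -> 0 < t ->
  is_derive t 1 (fun s => \int[m]_x scale_fun s f x)
    (t^-1 * \int[m]_x scale_fun t (euler f) x).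
Proof.
move=> mf tf t0; have sf := test_smooth tf.
have [M M0 hM] := test_bounded_support (test_euler tf).
have [K K0 hK] := test_bounded (test_euler tf).
have t20 : 0 < t / 2 by rewrite divr_gt0.
pose F (s : R) (x : E) := scale_fun s f x.
have inI : `](t / 2), (t * 2)[%classic t by rewrite /= in_itv/=; apply/andP; split; lra.
have Igt0 s : `](t / 2), (t * 2)[%classic s -> t / 2 < s.
  by rewrite /= in_itv/= => /andP[].
have dF s x : t / 2 < s -> is_derive s 1 (F ^~ x) (s^-1 * scale_fun s (euler f) x).
  by move=> ts; apply: is_derive_scale_t => //; rewrite gt_eqF// (lt_trans t20).
have F1 s x : t / 2 < s -> partial1of2 F s x = s^-1 * scale_fun s (euler f) x.
  by move=> ts; rewrite partial1of2E; have [_] := dF s x ts.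
pose B := [set x : E | `|x| <= M / (t / 2)].
have mB : measurable B by exact: measurable_norm_le.
pose G (x : E) : R := (t / 2)^-1 * K * \1_B x.
have G0 x : 0 <= G x by rewrite /G !mulr_ge0 ?invr_ge0 ?(ltW t20)// indicE.
have iG : m.-integrable setT (EFin \o G).
  apply: (@integrable_bounded_support _ _ _ _ ((t / 2)^-1 * K) (M / (t / 2)) mf).
  - by apply: measurable_funM => //; exact: measurable_indic.
  - move=> x; rewrite ger0_norm// /G indicE; case: (_ \in _); rewrite ?mulr1//.
    by rewrite mulr0 mulr_ge0// invr_ge0 ltW.
  - by move=> x xM; rewrite /G indicE memNset ?mulr0//= => h; move: xM; rewrite ltNge h.
have key := @cvg_differentiation_under_integral R _ _ m F setT measurableT t _ _ inI _ _ G G0 iG _.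
have {}key : h^-1 *: (\int[m]_x F (h + t) x - \int[m]_x F t x) @[h --> 0^'] -->
    t^-1 * \int[m]_x scale_fun t (euler f) x.
  rewrite -RintegralZl//; last first.
    exact: (test_integrable mf (test_scale_fun t0 (test_euler tf))).
  have -> : \int[m]_x (t^-1 * scale_fun t (euler f) x) = \int[m]_x partial1of2 F t x.
    by apply: eq_Rintegral => x _; rewrite F1//; exact: Igt0.
  apply: key.
  - move=> s /Igt0 ts; apply: test_integrable => //; apply: test_scale_fun => //.
    exact: lt_trans ts.
  - by move=> s x /Igt0 ts _; have [] := dF s x ts.
  - move=> s x /Igt0 ts _; rewrite F1//.
    have s0 : 0 < s by exact: lt_trans ts.
    rewrite normrM gtr0_norm ?invr_gt0// /G indicE.
    case: (boolP (x \in B)) => xB.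
      rewrite mulr1; apply: ler_pM => //; first by rewrite invr_ge0 ltW.
        by rewrite lef_pV2// ?posrE// ltW.
      exact: hK.
    rewrite (@scale_support s (t / 2) M)//; first by rewrite normr0 !mulr0.
      exact: ltW.
    by move: xB; rewrite notin_setE /B/= => /negP; rewrite -ltNge.
split.
  apply/cvg_ex; exists (t^-1 * \int[m]_x scale_fun t (euler f) x) => /=.
  by under eq_fun do rewrite scaler1.
by apply/cvg_lim => //=; under eq_fun do rewrite scaler1.
Qed.

Lemma is_derive_radon_scale T f (t : R) : radon T -> test_function f -> 0 < t ->
  is_derive t 1 (fun s => T (scale_fun s f)) (t^-1 * T (scale_fun t (euler f))).
Proof.
move=> [mu Tmu] tf t0.
have dp := is_derive_measure_scale (@spos_finite _ _ mu) tf t0.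
have dq := is_derive_measure_scale (@sneg_finite _ _ mu) tf t0.
rewrite Tmu; last by apply: test_scale_fun => //; exact: test_euler.
rewrite /gfun_of_measure mulrBr.
apply: near_eq_is_derive (is_deriveB dp dq).
have : \forall s \near t, 0 < s by exact: lt_nbhsr.
apply: filterS => s s0; rewrite Tmu//; exact: test_scale_fun.
Qed.

(* By Euler's equation [s |-> e^{c s} T (f (e^s x))] has derivative zero. *)
Lemma radon_euler_scale T f (t : R) (c : nat) : radon T ->
  (forall g, test_function g -> T (euler g) = - c%:R * T g) ->
  test_function f -> 0 < t -> t ^+ c * T (scale_fun t f) = T f.
Proof.
move=> rT eT tf t0.
pose H (s : R) : R := expR (c%:R * s) * T (scale_fun (expR s) f).
have H0 : H 0 = T f.
  rewrite /H mulr0 !expR0 mul1r; congr T.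
  by apply/funext => x; rewrite /scale_fun scale1r.
have Ht : H (ln t) = t ^+ c * T (scale_fun t f).
  by rewrite /H expRM_natl lnK.
rewrite -H0 -Ht; apply: is_derive_0_is_cst => s.
have s0 := expR_gt0 s.
have d1 := is_derive_radon_scale rT tf s0.
have d2 : is_derive s 1 ((fun s => T (scale_fun s f)) \o expR)
    ((expR s)^-1 * T (scale_fun (expR s) (euler f)) * expR s).
  exact: is_derive1_comp.
have d3 : is_derive s 1 (expR \o (fun s : R => c%:R * s)) (expR (c%:R * s) * c%:R).
  apply: is_derive1_comp; apply: is_derive_eq.
  by rewrite /GRing.scale/= mulr1.
apply: (is_derive_eq (is_deriveM d3 d2)).
rewrite -euler_scale; last exact: test_smooth.
rewrite eT; last exact: test_scale_fun.
by rewrite /GRing.scale/=; field; rewrite gt_eqF.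
Qed.

(** Obtained by differentiating the constant function [t |-> t^c T (f (t x))] at [t = 1]. *)
Lemma radon_scale_euler T f (c : nat) : radon T ->
  (forall t, 0 < t -> t ^+ c * T (scale_fun t f) = T f) ->
  test_function f -> T (euler f) = - c%:R * T f.
Proof.
move=> rT hT tf.
have d1 := is_derive_radon_scale rT tf ltr01.
have d2 := is_deriveM (is_deriveX c (is_derive_id (1 : R) (1 : R))) d1.
have d3 : is_derive (1 : R) 1 (cst (T f)) (c%:R * T f + T (euler f)).
  apply: near_eq_is_derive (is_derive_eq d2 _).
    have : \forall s \near (1 : R), 0 < s by exact: lt_nbhsr.
    by apply: filterS => s s0; rewrite -(hT s s0) exprfctE.
  rewrite !exprfctE invr1 /GRing.scale/= !expr1n !mul1r !mulr1.
  rewrite (_ : scale_fun 1 f = f); last by apply/funext => x; rewrite /scale_fun scale1r.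
  rewrite (_ : scale_fun 1 (euler f) = euler f); last by apply/funext => x; rewrite /scale_fun scale1r.
  by rewrite addrC [T f * _]mulrC.
have [_ d4] := d3; move: d4; rewrite derive_cst => /eqP.
by rewrite eq_sym addrC addr_eq0 mulNr => /eqP.
Qed.

End radon_scaling.

(** * Radon-Nikodym densities of differences of measures *)

Section signed_density.
Variables (R : realType) (n : nat).
Local Notation E := 'rV[R]_n.
Local Notation lam := (lebesgue_rV R n).

(** Only the difference [p - q] is absolutely continuous, not [p] and [q] themselves. Cut down to
    [D] both are finite, so the difference is a charge to which the Radon-Nikodym theorem
    applies. *)
Lemma signed_density (p q : {measure set E -> \bar R}) (D : set E) :
  measurable D -> (p D < +oo)%E -> (q D < +oo)%E ->
  (forall A, measurable A -> lam A = 0%E -> p A = q A) ->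
  exists h : E -> R, [/\ measurable_fun setT h, (forall x, ~ D x -> h x = 0),
    lam.-integrable setT (EFin \o h) &
    forall A, measurable A ->
      (p (A `&` D) + \int[lam]_(x in A) (Num.max (- h x) 0)%:E =
       q (A `&` D) + \int[lam]_(x in A) (Num.max (h x) 0)%:E)%E].
Proof.
move=> mD pD qD pq.
pose p' : {finite_measure set E -> \bar R} := mfrestr mD pD.
pose q' : {finite_measure set E -> \bar R} := mfrestr mD qD.
pose nu : {charge set E -> \bar R} :=
  cadd (charge_of_finite_measure p') (copp (charge_of_finite_measure q')).
have nuE A : nu A = (p (A `&` D) - q (A `&` D))%E by [].
have pfin A : measurable A -> p (A `&` D) \is a fin_num.
  move=> mA; rewrite ge0_fin_numE//.
  have h : (p (A `&` D) <= p D)%E.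
    by apply: le_measure; rewrite ?inE//; exact: measurableI.
  exact: le_lt_trans h pD.
have qfin A : measurable A -> q (A `&` D) \is a fin_num.
  move=> mA; rewrite ge0_fin_numE//.
  have h : (q (A `&` D) <= q D)%E.
    by apply: le_measure; rewrite ?inE//; exact: measurableI.
  exact: le_lt_trans h qD.
have nulam : nu `<< lam.
  apply/null_content_dominatesP => A mA A0; rewrite nuE (pq (A `&` D)).
  - by rewrite subee// qfin.
  - exact: measurableI.
  - apply/eqP; rewrite eq_le measure_ge0 andbT -A0.
    by apply: le_measure; rewrite ?inE//; exact: measurableI.
pose g := Radon_Nikodym nu lam.
have gfin x : g x \is a fin_num by exact: Radon_Nikodym_fin_num.
have gint : lam.-integrable setT g by exact: Radon_Nikodym_integrable.
have gE A : measurable A -> nu A = (\int[lam]_(x in A) g x)%E.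
  by move=> mA; exact: Radon_Nikodym_integral.
pose h x : R := fine (g x) * \1_D x.
have hE : EFin \o h = g \_ D.
  apply/funext => x; rewrite /h /= patchE indicE; case: ifP => _.
    by rewrite mulr1 fineK.
  by rewrite mulr0.
have hint : lam.-integrable setT (EFin \o h).
  by rewrite hE; apply/(integrable_mkcond _ mD); exact: integrableS gint.
have mh : measurable_fun setT h by apply/measurable_EFinP; exact: measurable_int hint.
exists h; split=> // [x Dx|A mA]; first by rewrite /h indicE memNset// mulr0.
have hintA : lam.-integrable A (EFin \o h) by exact: integrableS hint.
have ip := integrable_funepos mA hintA; have iq := integrable_funeneg mA hintA.
have hp : (EFin \o h)^\+%E = (fun x => (Num.max (h x) 0)%:E).
  by apply/funext => x; rewrite funeposE /= EFin_max.
have hn : (EFin \o h)^\-%E = (fun x => (Num.max (- h x) 0)%:E).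
  by apply/funext => x; rewrite funenegE /= EFin_max EFinN.
rewrite hp in ip; rewrite hn in iq.
have EA : (p (A `&` D) - q (A `&` D) =
  \int[lam]_(x in A) (Num.max (h x) 0)%:E - \int[lam]_(x in A) (Num.max (- h x) 0)%:E)%E.
  have -> : (\int[lam]_(x in A) (Num.max (h x) 0)%:E -
      \int[lam]_(x in A) (Num.max (- h x) 0)%:E = \int[lam]_(x in A) (EFin \o h) x)%E.
    by rewrite [RHS]integralE hp hn.
  rewrite hE -integral_mkcondr -gE; last exact: measurableI.
  by rewrite nuE -setIA setIid.
have fp := pfin A mA; have fq := qfin A mA.
have fip := integrable_fin_num mA ip; have fiq := integrable_fin_num mA iq.
move: EA => /=; rewrite -(fineK fp) -(fineK fq) -(fineK fip) -(fineK fiq).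
by rewrite -!EFinB -!EFinD => -[EA]; congr EFin; lra.
Qed.

End signed_density.

(** * Averages over dilations *)

Section homogeneous_density.
Variables (R : realType) (n : nat).
Local Notation E := 'rV[R]_n.
Local Notation lam := (lebesgue_rV R n).
Local Notation leb := (@lebesgue_measure R).
Local Notation RR := (measurableTypeR R).

Lemma lebesgue_integral_scaling (F : E -> \bar R) (t : R) : 0 < t ->
  measurable_fun setT F -> (forall x, 0 <= F x)%E ->
  (\int[lam]_x F (t *: x) = (t^-1 ^+ n)%:E * \int[lam]_x F x)%E.
Proof.
move=> t0 mF F0.
have mt := continuous_measurable_map (@continuous_scaling R n t).
have tn0 : 0 <= t^-1 ^+ n by rewrite exprn_ge0// invr_ge0 ltW.
have := @ge0_integral_pushforward _ _ _ E R _ mt lam setT F measurableT mF.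
rewrite preimage_setT => <-; last by move=> y _; exact: F0.
rewrite -[(t^-1 ^+ n)]/((NngNum tn0)%:num) -ge0_integral_mscale//.
apply: eq_measure_integral => A mA _.
exact: lebesgue_scaling.
Qed.

Lemma lebesgue_integral_shift (F : RR -> \bar R) (a : R) :
  measurable_fun setT F -> (forall x, 0 <= F x)%E ->
  (\int[leb]_r F (r + a)%R = \int[leb]_r F r)%E.
Proof.
move=> mF F0.
have ms : measurable_fun setT (fun r : RR => (r + a : RR)).
  exact: (@measurable_funD _ RR R setT id (cst a)).
have := @ge0_integral_pushforward _ _ _ RR R _ ms leb setT F measurableT mF.
rewrite preimage_setT => <-; last by move=> y _; exact: F0.
apply: eq_measure_integral => A mA _.
exact: lebesgue_measure_shift.
Qed.

Lemma integral_expN (a : R) : (\int[leb]_(r in `[a, +oo[) (expR (- r))%:E = (expR (- a))%:E)%E.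
Proof.
have dF (x : R) : is_derive x 1 (fun x : R => - expR (- x)) (expR (- x)).
  rewrite -[X in is_derive _ _ _ X]opprK -[X in - - X]mulr1 -mulrN.
  by apply: is_deriveN; apply: is_derive1_comp.
have cF : continuous (fun x : R => - expR (- x)).
  by move=> x; apply/differentiable_continuous/derivable1_diffP; have [] := dF x.
rewrite (@ge0_continuous_FTC2y _ _ (fun x => - expR (- x)) _ 0)//.
- by rewrite EFinN oppeK add0e.
- apply: continuous_subspaceT => x.
  by apply: continuous_comp; [exact: opp_continuous|exact: continuous_expR].
- by rewrite -[X in _ --> X]oppr0; apply: cvgN; exact: cvgr_expR.
- by apply: cvg_at_right_filter; exact: cF.
- by move=> x _; rewrite derive1E; have [_ ->] := dF x.
Qed.

(** Homogeneity tested on functions says that [t^c] times the image of [mu] under [x |-> t x] is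
    [mu] as a functional; uniqueness carries this over to sets. *)
Lemma radon_scale_sets T mu (c : nat) (t : R) : gfun_eq T (@gfun_of_measure R n mu) ->
  0 < t -> (forall f, test_function f -> t ^+ c * T (scale_fun t f) = T f) ->
  forall A : set E, measurable A ->
  ((t ^+ c)%:E * spos mu ((fun x => t *: x) @^-1` A) + sneg mu A =
   (t ^+ c)%:E * sneg mu ((fun x => t *: x) @^-1` A) + spos mu A)%E.
Proof.
move=> Tmu t0 Tt A mA.
have mt := continuous_measurable_map (@continuous_scaling R n t).
have tc0 : 0 <= t ^+ c by rewrite exprn_ge0// ltW.
have part (m : {measure set E -> \bar R}) : finite_on_compacts m ->
    exists nu : {measure set E -> \bar R}, [/\ finite_on_compacts nu,
      forall A : set E, measurable A -> nu A = ((t ^+ c)%:E * m ((fun x => t *: x) @^-1` A))%E &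
      forall f, test_function f -> \int[nu]_x f x = t ^+ c * \int[m]_x f (t *: x)].
  move=> mf; have [nu [nuA nuf]] := weighted_pushforward m mt (@measurable_cst _ _ E R setT (t ^+ c)) (fun=> tc0).
  have nuE (B : set E) : measurable B -> nu B = ((t ^+ c)%:E * m ((fun x => t *: x) @^-1` B))%E.
    move=> mB; rewrite nuA; under eq_integral do rewrite [cst _ _]/=; rewrite (integral_cst m)//.
    by rewrite -[X in measurable X]setTI; exact: mt.
  exists nu; split=> // [K cK|f tf].
    rewrite nuE; last exact: compact_measurable_rV.
    apply: lte_mul_pinfty; rewrite ?lee_fin//.
    have [M _ hM] := compact_norm_le cK.
    apply: le_lt_trans (mf _ (@compact_cube R n (M / t))).
    apply: le_measure; rewrite ?inE.
    - by rewrite -[X in measurable X]setTI; apply: mt => //; exact: compact_measurable_rV.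
    - exact: measurable_norm_le.
    - move=> x /= /hM; rewrite normrZ gtr0_norm// => xM.
      by rewrite ler_pdivlMr// mulrC.
  have tfs : test_function (scale_fun t f) by exact: test_scale_fun.
  rewrite (weighted_integral _ (test_measurable tf) nuf)// RintegralZl//.
  exact: (test_integrable mf tfs).
have [np [npc npA npf]] := part _ (@spos_finite _ _ mu).
have [nq [nqc nqA nqf]] := part _ (@sneg_finite _ _ mu).
have := @signed_measure_unique R n (SignedMeasure npc nqc) mu _ A mA.
rewrite /= npA// nqA// => ->; first by rewrite addeC.
move=> f tf; rewrite -Tmu// -Tt// Tmu; last exact: test_scale_fun.
by rewrite /gfun_of_measure /= npf// nqf// mulrBr.
Qed.

Lemma tonelli_line (m : {measure set E -> \bar R}) (k : E * RR -> \bar R) :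
  finite_on_compacts m -> measurable_fun setT k -> (forall z, 0 <= k z)%E ->
  [/\ measurable_fun setT (fun r : RR => \int[m]_y k (y, r)),
      measurable_fun setT (fun y => \int[leb]_r k (y, r)) &
      \int[leb]_r \int[m]_y k (y, r) = \int[m]_y \int[leb]_r k (y, r)]%E.
Proof.
move=> mf mk k0; have [m' mE] := finite_on_compacts_sigma_finite mf.
rewrite -mE; split.
- exact: (@measurable_fun_fubini_tonelli_G _ _ _ _ _ m' k).
- exact: (@measurable_fun_fubini_tonelli_F _ _ _ _ _ leb k).
- by rewrite -(@fubini_tonelli _ _ _ _ _ m' leb k).
Qed.

Lemma measurable_dilation : measurable_fun setT (fun z : E * RR => expR z.2 *: z.1).
Proof.
apply: measurable_fun_rV => j; under eq_fun do rewrite mxE.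
apply: measurable_funM.
  by apply: measurableT_comp measurable_snd; exact: measurable_expR.
exact: measurableT_comp (measurable_coord _ _) measurable_fst.
Qed.

Lemma measurable_origin : measurable [set (0 : E)].
Proof.
rewrite (_ : [set 0] = [set x : E | `|x| <= 0]); first exact: measurable_norm_le.
by rewrite eqEsubset; split=> x /=; rewrite normr_le0 => /eqP.
Qed.

(** The ratio of the radii is [e], so that for nonzero [y] the [r] with [expR r *: y] in the shell
    form an interval of length exactly 1; no normalizing constant is needed. *)
Definition shell : set E := [set x | 1 <= `|x| <= expR 1].

Lemma measurable_shell : measurable shell.
Proof.
rewrite (_ : shell = (fun x : E => `|x|) @^-1` `[1, expR 1]%classic).
  rewrite -[X in measurable X]setTI.
  apply: (continuous_measurable_rV (@norm_continuous _ _)) => //.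
by rewrite eqEsubset; split=> x; rewrite /= in_itv.
Qed.

Lemma lebesgue_dilation_shell (y : E) : y != 0 ->
  leb [set r : R | shell (expR r *: y)] = 1%E.
Proof.
move=> y0; have ny : 0 < `|y| by rewrite normr_gt0.
rewrite (_ : [set _ | _] = `[- ln `|y|, 1 - ln `|y|]%classic).
  by rewrite lebesgue_measure_itv/= lte_fin ltrDr ltr01 -EFinB opprK subrK.
rewrite eqEsubset; split=> r; rewrite /shell /= in_itv/= normrZ gtr0_norm ?expR_gt0//.
  rewrite -[X in _ * X]lnK ?posrE// -expRD -[X in X <= _ <= _]expR0 !ler_expR.
  by rewrite -lerBlDr add0r lerBrDr.
rewrite -[X in _ -> is_true (_ <= _ * X <= _)]lnK ?posrE// -expRD -[X in _ -> is_true (X <= _ <= _)]expR0 !ler_expR.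
by rewrite -[X in _ -> is_true (X && _)]lerBlDr add0r lerBrDr.
Qed.

(** Tonelli's theorem exchanges [r] and [y]: each nonzero [y] is counted with weight 1, and the
    origin is in no dilated shell. *)
Lemma integral_dilation_shell (m : {measure set E -> \bar R}) (A : set E) :
  finite_on_compacts m -> measurable A ->
  (measurable_fun setT (fun r : RR => m (A `&` [set y | shell (expR r *: y)])) /\
   \int[leb]_r m (A `&` [set y | shell (expR r *: y)]) = m (A `\ (0%R : E)))%E.
Proof.
move=> mf mA.
pose k (z : E * RR) : \bar R := (\1_A z.1 * \1_shell (expR z.2 *: z.1))%:E.
have mk : measurable_fun setT k.
  apply/measurable_EFinP; apply: measurable_funM.
    by apply: measurableT_comp measurable_fst; exact: measurable_indic.
  by apply: measurableT_comp measurable_dilation; apply: measurable_indic; exact: measurable_shell.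
have k0 z : (0 <= k z)%E by rewrite lee_fin mulr_ge0// indicE.
have mD (r : R) : measurable [set y | shell (expR r *: y)].
  rewrite -[X in measurable X]setTI.
  exact: (continuous_measurable_map (@continuous_scaling R n (expR r))) measurable_shell.
have kE r : (\int[m]_y k (y, r) = m (A `&` [set y | shell (expR r *: y)]))%E.
  transitivity (\int[m]_y (\1_(A `&` [set y | shell (expR r *: y)]) y)%:E)%E.
    by apply: eq_integral => y _; rewrite /k /= indicI.
  by rewrite integral_indic ?setIT//; exact: measurableI.
have [mG _ GE] := tonelli_line mf mk k0.
under eq_fun do rewrite -kE; split => //.
rewrite GE; transitivity (\int[m]_y (\1_(A `\ (0 : E)) y)%:E)%E; last first.
  by rewrite integral_indic ?setIT//; apply: measurableD => //; exact: measurable_origin.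
apply: eq_integral => y _; rewrite /k /= setDE indicI /=.
have [->|y0] := eqVneq y 0.
  rewrite (_ : \1_(~` _) _ = 0) ?mulr0; last by rewrite indicE memNset//= => ?; exact.
  apply: integral0_eq => r _; rewrite (_ : \1_shell _ = 0) ?mulr0//.
  by rewrite indicE memNset// /shell /= scaler0 normr0 ler10.
rewrite (_ : \1_(~` _) _ = 1) ?mulr1; last by rewrite indicE mem_set//= => /eqP; rewrite (negbTE y0).
under eq_integral do rewrite EFinM.
have mS : measurable ([set r : R | shell (expR r *: y)] : set RR).
  rewrite -[X in measurable X]setTI.
  exact: (measurableT_comp measurable_dilation (pair1_measurable y)) measurable_shell.
rewrite ge0_integralZl ?lee_fin//.
- rewrite (_ : (fun x : RR => (\1_shell (expR x *: y))%:E) = (fun r => (\1_[set r : R | shell (expR r *: y)] r)%:E))//.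
  rewrite [X in (_ * X)%E](_ : _ = 1%E) ?mule1//.
  by rewrite integral_indic// setIT; exact: lebesgue_dilation_shell.
- apply/measurable_EFinP; apply: measurableT_comp.
    by apply: measurable_indic; exact: measurable_shell.
  exact: (measurableT_comp measurable_dilation (pair1_measurable y)).
Qed.

(** Shifting [r] by [a] shows that the factor [e^{-r}] is the one that makes the average homogeneous
    of degree 1. The value may be infinite at some points. *)
Definition dilation_avg (g : E -> R) (y : E) : \bar R :=
  (\int[leb]_r (expR (- r) * g (expR r *: y))%:E)%E.

Section dilation_avg.
Variables (g : E -> R).
Hypothesis mg : measurable_fun setT g.
Hypothesis g0 : forall x, 0 <= g x.

Let k (z : E * RR) : \bar R := (expR (- z.2) * g (expR z.2 *: z.1))%:E.

Let k0 z : (0 <= k z)%E.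
Proof. by rewrite lee_fin mulr_ge0// expR_ge0. Qed.

Let mk : measurable_fun setT k.
Proof.
apply/measurable_EFinP; apply: measurable_funM; last first.
  exact: measurableT_comp measurable_dilation.
apply: measurableT_comp; first exact: measurable_expR.
exact: measurableT_comp measurable_snd.
Qed.

Lemma measurable_dilation_avg : measurable_fun setT (dilation_avg g).
Proof. by have [_] := tonelli_line (@lebesgue_finite_on_compacts R n) mk k0. Qed.

Lemma dilation_avg_ge0 y : (0 <= dilation_avg g y)%E.
Proof. by apply: integral_ge0 => r _; exact: (k0 (y, r)). Qed.

Lemma dilation_avgZ (a : R) y : dilation_avg g (expR a *: y) = ((expR a)%:E * dilation_avg g y)%E.
Proof.
have mky : measurable_fun setT (fun r : RR => k (y, r)) by exact: measurableT_comp.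
rewrite /dilation_avg -(lebesgue_integral_shift a mky)//.
rewrite -ge0_integralZl//; last first.
  apply: measurableT_comp mky _.
  exact: (@measurable_funD _ RR R setT id (cst a)).
apply: eq_integral => r _; rewrite /k /= -EFinM mulrA -expRD opprD scalerA -expRD.
by rewrite addrCA subrr addr0.
Qed.

Lemma integral_dilation_avg (A : set E) : measurable A ->
  (measurable_fun setT (fun r : RR => \int[lam]_(y in A) (expR (- r) * g (expR r *: y))%:E) /\
   \int[leb]_r \int[lam]_(y in A) (expR (- r) * g (expR r *: y))%:E =
   \int[lam]_(y in A) dilation_avg g y)%E.
Proof.
move=> mA.
pose kA (z : E * RR) : \bar R := ((\1_A z.1)%:E * k z)%E.
have kA0 z : (0 <= kA z)%E by rewrite mule_ge0// lee_fin indicE.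
have mkA : measurable_fun setT kA.
  apply: emeasurable_funM => //; apply/measurable_EFinP.
  by apply: measurableT_comp measurable_fst; exact: measurable_indic.
have [m1 m2 E12] := tonelli_line (@lebesgue_finite_on_compacts R n) mkA kA0.
have kAE r : (\int[lam]_y kA (y, r) = \int[lam]_(y in A) (expR (- r) * g (expR r *: y))%:E)%E.
  rewrite [RHS]integral_mkcond; apply: eq_integral => y _; rewrite /kA patchE indicE /=.
  by case: ifP => _; rewrite ?mul1e ?mul0e.
rewrite -(_ : (fun r : RR => \int[lam]_y kA (y, r))%E =
  (fun r : RR => \int[lam]_(y in A) (expR (- r) * g (expR r *: y))%:E)%E); last exact/funext.
split=> //; rewrite E12 [RHS]integral_mkcond; apply: eq_integral => y _; rewrite patchE.
case: ifP => yA; first by apply: eq_integral => r _; rewrite /kA indicE /= yA mul1e.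
by apply: integral0_eq => r _; rewrite /kA indicE /= yA mul0e.
Qed.

(** The power [n+1] collects the Jacobian [e^{-nr}] of the dilation and the factor [e^{-r}] of the
    average. *)
Lemma integral_dilation_scaling (A : set E) (r : R) : measurable A ->
  (\int[lam]_(y in A) (expR (- r) * g (expR r *: y))%:E =
   (expR (- r) ^+ n.+1)%:E * \int[lam]_(x in (fun x => expR (- r) *: x) @^-1` A) (g x)%:E)%E.
Proof.
move=> mA; have t0 := expR_gt0 (- r); set t := expR (- r) in t0 *.
have tV : expR r = t^-1 by rewrite /t expRN invrK.
have md (s : R) := continuous_measurable_map (@continuous_scaling R n s).
have mB : measurable ((fun x : E => t *: x) @^-1` A).
  by rewrite -[X in measurable X]setTI; exact: md.
pose F (y : E) : \bar R := (\1_A y * (t * g (expR r *: y)))%:E.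
have F0 y : (0 <= F y)%E by rewrite lee_fin !mulr_ge0// ?indicE// ltW.
have mF : measurable_fun setT F.
  apply/measurable_EFinP; apply: measurable_funM; first exact: measurable_indic.
  by apply: measurable_funM => //; exact: measurableT_comp (md _).
have -> : (\int[lam]_(y in A) (t * g (expR r *: y))%:E = \int[lam]_y F y)%E.
  rewrite integral_mkcond; apply: eq_integral => y _; rewrite /F patchE indicE /=.
  by case: ifP => _; rewrite ?mul1r ?mul0r.
have := lebesgue_integral_scaling t0 mF F0.
have -> : (\int[lam]_x F (t *: x) = t%:E * \int[lam]_(x in (fun x => t *: x) @^-1` A) (g x)%:E)%E.
  rewrite -ge0_integralZl//; first last.
  - by rewrite lee_fin ltW.
  - by move=> x _; rewrite lee_fin.
  - by apply/measurable_EFinP; exact: measurable_funTS.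
  rewrite [RHS]integral_mkcond; apply: eq_integral => x _; rewrite /F patchE indicE /=.
  rewrite tV scalerA mulVf ?gt_eqF// scale1r.
  have -> : (t *: x \in A) = (x \in (fun x => t *: x) @^-1` A) by apply/idP/idP => /set_mem h; exact/mem_set.
  by case: ifP => _; rewrite ?mul1r ?mul0r.
rewrite exprS mulrC EFinM -muleA => ->.
by rewrite muleA -EFinM -exprMn divff ?gt_eqF// expr1n mul1e.
Qed.

(** The dilate [e^{-r} shell] meets the cube of radius [M] only if [e^{-r} <= M], so only
    [r >= - ln a] contributes. There [e^{-nr} <= a^n], and the remaining factor [e^{-r}] is
    integrable. The maximum with 1 in [a] makes the logarithm meaningful. *)
Lemma dilation_avg_finite (M : R) : (forall x, ~ shell x -> g x = 0) ->
  (\int[lam]_x (g x)%:E < +oo)%E ->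
  (\int[lam]_(y in [set y : E | (`|y| <= M)%R]) dilation_avg g y < +oo)%E.
Proof.
move=> gD gfin; set A := [set y : E | _].
have mA : measurable A by exact: measurable_norm_le.
have [mI <-] := integral_dilation_avg mA.
pose a := Num.max M 1; have a0 : 0 < a by rewrite lt_max ltr01 orbT.
set H := (\int[lam]_x (g x)%:E)%E in gfin.
have H0 : (0 <= H)%E by apply: integral_ge0 => x _; rewrite lee_fin.
apply: (@le_lt_trans _ _ (\int[leb]_(r in `[(- ln a)%R, +oo[) (((a ^+ n)%:E * H) * (expR (- r))%:E))%E); last first.
  rewrite ge0_integralZl//; first last.
  - by rewrite mule_ge0// lee_fin exprn_ge0// ltW.
  - apply/measurable_EFinP; apply: measurable_funTS; apply: measurableT_comp => //.
  rewrite integral_expN opprK lnK ?posrE//.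
  rewrite -(fineK (_ : H \is a fin_num)) ?ge0_fin_numE//.
  by rewrite -!EFinM ltry.
rewrite [leRHS]integral_mkcond; apply: ge0_le_integral => //.
- by move=> r _; apply: integral_ge0 => y _; exact: (k0 (y, r)).
- apply/measurable_restrict => //; apply: measurable_funTS; apply: measurable_funeM.
  by apply/measurable_EFinP; apply: measurableT_comp.
move=> r _; rewrite integral_dilation_scaling// patchE.
have t0 := expR_gt0 (- r).
have [ta|ta] := leP (expR (- r)) a; last first.
  rewrite [X in (_ * X)%E]integral0_eq ?mule0.
    by case: ifP => // _; rewrite !mule_ge0// lee_fin ?expR_ge0// exprn_ge0// ltW.
  move=> x /= xA; rewrite gD// /shell /= => /andP[x1 _].
  move: xA; rewrite /A/= normrZ gtr0_norm// leNgt => /negP; apply.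
  rewrite (@le_lt_trans _ _ a)//; first by rewrite le_max lexx.
  by rewrite (lt_le_trans ta)// ler_peMr// ltW.
rewrite mem_set; last first.
  by rewrite /= in_itv/= andbT lerNl -ler_expR lnK ?posrE.
have le1 : (\int[lam]_(x in (fun x => expR (- r) *: x) @^-1` A) (g x)%:E <= H)%E.
  apply: ge0_subset_integral => //.
  - rewrite -[X in measurable X]setTI.
    exact: (continuous_measurable_map (@continuous_scaling R n _)).
  - by apply/measurable_EFinP.
  - by move=> x _; rewrite lee_fin.
rewrite exprSr EFinM muleAC; apply: lee_wpmul2r; first by rewrite lee_fin ltW.
apply: lee_pmul => //.
- by apply: integral_ge0 => x _; rewrite lee_fin.
- by rewrite lee_fin lerXn2r// nnegrE ltW.
Qed.

Lemma dilation_avg_homogeneous : homogeneous1 (fun y => fine (dilation_avg g y)).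
Proof.
move=> t y t0; rewrite -{1}(@lnK _ t) ?posrE// dilation_avgZ lnK ?posrE//.
(* Where the average is infinite, [fine] gives 0 at [y] and at its positive multiples alike, so
   homogeneity holds at every point. *)
by case: (dilation_avg g y) => [s| |]//=; rewrite mulr0 ?gt0_muley ?gt0_muleNy ?lte_fin.
Qed.

(** On a bounded set the average is integrable, hence finite almost everywhere, and [fine] changes
    it only on a null set. *)
Lemma dilation_avg_fine (M : R) (A : set E) : (forall x, ~ shell x -> g x = 0) ->
  (\int[lam]_x (g x)%:E < +oo)%E -> measurable A -> (forall x, A x -> `|x| <= M) ->
  (\int[lam]_(y in A) (fine (dilation_avg g y))%:E = \int[lam]_(y in A) dilation_avg g y)%E /\
  (\int[lam]_(y in A) dilation_avg g y < +oo)%E.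
Proof.
move=> gD gfin mA AM.
have Afin : (\int[lam]_(y in A) dilation_avg g y < +oo)%E.
  apply: le_lt_trans (dilation_avg_finite M gD gfin); apply: ge0_subset_integral => //.
  - exact: measurable_norm_le.
  - by apply: measurable_funTS; exact: measurable_dilation_avg.
  - by move=> x _; exact: dilation_avg_ge0.
split=> //.
have iA : lam.-integrable A (dilation_avg g).
  apply/integrableP; split; first by apply: measurable_funTS; exact: measurable_dilation_avg.
  by under eq_integral do rewrite gee0_abs ?dilation_avg_ge0//.
apply: ge0_ae_eq_integral => //.
- apply/measurable_EFinP; apply: measurable_funTS; apply: measurableT_comp => //.
  exact: measurable_dilation_avg.
- by apply: measurable_funTS; exact: measurable_dilation_avg.
- by move=> x _; rewrite lee_fin fine_ge0// dilation_avg_ge0.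
- by move=> x _; exact: dilation_avg_ge0.
have := integrable_ae mA iA; apply: filterS => x fx Ax.
by rewrite fineK//; exact: fx.
Qed.

End dilation_avg.

Lemma finite_on_bounded (m : {measure set E -> \bar R}) (A : set E) (M : R) :
  finite_on_compacts m -> measurable A -> (forall x, A x -> `|x| <= M) -> (m A < +oo)%E.
Proof.
move=> mf mA AM; apply: le_lt_trans (mf _ (@compact_cube R n M)).
by apply: le_measure; rewrite ?inE//; exact: measurable_norm_le.
Qed.

Section polar_decomposition.
Variables (p q : {measure set E -> \bar R}).
Hypotheses (pfin : finite_on_compacts p) (qfin : finite_on_compacts q).
Hypothesis pq_scale : forall (t : R) (A : set E), 0 < t -> measurable A ->
  ((t ^+ n.+1)%:E * p ((fun x => t *: x) @^-1` A) + q A =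
   (t ^+ n.+1)%:E * q ((fun x => t *: x) @^-1` A) + p A)%E.

(** The dilation by 2 fixes the origin, so its mass [a - b] satisfies [(2^{n+1} - 1)(a - b) = 0].
    This covers [n = 0], where the origin is not Lebesgue null. *)
Lemma homogeneous_origin : p [set (0 : E)] = q [set (0 : E)].
Proof.
have := @pq_scale 2 [set 0] ltac:(by []) measurable_origin.
have -> : (fun x : E => 2 *: x) @^-1` [set 0] = [set 0].
  by rewrite eqEsubset; split=> x /=; [move/eqP; rewrite scaler_eq0 pnatr_eq0/= => /eqP|move->; rewrite scaler0].
have fin (m : {measure set E -> \bar R}) : finite_on_compacts m -> m [set (0 : E)] \is a fin_num.
  move=> mf; rewrite ge0_fin_numE//.
  by apply: (@finite_on_bounded m _ 0) => // [|x ->]; [exact: measurable_origin|rewrite normr0].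
have fp := fin _ pfin; have fq := fin _ qfin.
rewrite -(fineK fp) -(fineK fq) -!EFinM -!EFinD => -[h]; congr EFin.
set a := fine _ in h *; set b := fine _ in h *.
have h2 : (2 ^+ n.+1 - 1) * (a - b) = 0 :> R by lra.
move/eqP : h2; rewrite mulf_eq0 !subr_eq0 => /orP[|/eqP//].
by rewrite -[X in _ == X](expr1n R n.+1) => /eqP/pexpIrn; rewrite !nnegrE => /(_ isT (ler0n R 2) ler01); lra.
Qed.

Variable h : E -> R.
Hypothesis mh : measurable_fun setT h.
Hypothesis ih : lam.-integrable setT (EFin \o h).
Hypothesis hE : forall A, measurable A ->
  (p (A `&` shell) + \int[lam]_(x in A) (Num.max (- h x) 0)%:E =
   q (A `&` shell) + \int[lam]_(x in A) (Num.max (h x) 0)%:E)%E.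

Let hp x := Num.max (h x) 0.
Let hm x := Num.max (- h x) 0.
Let mhp : measurable_fun setT hp. Proof. exact: measurable_maxr. Qed.
Let mhm : measurable_fun setT hm.
Proof. by apply: measurable_maxr => //; exact: measurableT_comp. Qed.
Let hp0 x : 0 <= hp x. Proof. by rewrite le_max lexx orbT. Qed.
Let hm0 x : 0 <= hm x. Proof. by rewrite le_max lexx orbT. Qed.

Let abs_fin : (\int[lam]_x `|h x|%:E < +oo)%E.
Proof. by have /integrableP[_] := ih. Qed.

Let hp_fin : (\int[lam]_x (hp x)%:E < +oo)%E.
Proof.
apply: le_lt_trans abs_fin; apply: ge0_le_integral => //.
- by move=> x _; rewrite lee_fin.
- exact/measurable_EFinP.
- by apply/measurable_EFinP; exact: measurableT_comp.
- by move=> x _; rewrite lee_fin ge_max ler_norm normr_ge0.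
Qed.

Let hm_fin : (\int[lam]_x (hm x)%:E < +oo)%E.
Proof.
apply: le_lt_trans abs_fin; apply: ge0_le_integral => //.
- by move=> x _; rewrite lee_fin.
- exact/measurable_EFinP.
- by apply/measurable_EFinP; exact: measurableT_comp.
- by move=> x _; rewrite lee_fin ge_max ler_normr lexx orbT normr_ge0.
Qed.

(* Compares the density of [p - q] on the shell with the one on its image under
   the dilation by [e^{-r}]; integrating over [r] covers each point but the
   origin with total mass 1 ([lebesgue_dilation_shell]). *)
Lemma dilation_density (A : set E) (r : R) : measurable A ->
  (\int[lam]_(y in A) (expR (- r) * hp (expR r *: y))%:E +
     q (A `&` [set y | shell (expR r *: y)]) =
   \int[lam]_(y in A) (expR (- r) * hm (expR r *: y))%:E +
     p (A `&` [set y | shell (expR r *: y)]))%E.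
Proof.
move=> mA; rewrite !integral_dilation_scaling//.
have t0 := expR_gt0 (- r).
have rV : expR r * expR (- r) = 1 by rewrite -expRD subrr expR0.
have md (s : R) := continuous_measurable_map (@continuous_scaling R n s).
set t := expR (- r) in t0 rV *; set D := [set y | _].
have mD : measurable D.
  by rewrite -[X in measurable X]setTI; apply: md => //; exact: measurable_shell.
pose B := (fun x : E => t *: x) @^-1` A.
have mB : measurable B by rewrite -[X in measurable X]setTI; exact: md.
have mAD : measurable (A `&` D) by exact: measurableI.
have mBD : measurable (B `&` shell) by apply: measurableI => //; exact: measurable_shell.
have BD : (fun x : E => t *: x) @^-1` (A `&` D) = B `&` shell.
  by rewrite /B /D eqEsubset; split=> x /=; rewrite scalerA rV scale1r.
have Dle x : D x -> `|x| <= t * expR 1.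
  rewrite /D /= /shell /= => /andP[_]; rewrite normrZ gtr0_norm ?expR_gt0// => hx.
  have -> : `|x| = t * (expR r * `|x|) by rewrite mulrA [t * _]mulrC rV mul1r.
  by rewrite ler_wpM2l// ltW.
have finA (m : {measure set E -> \bar R}) : finite_on_compacts m -> m (A `&` D) \is a fin_num.
  move=> mf; rewrite ge0_fin_numE//; apply: (@finite_on_bounded m _ (t * expR 1)) => //.
  by move=> x [_ /Dle].
have finB (m : {measure set E -> \bar R}) : finite_on_compacts m -> m (B `&` shell) \is a fin_num.
  move=> mf; rewrite ge0_fin_numE//; apply: (@finite_on_bounded m _ (expR 1)) => //.
  by move=> x [_ /andP[]].
have finI (g : E -> R) : measurable_fun setT g -> (forall x, 0 <= g x) ->
    (\int[lam]_x (g x)%:E < +oo)%E -> (\int[lam]_(x in B) (g x)%:E)%E \is a fin_num.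
  move=> mg g0 gfin; rewrite ge0_fin_numE; last by apply: integral_ge0 => x _; rewrite lee_fin.
  apply: le_lt_trans gfin; apply: ge0_subset_integral => //; first exact/measurable_EFinP.
  by move=> x _; rewrite lee_fin.
(* With [t = e^{-r}] and [B] the preimage of [A], homogeneity gives [(p - q)(A /\ D) = t^{n+1} (p -
   q)(B /\ shell)], and the density turns the last factor into the integral of [h] over [B]. All
   terms are finite, so this is real arithmetic. *)
have := pq_scale t0 mAD; rewrite BD; have := hE mB.
have f1 := finA _ pfin; have f2 := finA _ qfin; have f3 := finB _ pfin; have f4 := finB _ qfin.
have f5 := finI _ mhp hp0 hp_fin; have f6 := finI _ mhm hm0 hm_fin.
rewrite -[X in (_ + X = _)%E -> _](fineK f6) -[X in (_ = _ + X)%E -> _](fineK f5).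
rewrite -(fineK f3) -(fineK f4) -(fineK f1) -(fineK f2) -(fineK f5) -(fineK f6) -!EFinM -!EFinD.
move=> -[h1] -[h2]; congr EFin.
set P := fine (p (B `&` _)) in h1 h2; set Q := fine (q (B `&` _)) in h1 h2.
move: h1 h2; set P' := fine (p _); set Q' := fine (q _); set Hm := fine _; set Hp := fine _.
move=> h1 h2; have -> : Hp = P - Q + Hm by lra.
by rewrite mulrDr mulrBr; lra.
Qed.

(** Integral of [dilation_density] over [r]. The shell terms recover the masses away from the
    origin, and at the origin [p] and [q] agree. *)
Lemma dilation_avg_density (A : set E) : measurable A ->
  (\int[lam]_(y in A) dilation_avg hp y + q A = \int[lam]_(y in A) dilation_avg hm y + p A)%E.
Proof.
move=> mA.
have [mqA qA] := integral_dilation_shell qfin mA; have [mpA pA] := integral_dilation_shell pfin mA.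
have [mIp Ip] := integral_dilation_avg mhp hp0 mA.
have [mIm Im] := integral_dilation_avg mhm hm0 mA.
have := measurableI _ _ mA measurable_origin; move=> mA0.
have A0 : p (A `&` [set (0 : E)]) = q (A `&` [set (0 : E)]).
  have [A0|nA0] := pselect (A 0).
    by rewrite setIC setIidl ?homogeneous_origin// => x ->.
  by rewrite setIC (_ : _ `&` _ = set0) ?measure0// -subset0 => x [->].
have pE : p A = (p (A `\ (0%R : E)) + p (A `&` [set (0%R : E)]))%E := measureDI p mA measurable_origin.
have qE : q A = (q (A `\ (0%R : E)) + q (A `&` [set (0%R : E)]))%E := measureDI q mA measurable_origin.
rewrite pE qE.
have cancel (a b c a' b' : \bar R) : (a + b = a' + b' -> a + (b + c) = a' + (b' + c))%E.
  by move=> ab; rewrite !addeA ab.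
rewrite A0; apply: cancel; rewrite -qA -pA -Ip -Im.
rewrite -(ge0_integralD leb measurableT _ mIp _ mqA)// -?(ge0_integralD leb measurableT _ mIm _ mpA)//.
- by apply: eq_integral => r _; exact: dilation_density.
- by move=> r _; apply: integral_ge0 => y _; rewrite lee_fin mulr_ge0// expR_ge0.
- by move=> r _; apply: integral_ge0 => y _; rewrite lee_fin mulr_ge0// expR_ge0.
Qed.

End polar_decomposition.

(** [psi] is the difference of the averages of the positive and negative parts of the density on the
    shell. Each average is of a nonnegative function, so Tonelli's theorem suffices; the difference
    is formed only after passing to finite values. *)
Lemma radon_homogeneous_density T mu : gfun_eq T (@gfun_of_measure R n mu) ->
  (forall f t, test_function f -> 0 < t -> t ^+ n.+1 * T (scale_fun t f) = T f) ->
  (forall A, measurable A -> lam A = 0%E -> spos mu A = sneg mu A) ->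
  exists psi, [/\ homogeneous1 psi, locally_integrable_rV psi &
    gfun_eq T (gfun_of_fun psi)].
Proof.
move=> Tmu Tt ac; have pfin := @spos_finite _ _ mu; have qfin := @sneg_finite _ _ mu.
set p := spos mu in pfin ac; set q := sneg mu in qfin ac.
have pq_scale (t : R) (A : set E) : 0 < t -> measurable A ->
  ((t ^+ n.+1)%:E * p ((fun x => t *: x) @^-1` A) + q A =
   (t ^+ n.+1)%:E * q ((fun x => t *: x) @^-1` A) + p A)%E.
  by move=> t0; apply: (radon_scale_sets Tmu t0) => f tf; exact: Tt.
have shell_fin (m : {measure set E -> \bar R}) : finite_on_compacts m -> (m shell < +oo)%E.
  move=> mf; apply: (@finite_on_bounded m _ (expR 1)) => //; first exact: measurable_shell.
  by move=> x /andP[].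
have [h [mh hD ih hE]] := signed_density measurable_shell (shell_fin _ pfin) (shell_fin _ qfin) ac.
pose hp x := Num.max (h x) 0; pose hm x := Num.max (- h x) 0.
have mhp : measurable_fun setT hp by exact: measurable_maxr.
have mhm : measurable_fun setT hm by apply: measurable_maxr => //; exact: measurableT_comp.
have hp0 x : 0 <= hp x by rewrite le_max lexx orbT.
have hm0 x : 0 <= hm x by rewrite le_max lexx orbT.
have hpD x : ~ shell x -> hp x = 0 by move=> /hD; rewrite /hp => ->; rewrite maxxx.
have hmD x : ~ shell x -> hm x = 0 by move=> /hD; rewrite /hm => ->; rewrite oppr0 maxxx.
have fin (g : E -> R) : measurable_fun setT g -> (forall x, 0 <= g x) ->
    (forall x, g x <= `|h x|) -> (\int[lam]_x (g x)%:E < +oo)%E.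
  move=> mg g0 gh; have /integrableP[_] := ih; apply: le_lt_trans.
  apply: ge0_le_integral => //.
  - by move=> x _; rewrite lee_fin.
  - exact/measurable_EFinP.
  - by apply/measurable_EFinP; exact: measurableT_comp.
  - by move=> x _; rewrite lee_fin.
have hp_fin : (\int[lam]_x (hp x)%:E < +oo)%E.
  by apply: fin => // x; rewrite ge_max ler_norm normr_ge0.
have hm_fin : (\int[lam]_x (hm x)%:E < +oo)%E.
  by apply: fin => // x; rewrite ge_max ler_normr lexx orbT normr_ge0.
have dens := dilation_avg_density pfin qfin pq_scale mh ih hE.
pose u y := fine (dilation_avg hp y); pose v y := fine (dilation_avg hm y).
have mu_ : measurable_fun setT u by apply: measurableT_comp => //; exact: measurable_dilation_avg.
have mv : measurable_fun setT v by apply: measurableT_comp => //; exact: measurable_dilation_avg.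
have u0 y : 0 <= u y by rewrite fine_ge0// dilation_avg_ge0.
have v0 y : 0 <= v y by rewrite fine_ge0// dilation_avg_ge0.
have mM := @measurable_norm_le R n.
have lu M : (\int[lam]_(x in [set x : E | (`|x| <= M)%R]) `|u x|%:E < +oo)%E.
  under eq_integral do rewrite ger0_norm//.
  by have [-> ] := dilation_avg_fine mhp hp0 hpD hp_fin (mM M) (fun x => id).
have lv M : (\int[lam]_(x in [set x : E | (`|x| <= M)%R]) `|v x|%:E < +oo)%E.
  under eq_integral do rewrite ger0_norm//.
  by have [-> ] := dilation_avg_fine mhm hm0 hmD hm_fin (mM M) (fun x => id).
have iw (w : E -> R) f : measurable_fun setT w ->
    (forall M, \int[lam]_(x in [set x : E | (`|x| <= M)%R]) `|w x|%:E < +oo)%E ->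
    test_function f -> lam.-integrable setT (EFin \o (fun x => w x * f x)).
  by move=> mw lw; apply: (integrable_along (phi := id)).
exists (fun x => u x - v x); split.
- by move=> t x t0; rewrite /u /v !dilation_avg_homogeneous// mulrBr.
- split=> [|K cK]; first exact: measurable_funB.
  have [M _ hM] := compact_norm_le cK; have mK := compact_measurable_rV cK.
  apply: (@le_lt_trans _ _ (\int[lam]_(x in [set x : E | (`|x| <= M)%R]) (`|u x|%:E + `|v x|%:E))%E).
    apply: (@le_trans _ _ (\int[lam]_(x in [set x : E | (`|x| <= M)%R]) `|u x - v x|%:E)%E).
      apply: ge0_subset_integral => //.
      by apply/measurable_EFinP; apply: measurable_funTS; apply: measurableT_comp => //; exact: measurable_funB.
    apply: ge0_le_integral => //.
    + by apply/measurable_EFinP; apply: measurable_funTS; apply: measurableT_comp => //; exact: measurable_funB.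
    + by apply: emeasurable_funD; apply/measurable_EFinP; apply: measurable_funTS; exact: measurableT_comp.
    + by move=> x _; rewrite -EFinD lee_fin ler_normB.
  rewrite ge0_integralD//; first exact: lte_add_pinfty.
  + by apply/measurable_EFinP; apply: measurable_funTS; exact: measurableT_comp.
  + by apply/measurable_EFinP; apply: measurable_funTS; exact: measurableT_comp.
move=> f tf; rewrite Tmu// /gfun_of_measure -/p -/q.
have [nu_u [nuA nuf]] := weighted_pushforward lam (@measurable_id _ _ setT) mu_ u0.
have [nu_v [nvA nvf]] := weighted_pushforward lam (@measurable_id _ _ setT) mv v0.
have nufin : finite_on_compacts nu_u.
  move=> K cK; have [M _ hM] := compact_norm_le cK; rewrite nuA.
  by have [-> ] := dilation_avg_fine mhp hp0 hpD hp_fin (compact_measurable_rV cK) hM.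
have nvfin : finite_on_compacts nu_v.
  move=> K cK; have [M _ hM] := compact_norm_le cK; rewrite nvA.
  by have [-> ] := dilation_avg_fine mhm hm0 hmD hm_fin (compact_measurable_rV cK) hM.
have E12 A : measurable A -> measure_add nu_u q A = measure_add nu_v p A.
  apply: measure_box_unique => [a b|k]; last first.
    exact: (finite_on_cubes _ (finite_on_compactsD nufin qfin)).
  have mb := measurable_box a b; 
  transitivity (nu_u (box a b) + q (box a b))%E; first exact: measure_addE.
  transitivity (nu_v (box a b) + p (box a b))%E; last exact/esym/measure_addE.
  rewrite nuA nvA.
  have [-> _] := dilation_avg_fine mhp hp0 hpD hp_fin mb (@box_bounded R n a b).
  have [-> _] := dilation_avg_fine mhm hm0 hmD hm_fin mb (@box_bounded R n a b).
  exact: dens.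
have : \int[measure_add nu_u q]_x f x = \int[measure_add nu_v p]_x f x.
  by congr fine; apply: eq_measure_integral => A mA _; exact: E12.
rewrite !Rintegral_measure_add//.
rewrite (weighted_integral u0 (test_measurable tf) nuf) (weighted_integral v0 (test_measurable tf) nvf).
rewrite /gfun_of_fun => h12.
rewrite (_ : (fun x => (u x - v x) * f x) = (fun x => u x * f x - v x * f x)); last first.
  by apply/funext => x; rewrite mulrBl.
rewrite RintegralB//; [|exact: iw|exact: iw].
have lin (a b c d : R) : a + b = c + d -> d - b = a - c by clear; lra.
exact: lin.
Qed.

End homogeneous_density.

(** * Construction of the potential *)

Section poincare.
Variables (R : realType) (n : nat).
Local Notation E := 'rV[R]_n.
Local Notation lam := (lebesgue_rV R n).

(* Integrates the closed family [w] one coordinate at a time: [cutoff_prim] is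
   the transpose of integration in direction [i], and the part constant in that
   direction, seen by [cutoff_proj], is left to the remaining coordinates. *)
Fixpoint potential (w : 'I_n -> gfun R n) (s : seq 'I_n) : gfun R n :=
  if s is i :: s' then
    fun f => potential w s' (cutoff_proj i f) - w i (cutoff_prim i f)
  else @gfun0 R n.

Lemma radon_potential (w : 'I_n -> gfun R n) s :
  (forall i, radon (w i)) -> radon (potential w s).
Proof.
move=> rw; elim: s => [|i s IH] /=; first by rewrite radonE; exact: radon_null0.
apply: (radonD (radon_null_radon (radon_cutoff_proj i IH))).
by apply: radonN; exact: radon_null_radon (radon_cutoff_prim i (rw i)).
Qed.

(** In the direction [i] just integrated, [P d_i = 0] and [V d_i = id]. In another direction the
    derivative passes through both operators, closedness turns [w_i (d_l (V f))] into
    [w_l (d_i (V f))], and the homotopy formula reassembles [w_l f]. *)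
Lemma potential_partial (w : 'I_n -> gfun R n) s l f : (forall i, radon (w i)) ->
  (forall i j f, test_function f -> w i (partial j f) = w j (partial i f)) ->
  l \in s -> test_function f -> potential w s (partial l f) = - w l f.
Proof.
move=> rw cw; elim: s f => [//|i s IH] f; rewrite inE /= => ls tf.
have [li|li] := eqVneq l i.
  by rewrite li cutoff_proj_partial// cutoff_prim_partial// radon_zero ?sub0r//; exact: radon_potential.
rewrite (negbTE li)/= in ls.
have tP := test_cutoff_proj i tf; have tV := test_cutoff_prim i tf.
rewrite -partial_cutoff_proj_neq// -partial_cutoff_prim_neq// IH// cw//.
by rewrite partial_cutoff_prim// radon_sub// opprB addrA addNr sub0r.
Qed.

Lemma homogeneous_potential (w : 'I_n -> 'I_n -> gfun R n) :
  (forall j k, radon (w j k)) ->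
  (forall i j k f, test_function f -> w j k (partial i f) = w i k (partial j f)) ->
  (forall j f, test_function f -> \sum_k w j k (fun x => x ord0 k * f x) = 0) ->
  exists psi, [/\ homogeneous1 psi, locally_integrable_rV psi &
    forall j k f, test_function f ->
      w j k f = gfun_of_fun psi (partial k (partial j f))].
Proof.
move=> rw cw xw.
pose u k := potential (w^~ k) (enum 'I_n).
have ru k : radon (u k) by exact: radon_potential.
have du j k f : test_function f -> u k (partial j f) = - w j k f.
  have jn : j \in enum 'I_n by rewrite mem_enum.
  exact: (potential_partial (fun i => rw i k) (fun i l => cw l i k) jn).
pose T : gfun R n := fun f => \sum_k u k (fun x => x ord0 k * f x).
have rT : radon T by apply: radon_sum => k; exact: radon_mul.
have dT j f : test_function f -> T (partial j f) = - u j f.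
  move=> tf; have tdf := test_partial j tf.
  (* Leibniz' rule: [x_k d_j f = d_j (x_k f) - (k == j) f]. Summed over [k], the first terms cancel
     by the contraction hypothesis. *)
  have Tj k : u k (fun x => x ord0 k * partial j f x) =
      - w j k (fun x => x ord0 k * f x) - (k == j)%:R * u k f.
    have txf := test_coordM k tf.
    rewrite -du// -radon_scale// partial_coordM; last exact: test_smooth.
    rewrite radon_add//; [by rewrite addrAC subrr add0r| |exact: test_coordM].
    by apply: test_functionMr => //; exact: smooth_cst.
  rewrite /T; under eq_bigr do rewrite Tj.
  rewrite big_split/= !sumrN xw// oppr0 add0r (bigD1 j)//= eqxx mul1r big1 ?addr0// => k /negbTE->.
  by rewrite mul0r.
have eT f : test_function f -> T (euler f) = - n.+1%:R * T f.
  move=> tf; rewrite radon_test_sum//; last first.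
    by move=> j; apply: test_coordM; exact: test_partial.
  (* Moving [x_j] inside the derivative costs one [T f] per coordinate, [n] in all; the terms
     [u_j (x_j f)] add up to one more. *)
  have Tj j : T (fun x => x ord0 j * partial j f x) = - u j (fun x => x ord0 j * f x) - T f.
    rewrite -dT; last exact: test_coordM.
    rewrite partial_coordM; last exact: test_smooth.
    rewrite [X in _ = T X - _](_ : _ = (fun x => f x + x ord0 j * partial j f x)); last first.
      by apply/funext => x; rewrite eqxx mul1r.
    have cancel (a b : R) : a = b + a - b by rewrite addrAC subrr add0r.
    rewrite (radon_add rT tf (test_coordM j (test_partial j tf))).
    exact: cancel.
  under eq_bigr do rewrite Tj.
  rewrite big_split/= !sumrN -/(T f) sumr_const card_ord -[in RHS]addn1 natrD.
  by rewrite -mulr_natl; ring.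
have [mu Tmu] := rT.
have [||psi [hpsi lpsi Tpsi]] := radon_homogeneous_density Tmu.
- by move=> f t tf t0; exact: radon_euler_scale.
- apply: (radon_partial_ac Tmu) => i; apply: radon_eq (ru i) => f tf.
  by rewrite /gfun_partial dT// opprK.
exists psi; split=> // j k f tf; have tjf := test_partial j tf.
by rewrite -Tpsi; [rewrite dT// du// opprK|exact: test_partial].
Qed.

Lemma Rintegral_scaling (F : E -> R) (t : R) : 0 < t -> measurable_fun setT F ->
  \int[lam]_x F (t *: x) = t^-1 ^+ n * \int[lam]_x F x.
Proof.
move=> t0 mF; have c0 : 0 < t^-1 ^+ n by rewrite exprn_gt0// invr_gt0.
have mEF : measurable_fun setT (EFin \o F) by exact/measurable_EFinP.
have mp := measurable_funepos mEF; have mn := measurable_funeneg mEF.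
have E1 := lebesgue_integral_scaling t0 mp (@funepos_ge0 _ _ (EFin \o F)).
have E2 := lebesgue_integral_scaling t0 mn (@funeneg_ge0 _ _ (EFin \o F)).
rewrite /Rintegral integralE [in RHS]integralE.
rewrite (_ : (\int[lam]_x (_^\+)%E x)%E = (\int[lam]_x ((EFin \o F)^\+)%E (t *: x))%E); last first.
  by apply: eq_integral => x _; rewrite !funeposE.
rewrite (_ : (\int[lam]_x (_^\-)%E x)%E = (\int[lam]_x ((EFin \o F)^\-)%E (t *: x))%E); last first.
  by apply: eq_integral => x _; rewrite !funenegE.
(* Non-integrable [F] are covered too: a positive factor preserves infinite values, and [fine] sends
   both sides to 0. *)
rewrite E1 E2; move: (integral _ _ _) (integral _ _ _) => [a| |] [b| |] /=;
  rewrite ?gt0_muley ?gt0_muleNy ?lte_fin//= ?mulr0// -mulrBr//.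
Qed.

Lemma gfun_of_fun_radon (psi : E -> R) : locally_integrable_rV psi ->
  radon (gfun_of_fun psi).
Proof.
move=> [mpsi lpsi]; have [|nu nuE] := signed_pushforward_id (m := lam) mpsi.
  by move=> M; apply: lpsi; exact: compact_cube.
by exists nu => f tf; rewrite nuE.
Qed.

Lemma integrable_gfun_of_fun (psi : E -> R) f : locally_integrable_rV psi ->
  test_function f -> lam.-integrable setT (EFin \o (fun x => psi x * f x)).
Proof.
move=> [mpsi lpsi] tf; apply: (integrable_along (phi := id)) => // M.
by apply: lpsi; exact: compact_cube.
Qed.

(** Changing variables in [t^{n+1} T (f (t x))] spends [t^n] on the Jacobian and one [t] on the
    homogeneity of [psi], leaving [T f]; then differentiate in [t]. *)
Lemma homogeneous_euler (psi : E -> R) f : homogeneous1 psi ->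
  locally_integrable_rV psi -> test_function f ->
  gfun_of_fun psi (euler f) = - n.+1%:R * gfun_of_fun psi f.
Proof.
move=> hpsi lpsi tf; apply: radon_scale_euler => // [|t t0]; first exact: gfun_of_fun_radon.
have mF : measurable_fun setT (fun x => psi x * f x).
  by apply: measurable_funM; [exact: lpsi.1|exact: test_measurable].
have sE := Rintegral_scaling t0 mF.
rewrite /gfun_of_fun -[RHS](mulVKf (_ : t ^+ n != 0)); last by rewrite expf_neq0// gt_eqF.
rewrite -exprVn -sE exprSr -mulrA; congr (_ * _).
rewrite -RintegralZl//; last first.
  apply: integrable_gfun_of_fun => //; exact: test_scale_fun.
by apply: eq_Rintegral => x _; rewrite hpsi// mulrA.
Qed.

End poincare.

(** * Components of currents of bidegree (1,1) *)

Section supercurrent_components.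
Variables (R : realType) (n : nat).
Local Notation E := 'rV[R]_n.
Implicit Types (a omega : superform R n) (T : gfun R n) (f : E -> R).

Lemma d_sharp_set1 T k f : d_sharp T finset.set0 [set k]%SET f = - T (partial k f).
Proof.
rewrite /d_sharp eqxx (big_pred1 k) // => j.
by rewrite (inj_eq set1_inj) eq_sym.
Qed.

Lemma ext_d_set1 a j K f : ext_d a [set j]%SET K f = - a finset.set0 K (partial j f).
Proof.
rewrite /ext_d big_set1 /gfun_partial finset.setDv /sort_sign (_ : [set i in _ | _] = finset.set0).
  by rewrite cards0 expr0 mul1r.
by apply/setP => i; rewrite !inE; case: eqVneq => [->|]; rewrite ?ltnn.
Qed.

Lemma ext_d_set2 a (i j : 'I_n) K f : (i < j)%N -> ext_d a [set i; j]%SET K f =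
  a [set i]%SET K (partial j f) - a [set j]%SET K (partial i f).
Proof.
move=> ij; have ji : j != i by rewrite -val_eqE /= gtn_eqF.
rewrite /ext_d big_setU1 ?inE 1?eq_sym//= big_set1 /gfun_partial.
rewrite (_ : [set i; j] :\ i = [set j])%SET; last first.
  by apply/setP => l; rewrite !inE; case: eqVneq => [->|]//=; rewrite (negbTE (_ : i != j)) 1?eq_sym.
rewrite (_ : [set i; j] :\ j = [set i])%SET; last first.
  by apply/setP => l; rewrite !inE; case: eqVneq => [->|]//=; rewrite ?(negbTE ji) ?orbF.
rewrite /sort_sign (_ : [set l : 'I_n in _ | (l < i)%N]%SET = finset.set0); last first.
  apply/setP => l; rewrite !inE; apply/negP => /andP[/orP[]/eqP->]; first by rewrite ltnn.
  by rewrite ltnNge ltnW.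
rewrite (_ : [set l : 'I_n in _ | (l < j)%N] = [set i])%SET; last first.
  apply/setP => l; rewrite !inE; case: (eqVneq l i) => [->|] //=.
  by case: (eqVneq l j) => [->|]//=; rewrite ltnn.
by rewrite cards0 cards1 expr0 expr1 mul1r mulN1r opprK addrC.
Qed.

Lemma ext_d_d_sharp T j k f : ext_d (d_sharp T) [set j]%SET [set k]%SET f =
  T (partial k (partial j f)).
Proof. by rewrite ext_d_set1 d_sharp_set1 opprK. Qed.

Lemma delta_sharp_set0 a j f : delta_sharp a [set j]%SET finset.set0 f =
  - \sum_k a [set j]%SET [set k]%SET (fun x => x ord0 k * f x).
Proof.
rewrite /delta_sharp -sumrN; apply: eq_big => [k|k _]; first by rewrite inE.
rewrite /sort_sign (_ : [set i in _ | _] = finset.set0); last by apply/setP => i; rewrite !inE.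
by rewrite cards0 cards1 expr0 expr1 mulr1 mulN1r /gfun_mul finset.setU0.
Qed.

(** With [g = d_j f], Leibniz' rule gives [d_k d_j (x_k f) = x_k d_k g + g + (k == j) d_k f].
    Summing over [k] yields [euler g + n g + g], on which [T] vanishes. *)
Lemma radon_contraction T j f : radon T ->
  (forall g, test_function g -> T (euler g) = - n.+1%:R * T g) -> test_function f ->
  \sum_k T (partial k (partial j (fun x => x ord0 k * f x))) = 0.
Proof.
move=> rT eT tf; have tg := test_partial j tf; set g := partial j f in tg.
have Tk k : T (partial k (partial j (fun x => x ord0 k * f x))) =
    T (fun x => x ord0 k * partial k g x) + T g + (k == j)%:R * T (partial k f).
  have tkf := test_partial k tf; have txg := test_coordM k (test_partial k tg).
  have tc : test_function (fun x => (k == j)%:R * partial k f x).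
    by apply: test_functionMr => //; exact: smooth_cst.
  rewrite -(radon_scale _ rT tkf) -(radon_add rT txg tg).
  rewrite -(radon_add rT (test_functionD txg tg) tc); congr T.
  rewrite (partial_coordM j k (test_smooth tf)) partialD; last 2 first.
    by apply: smoothM; [exact: smooth_cst|exact: test_smooth].
    exact: test_smooth (test_coordM k tg).
  rewrite (partialM k (smooth_cst (k == j)%:R) (test_smooth tf)).
  rewrite (partial_coordM k k (smooth_partial j (test_smooth tf))).
  apply/funext => x; rewrite partial_cst eqxx mul1r mulr0 addr0 /g.
  by rewrite addrC [X in X + _]addrC.
under eq_bigr do rewrite Tk.
rewrite !big_split/= -(radon_test_sum _ rT); last first.
  by move=> k; apply: test_coordM; exact: test_partial.
rewrite -[X in T X]/(euler g) eT//.
rewrite sumr_const card_ord (bigD1 j)//= eqxx mul1r big1 ?addr0 => [|k /negbTE->]; last by rewrite mul0r.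
by rewrite -/g -mulr_natl -natr1; ring.
Qed.

Lemma current_set1 omega (I K : {set 'I_n}) f : is_current 1 1 omega -> test_function f ->
  ~~ ((#|I| == 1) && (#|K| == 1))%N -> omega I K f = 0.
Proof. by move=> co tf IK; have := co I K; rewrite (negbTE IK); apply. Qed.

(** Only components with two indices in [J] and one in [K] can be nonzero, and there the signs leave
    the difference of two crossed derivatives, antisymmetric in the two indices of [J]. *)
Lemma current_ext_d0 omega : is_current 1 1 omega ->
  (forall i j k f, test_function f ->
    omega [set j]%SET [set k]%SET (partial i f) =
    omega [set i]%SET [set k]%SET (partial j f)) <->
  superform_eq (ext_d omega) superform0.
Proof.
move=> co; split=> [h J K f tf|h i j k f tf]; last first.
  wlog ij : i j / (i < j)%N => [hw|].
    by have [ij|ji|/val_inj->] := ltngtP i j; [exact: hw|apply/esym/hw|].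
  apply/esym/eqP; rewrite -subr_eq0; apply/eqP.
  by rewrite -(ext_d_set2 _ _ _ ij); exact: h.
rewrite /superform0 /gfun0; have [/cards1P[k ->]|K1] := boolP (#|K| == 1)%N; last first.
  rewrite /ext_d big1// => j jJ; rewrite /gfun_partial current_set1// ?oppr0 ?mulr0//.
    exact: test_partial.
  by rewrite (negbTE K1) andbF.
have [/cards2P[i [j [ij ->]]]|J2] := boolP (#|J| == 2)%N.
  wlog lij : i j ij / (i < j)%N => [hw|].
    have [lij|lji|/val_inj eij] := ltngtP i j; first exact: hw.
      by rewrite finset.setUC; apply: hw => //; rewrite eq_sym.
    by rewrite eij eqxx in ij.
  by rewrite ext_d_set2// h// subrr.
rewrite /ext_d big1// => j jJ; rewrite /gfun_partial current_set1// ?oppr0 ?mulr0//.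
  exact: test_partial.
by move: J2; rewrite (cardsD1 j J) jJ add1n eqSS => /negbTE->.
Qed.

(** Contraction leaves no [dxi], so only [L] empty matters: for other [L] the set [k |: L] has at
    least two elements and the coefficient vanishes. *)
Lemma current_delta_sharp0 omega : is_current 1 1 omega ->
  (forall j f, test_function f ->
    \sum_k omega [set j]%SET [set k]%SET (fun x => x ord0 k * f x) = 0) <->
  superform_eq (delta_sharp omega) superform0.
Proof.
move=> co; split=> [h I L f tf|h j f tf]; last first.
  have := h [set j]%SET finset.set0 f tf; rewrite delta_sharp_set0 => /eqP.
  by rewrite oppr_eq0 => /eqP.
rewrite /superform0 /gfun0; have [/cards1P[j ->]|I1] := boolP (#|I| == 1)%N; last first.
  rewrite /delta_sharp big1// => k _; rewrite /gfun_mul current_set1// ?mulr0//.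
    exact: test_coordM.
  by rewrite (negbTE I1).
have [->|L0] := eqVneq L finset.set0; first by rewrite delta_sharp_set0 h// oppr0.
rewrite /delta_sharp big1// => k kL; rewrite /gfun_mul current_set1// ?mulr0//.
  exact: test_coordM.
by rewrite cards1 eqxx /= cardsU1 kL add1n eqSS cards_eq0 (negbTE L0).
Qed.

Lemma current_dd_sharp omega T : is_current 1 1 omega -> T (fun=> 0) = 0 ->
  (forall j k f, test_function f ->
    omega [set j]%SET [set k]%SET f = T (partial k (partial j f))) <->
  superform_eq omega (ext_d (d_sharp T)).
Proof.
move=> co T0; split=> [h I K f tf|h j k f tf]; last by rewrite h// ext_d_d_sharp.
have [/cards1P[j ->]|I1] := boolP (#|I| == 1)%N; last first.
  rewrite current_set1//; last by rewrite (negbTE I1).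
  rewrite /ext_d big1// => j jI; rewrite /gfun_partial /d_sharp ifF ?oppr0 ?mulr0//.
  by apply/negbTE; move: I1; rewrite (cardsD1 j I) jI add1n eqSS cards_eq0.
have [/cards1P[k ->]|K1] := boolP (#|K| == 1)%N; first by rewrite h// ext_d_d_sharp.
rewrite current_set1//; last by rewrite (negbTE K1) andbF.
rewrite ext_d_set1 /d_sharp eqxx big_pred0 ?oppr0// => k.
by apply/negbTE; move: K1; apply: contra => /eqP->; rewrite cards1.
Qed.

End supercurrent_components.

Theorem proposition7p2 (R : realType) (n : nat) (omega : superform R n)
    (omega_current : is_current 1 1 omega) :
  (exists psi : 'rV[R]_n -> R,
     [/\ homogeneous1 psi, locally_integrable_rV psi &
         superform_eq omega (ext_d (d_sharp (gfun_of_fun psi)))]) <->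
  (superform_eq (ext_d omega) superform0 /\
   superform_eq (delta_sharp omega) superform0).
Proof.
split=> [[psi [hpsi lpsi dpsi]]|]; last first.
  move=> [/(current_ext_d0 omega_current) dw /(current_delta_sharp0 omega_current) xw].
  have [|psi [hpsi lpsi wpsi]] := @homogeneous_potential R n (fun j k => omega [set j]%SET [set k]%SET) _ dw xw.
    by move=> j k; have := omega_current [set j]%SET [set k]%SET; rewrite !cards1.
  exists psi; split=> //; apply/current_dd_sharp => //.
  by rewrite radon_zero//; exact: gfun_of_fun_radon.
have rpsi := gfun_of_fun_radon lpsi.
have {dpsi}wE : forall j k f, test_function f ->
    omega [set j]%SET [set k]%SET f = gfun_of_fun psi (partial k (partial j f)).
  by apply/current_dd_sharp => //; exact: radon_zero.
split; [apply/(current_ext_d0 omega_current) => i j k f tf|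
  apply/(current_delta_sharp0 omega_current) => j f tf].
  rewrite (wE _ _ _ (test_partial i tf)) (wE _ _ _ (test_partial j tf)).
  by rewrite (partial_comm j i tf).
under eq_bigr do rewrite (wE _ _ _ (test_coordM _ tf)).
apply: radon_contraction => // g tg; exact: homogeneous_euler.
Qed.
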